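(* Let $(\mathbb P^{s,x})_{(s,x)\in[0,T]\times E}$ be a canonical Markov class associated to a transition kernel measurable in time, solving the martingale problem associated to $(\mathcal D(a),a,V)$. Let $\psi=(\psi_1,\dots,\psi_d)\in\mathcal D(a)^d$ be such that for every $i$: $\langle M[\psi_i]^{s,x}\rangle$ is absolutely continuous with respect to $V$ under every $\mathbb P^{s,x}$; $a(\psi_i)\in\mathcal L^2_X$; and $\mathfrak G^{\psi_i}(\psi_i)$ is bounded. Let $\zeta,\eta:E\to\mathbb R_+$ be Borel such that the class satisfies $H^{mom}(\zeta,\eta)$, and let $(f,g)$ satisfy $H^{growth}(\zeta,\eta)$. Then every decoupled mild solution of $Pseudo\text{-}PDE(f,g)$ is a martingale solution. Moreover, if $(u,v)$ solves $IP(f,g)$, then $v=\mathfrak G^\psi(u)$ up to zero potential sets.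
   Context: **Canonical Markov class.** $E$ is a Polish space, $\Omega$ the space of càdlàg functions $[0,T]\to E$, $X$ the canonical process, $\mathcal F=\sigma(X_r:r\in[0,T])$, $\mathcal F_t=\bigcap_{u\in]t,T]}\sigma(X_r:r\le u)$ for $t<T$, $\mathcal F_T=\mathcal F$. A transition kernel $P=(P_{s,t})$ is a family of Markov kernels on $E$ with $P_{s,t}(x,A)=\mathbf 1_A(x)$ if $t\le s$ and $\int P_{s,t}(x,dy)P_{t,u}(y,A)=P_{s,u}(x,A)$ for $s<t<u$; it is measurable in time if $(s,x)\mapsto P_{s,t}(x,A)$ is Borel for all $t,A$. A canonical Markov class associated to $P$ is a family of probabilities $\mathbb P^{s,x}$ on $(\Omega,\mathcal F)$ with $\mathbb P^{s,x}(X_t\in A)=P_{s,t}(x,A)$ for all $t,A$, and $\mathbb P^{s,x}(X_u\in A\mid\mathcal F_t)=P_{t,u}(X_t,A)$ $\mathbb P^{s,x}$-a.s. for $s\le t\le u$. $(\mathcal F^{s,x},(\mathcal F^{s,x}_t))$ are the $\mathbb P^{s,x}$-completions; martingales under $\mathbb P^{s,x}$ refer to this basis. $P_{s,t}[\phi](x)=\int\phi(y)P_{s,t}(x,dy)$. **Martingale problem.** $V:[0,T]\to\mathbb R_+$ is non-decreasing, continuous, $V_0=0$; $\mathcal D(a)$ is a linear space of Borel functions $[0,T]\times E\to\mathbb R$ and $a$ a linear operator from $\mathcal D(a)$ to the Borel functions. The class solves the martingale problem for $(\mathcal D(a),a,V)$ if for all $(s,x)$: $\mathbb P^{s,x}(X_t=x\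 \forall t\in[0,s])=1$, and for every $\phi\in\mathcal D(a)$, $\phi(\cdot,X_\cdot)-\int_s^\cdot a(\phi)(r,X_r)dV_r$ on $[s,T]$ is a càdlàg square integrable $\mathbb P^{s,x}$-martingale. $M[\phi]^{s,x}:=\mathbf 1_{[s,T]}(\phi(\cdot,X_\cdot)-\phi(s,x)-\int_s^\cdot a(\phi)(r,X_r)dV_r)$. $\mathcal H^2_0$: square integrable martingales vanishing at $0$. $\langle\cdot,\cdot\rangle$: predictable angle bracket. **Extended operators.** A Borel set $A\subset[0,T]\times E$ is of zero potential if $\mathbb E^{s,x}[\int_s^T\mathbf 1_{\{(t,X_t)\in A\}}dV_t]=0$ for all $(s,x)$. For $p>0$, $\mathcal L^p_X$ is the set of Borel $\phi:[0,T]\times E\to\mathbb R$ with $\mathbb E^{s,x}[\int_s^T|\phi|^p(r,X_r)dV_r]<\infty$ for all $(s,x)$; $\mathcal L^0_X$ the set of those with $\int_s^T|\phi|(r,X_r)dV_r<\infty$ $\mathbb P^{s,x}$-a.s. for all $(s,x)$; $L^p_X$ is the quotient by functions vanishing outside a zero potential set. $\mathcal D(\mathfrak a)$ is the set of Borel $\phi$ for which there is $\chi\in\mathcal L^0_X$ such that under every $\mathbb P^{s,x}$ the process $\mathbf 1_{[s,T]}(\phi(\cdot,X_\cdot)-\phi(s,x)-\int_s^\cdot\chi(r,X_r)dV_r)$ has a càdlàg modification in $\mathcal H^2_0$; $\chi$ is unique up to zero potential sets, $\mathfrak a(\phi)\in L^0_X$ denotes its class, and $M[\phi]^{s,x}$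 that càdlàg modification (if $\phi\in\mathcal D(a)$, then $\chi=a(\phi)$ up to zero potential sets and this modification is the process $\mathbf 1_{[s,T]}(\phi(\cdot,X_\cdot)-\phi(s,x)-\int_s^\cdot a(\phi)(r,X_r)dV_r)$, so the notation $M[\phi]^{s,x}$ is unambiguous). Under the absolute continuity of the $\langle M[\psi_i]^{s,x}\rangle$ with respect to $V$, for $\phi\in\mathcal D(\mathfrak a)$, $\mathfrak G^{\psi_i}(\phi)$ is the Borel function, unique up to zero potential sets, with $\langle M[\phi]^{s,x},M[\psi_i]^{s,x}\rangle=\int_s^{\cdot\vee s}\mathfrak G^{\psi_i}(\phi)(r,X_r)dV_r$ under every $\mathbb P^{s,x}$; $\mathfrak G^\psi=(\mathfrak G^{\psi_1},\dots,\mathfrak G^{\psi_d})$. **Hypotheses.** $H^{mom}(\zeta,\eta)$: $\mathbb E^{s,x}[\zeta^2(X_T)]<\infty$ and $\mathbb E^{s,x}[\int_0^T\eta^2(X_r)dV_r]<\infty$ for all $(s,x)$. $H^{growth}(\zeta,\eta)$: $f:[0,T]\times E\times\mathbb R\times\mathbb R^d\to\mathbb R$, $g:E\to\mathbb R$ are Borel and for some positive constants, $|g(x)|\le C(1+\zeta(x))$ and $|f(t,x,y,z)|\le C'(1+\eta(x)+|y|+\|z\|)$. **Notions of solution.** $Pseudo\text{-}PDE(f,g)$ is the equation $a(u)+f(\cdot,\cdot,u,\Gamma^\psi(u))=0$ on $[0,T]\times E$, $u(T,\cdot)=g$, where $\Gamma^\psi(u)=(a(u\psi_i)-ua(\psi_i)-\psi_ia(u))_{i\le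 d}$. A Borel function $u$ is a martingale solution if $u\in\mathcal D(\mathfrak a)$, $\mathfrak a(u)=-f(\cdot,\cdot,u,\mathfrak G^\psi(u))$ in $L^0_X$, and $u(T,\cdot)=g$ pointwise. A couple of Borel functions $u:[0,T]\times E\to\mathbb R$, $v=(v_1,\dots,v_d):[0,T]\times E\to\mathbb R^d$ is a solution of $IP(f,g)$ if $u,v_1,\dots,v_d\in\mathcal L^2_X$ and for every $(s,x)$ and every $i\in\{1,\dots,d\}$, $$u(s,x)=P_{s,T}[g](x)+\int_s^TP_{s,r}[f(\cdot,\cdot,u,v)(r,\cdot)](x)dV_r,$$ $$u\psi_i(s,x)=P_{s,T}[g\psi_i(T,\cdot)](x)-\int_s^TP_{s,r}[(v_i+ua(\psi_i)-\psi_if(\cdot,\cdot,u,v))(r,\cdot)](x)dV_r,$$ where $f(\cdot,\cdot,u,v)(t,x)=f(t,x,u(t,x),v(t,x))$. $u$ is a decoupled mild solution of $Pseudo\text{-}PDE(f,g)$ if there is $v$ such that $(u,v)$ solves $IP(f,g)$. *)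

(* Defs.v *)
From HB Require Import structures.
From mathcomp Require Import all_boot all_order all_algebra.
From mathcomp Require Import all_classical all_reals all_analysis.
From mathcomp Require Import measurable_realfun.
Import Order.TTheory GRing.Theory Num.Theory.
Import numFieldNormedType.Exports.

Set Implicit Arguments.
Unset Strict Implicit.
Unset Printing Implicit Defensive.

Local Open Scope classical_set_scope.
Local Open Scope ring_scope.

(* Conventions.  The time set [0,T] is a subset of R: a function on [0,T], on
   [0,T] x E, ... is represented by a function on R, on R x E, ..., of which
   only the values at times in [0,T] are ever used.  V is represented by a
   continuous nondecreasing extension of it to R, as required by
   [lebesgue_stieltjes_measure]; dV then has no atoms. *)

Section polish.
Context (R : realType) (E : topologicalType).

Definition complete_metric (d : E -> E -> R) : Prop :=
  [/\ forall x y, d x y = 0 <-> x = y,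
      forall x y, d x y = d y x,
      forall x y z, d x z <= d x y + d y z &
      forall u : nat -> E,
        (forall e, 0 < e -> exists N, forall m n, (N <= m)%N -> (N <= n)%N ->
          d (u m) (u n) < e) ->
        exists l : E, u @ \oo --> l].

Definition polish_space : Prop :=
  (exists2 D : set E, countable D & dense D) /\
  (exists2 d, complete_metric d &
    forall (x : E) (A : set E),
      nbhs x A <-> exists2 e : R, 0 < e & [set y | d x y < e] `<=` A).

End polish.

Notation borel E := (g_sigma_algebraType (@open E)).

Section cadlag.
Context (R : realType) (E : topologicalType).

Definition cadlag_on (a b : R) (f : R -> E) : Prop :=
  (forall t, a <= t < b -> f @ t^'+ --> f t) /\
  (forall t, a < t <= b -> exists l : E, f @ t^'- --> l).

(* Freezing paths outside [0,T] makes these functions on R correspond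
   bijectively to the cadlag functions [0,T] -> E. *)
Definition cadlag_paths (T : R) : set (R -> E) :=
  [set w | [/\ cadlag_on 0 T w,
               forall t, t <= 0 -> w t = w 0 &
               forall t, T <= t -> w t = w T]].

End cadlag.

Section canonical_space.
Context (R : realType) (E : ptopologicalType) (T : R).

Definition cadlag_space : Type := set_type (@cadlag_paths R E T).

HB.instance Definition _ := Choice.on cadlag_space.

Lemma cst_cadlag : (fun=> point : E) \in cadlag_paths T.
Proof.
rewrite inE; split=> //; split=> t _; first exact: cvg_cst.
by exists point; exact: cvg_cst.
Qed.

HB.instance Definition _ :=
  isPointed.Build cadlag_space (exist _ (fun=> point) cst_cadlag).

Definition path_cylinders (t : R) : set (set cadlag_space) :=
  [set C | exists2 r, 0 <= r <= t & exists2 B : set (borel E), measurable B &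
     C = [set w | B (\val w r)]].

Definition Omega := g_sigma_algebraType (path_cylinders T).

Definition X (t : R) (w : Omega) : borel E := \val w t.

Definition filtration (t : R) : set (set Omega) :=
  if t < T then \bigcap_(u in `]t, T]) <<s path_cylinders u >>
  else @measurable _ Omega.

End canonical_space.

Arguments Omega {R} E T.

(* Processes are adapted to completed filtrations, so a variable below may be
   measurable for the P-completion only.  \int[P] is defined for every function,
   through suprema over simple functions; on functions measurable for the
   completion of P it is the integral with respect to the completed P. *)
Section stochastic_processes.
Context d (W : measurableType d) (R : realType) (P : probability W R).
Implicit Types (G : set (set W)) (F : R -> set (set W)).

Definition measurable_wrt d' (S : measurableType d') G (Y : W -> S) : Prop :=
  forall B : set S, measurable B -> G (Y @^-1` B).

Definition is_cond_exp G (Y Z : W -> \bar R) : Prop :=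
  measurable_wrt G Z /\
  forall B, G B -> (\int[P]_(w in B) Z w = \int[P]_(w in B) Y w)%E.

Definition completion G : set (set W) :=
  [set A | exists2 B, G B & P.-negligible ((A `\` B) `|` (B `\` A))].

Definition martingale F (a b : R) (M : R -> W -> R) : Prop :=
  [/\ forall t, a <= t <= b -> measurable_wrt (F t) (M t),
      forall t, a <= t <= b -> (\int[P]_w `|M t w|%:E < +oo)%E &
      forall r t, a <= r -> r <= t -> t <= b ->
        is_cond_exp (F r) (EFin \o M t) (EFin \o M r)].

Definition sq_integrable_martingale F (a b : R) (M : R -> W -> R) : Prop :=
  martingale F a b M /\
  forall t, a <= t <= b -> (\int[P]_w ((M t w) ^+ 2)%:E < +oo)%E.

Definition H20 F (T : R) (M : R -> W -> R) : Prop :=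
  sq_integrable_martingale F 0 T M /\ \forall w \ae P, M 0 w = 0.

Definition cadlag_process (a b : R) (M : R -> W -> R) : Prop :=
  \forall w \ae P, cadlag_on a b (M ^~ w).

Definition modification (T : R) (M N : R -> W -> R) : Prop :=
  forall t, 0 <= t <= T -> \forall w \ae P, M t w = N t w.

Definition indistinguishable (T : R) (M N : R -> W -> R) : Prop :=
  \forall w \ae P, forall t, 0 <= t <= T -> M t w = N t w.

Definition predictable_sigma_algebra F (T : R) : set (set (R * W)) :=
  <<s `[0, T]%classic `*` [set: W],
      [set C | exists2 A, F 0 A & C = [set 0] `*` A] `|`
      [set C | exists r t, [/\ 0 <= r, r < t, t <= T &
         exists2 A, F r A & C = `]r, t]%classic `*` A]] >>.

Definition predictable F (T : R) (A : R -> W -> R) : Prop :=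
  forall B : set R, measurable B ->
    predictable_sigma_algebra F T
      [set z | 0 <= z.1 <= T /\ B (A z.1 z.2)].

(* A is (a version of) the predictable bracket <M, N> of M, N in H20. *)
Definition is_angle_bracket F (T : R) (M N A : R -> W -> R) : Prop :=
  [/\ predictable F T A,
      \forall w \ae P, A 0 w = 0,
      cadlag_process 0 T A,
      \forall w \ae P, bounded_variation 0 T (A ^~ w) &
      martingale F 0 T (fun t w => M t w * N t w - A t w)].

End stochastic_processes.

Section stieltjes.
Context (R : realType).

Definition dStieltjes (V : cumulative R R) :
    {measure set (measurableTypeR R) -> \bar R} :=
  lebesgue_stieltjes_measure V.

(* The nondecreasing right-continuous function A on [0,T] induces a measure dA
   on [0,T] (carried by ]0,T]) such that dA << dV. *)
Definition path_abs_continuous (V : cumulative R R) (T : R) (A : R -> R) :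
    Prop :=
  exists F : cumulative R R,
    [/\ forall t, 0 <= t <= T -> F t = A t,
        forall t, t <= 0 -> F t = A 0,
        forall t, T <= t -> F t = A T &
        dStieltjes F `<< dStieltjes V].

End stieltjes.

Section markov.
Context (R : realType) (E : ptopologicalType) (T : R).

Definition time_dom : set (measurableTypeR R * borel E) :=
  [set z | 0 <= z.1 <= T].

Definition borel_fun (phi : measurableTypeR R * borel E -> R) : Prop :=
  measurable_fun time_dom phi.

Section kernels.
Context (P : R -> R -> R.-pker (borel E) ~> (borel E)).

Definition transition_kernel : Prop :=
  (forall s t x (A : set (borel E)), 0 <= s <= T -> 0 <= t <= T -> t <= s ->
     measurable A -> P s t x A = \d_x A) /\
  (forall s t u x (A : set (borel E)), 0 <= s -> s < t -> t < u -> u <= T ->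
     measurable A -> (\int[P s t x]_y P t u y A = P s u x A)%E).

Definition measurable_in_time : Prop :=
  forall t (A : set (borel E)), 0 <= t <= T -> measurable A ->
    measurable_fun time_dom (fun z => P z.1 t z.2 A).

Definition transition_op (s t : R) (phi : borel E -> R) (x : borel E) :
    \bar R := (\int[P s t x]_y (phi y)%:E)%E.

Definition canonical_markov_class
    (PP : R -> borel E -> probability (Omega E T) R) : Prop :=
  (forall s x t (A : set (borel E)), 0 <= s <= T -> 0 <= t <= T ->
     measurable A -> PP s x [set w | A (X t w)] = P s t x A) /\
  (forall s x t u (A : set (borel E)), 0 <= s -> s <= t -> t <= u -> u <= T ->
     measurable A ->
     is_cond_exp (PP s x) (filtration t)
       (fun w => (\1_A (X u w))%:E) (fun w => P t u (X t w) A)).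

End kernels.

Section operators.
Context (V : cumulative R R) (PP : R -> borel E -> probability (Omega E T) R).
Implicit Types (phi chi psi h : measurableTypeR R * borel E -> R).

Local Notation dV := (dStieltjes V).

Definition completed_filtration (s : R) (x : borel E) (t : R) :
    set (set (Omega E T)) := completion (PP s x) (filtration t).

(* By the last clause, a phi on [0,T] x E only depends on phi on [0,T] x E. *)
Definition linear_operator
    (Da : set (measurableTypeR R * borel E -> R))
    (a : (measurableTypeR R * borel E -> R) ->
         (measurableTypeR R * borel E -> R)) : Prop :=
  [/\ Da (fun=> 0) /\
      (forall c phi psi, Da phi -> Da psi ->
         Da (fun z => c * phi z + psi z)),
      forall phi, Da phi -> borel_fun phi /\ borel_fun (a phi),
      forall c phi psi, Da phi -> Da psi ->
        forall z, time_dom z ->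
          a (fun z' => c * phi z' + psi z') z = c * a phi z + a psi z &
      forall phi psi, Da phi -> Da psi ->
        (forall z, time_dom z -> phi z = psi z) ->
        forall z, time_dom z -> a phi z = a psi z].

Definition zero_potential (A : set (measurableTypeR R * borel E)) : Prop :=
  [/\ measurable A, A `<=` time_dom &
      forall s x, 0 <= s <= T ->
        (\int[PP s x]_w \int[dV]_(t in `[s, T]) (\1_A (t, X t w))%:E = 0)%E].

Definition eq_zero_potential phi psi : Prop :=
  exists2 A, zero_potential A &
    forall z, time_dom z -> ~ A z -> phi z = psi z.

Definition L0X phi : Prop :=
  borel_fun phi /\
  forall s x, 0 <= s <= T ->
    \forall w \ae PP s x,
      (\int[dV]_(r in `[s, T]) `|phi (r, X r w)|%:E < +oo)%E.

Definition L2X phi : Prop :=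
  borel_fun phi /\
  forall s x, 0 <= s <= T ->
    (\int[PP s x]_w \int[dV]_(r in `[s, T])
       (`|phi (r, X r w)| ^+ 2)%:E < +oo)%E.

Definition dV_integral (s t : R) chi (w : Omega E T) : R :=
  \int[dV]_(r in `[s, t]) chi (r, X r w).

(* The clause [L0X (a phi)] is what makes the integral of a phi meaningful. *)
Definition solves_martingale_problem
    (Da : set (measurableTypeR R * borel E -> R))
    (a : (measurableTypeR R * borel E -> R) ->
         (measurableTypeR R * borel E -> R)) : Prop :=
  (forall s x, 0 <= s <= T ->
     PP s x [set w | forall t, 0 <= t <= s -> X t w = x] = 1%E) /\
  (forall phi, Da phi -> L0X (a phi) /\
     forall s x, 0 <= s <= T ->
       let M := fun t w => phi (t, X t w) - dV_integral s t (a phi) w in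
       cadlag_process (PP s x) s T M /\
       sq_integrable_martingale (PP s x) (completed_filtration s x) s T M).

(* M is a cadlag modification in H20 of
   1_[s,T] (phi(.,X) - phi(s,x) - int_s^. chi(r,X_r) dV_r). *)
Definition martingale_part_of phi chi (s : R) (x : borel E)
    (M : R -> Omega E T -> R) : Prop :=
  [/\ modification (PP s x) T M
        (fun t w => if s <= t then
           phi (t, X t w) - phi (s, x) - dV_integral s t chi w else 0),
      cadlag_process (PP s x) 0 T M &
      H20 (PP s x) (completed_filtration s x) T M].

(* The class of phi under the extended generator, as its set of versions; phi is
   in the extended domain when this set is nonempty. *)
Definition frak_a phi : set (measurableTypeR R * borel E -> R) :=
  [set chi | [/\ borel_fun phi, L0X chi &
     forall s x, 0 <= s <= T -> exists M, martingale_part_of phi chi s x M]].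

Definition frak_domain : set (measurableTypeR R * borel E -> R) :=
  [set phi | frak_a phi !=set0].

Definition martingale_part phi (s : R) (x : borel E)
    (M : R -> Omega E T -> R) : Prop :=
  exists2 chi, frak_a phi chi & martingale_part_of phi chi s x M.

Definition bracket_abs_continuous psi : Prop :=
  forall s x, 0 <= s <= T ->
    exists M A, [/\ martingale_part psi s x M,
      is_angle_bracket (PP s x) (completed_filtration s x) T M M A &
      \forall w \ae PP s x, path_abs_continuous V T (A ^~ w)].

(* The set of versions of G^psi(phi), a function defined up to zero potential
   sets. *)
Definition frakG psi phi : set (measurableTypeR R * borel E -> R) :=
  [set h | L0X h /\
     forall s x, 0 <= s <= T -> exists M N A,
       [/\ martingale_part phi s x M, martingale_part psi s x N,
           is_angle_bracket (PP s x) (completed_filtration s x) T M N A &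
           indistinguishable (PP s x) T A
             (fun t w => dV_integral s (Num.max t s) h w)]].

Definition Hmom (zeta eta : borel E -> R) : Prop :=
  forall s x, 0 <= s <= T ->
    (\int[PP s x]_w (zeta (X T w) ^+ 2)%:E < +oo)%E /\
    (\int[PP s x]_w \int[dV]_(r in `[0%R, T]) (eta (X r w) ^+ 2)%:E < +oo)%E.

Section pde.
Context (n : nat).

Definition euclidean_norm (z : n.-tuple R) : R :=
  Num.sqrt (\sum_(i < n) tnth z i ^+ 2).

Definition Hgrowth (zeta eta : borel E -> R)
    (f : measurableTypeR R * borel E * R * n.-tuple R -> R)
    (g : borel E -> R) : Prop :=
  [/\ measurable_fun [set q | 0 <= q.1.1.1 <= T] f,
      measurable_fun setT g,
      exists2 C, 0 < C & forall x, `|g x| <= C * (1 + zeta x) &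
      exists2 C', 0 < C' & forall t x y z, 0 <= t <= T ->
        `|f (t, x, y, z)| <= C' * (1 + eta x + `|y| + euclidean_norm z)].

Definition driver (f : measurableTypeR R * borel E * R * n.-tuple R -> R)
    (u : measurableTypeR R * borel E -> R)
    (v : 'I_n -> measurableTypeR R * borel E -> R)
    (z : measurableTypeR R * borel E) : R :=
  f (z, u z, [tuple v i z | i < n]).

Definition martingale_solution
    (psi : 'I_n -> measurableTypeR R * borel E -> R)
    (f : measurableTypeR R * borel E * R * n.-tuple R -> R) (g : borel E -> R)
    (u : measurableTypeR R * borel E -> R) : Prop :=
  [/\ borel_fun u, frak_domain u,
      exists2 w : 'I_n -> measurableTypeR R * borel E -> R,
        forall i, frakG (psi i) u (w i) &
        frak_a u (fun z => - driver f u w z) &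
      forall x, u (T, x) = g x].

Definition solves_IP (P : R -> R -> R.-pker (borel E) ~> (borel E))
    (a : (measurableTypeR R * borel E -> R) ->
         (measurableTypeR R * borel E -> R))
    (psi : 'I_n -> measurableTypeR R * borel E -> R)
    (f : measurableTypeR R * borel E * R * n.-tuple R -> R) (g : borel E -> R)
    (u : measurableTypeR R * borel E -> R)
    (v : 'I_n -> measurableTypeR R * borel E -> R) : Prop :=
  [/\ L2X u, forall i, L2X (v i) &
      forall s x, 0 <= s <= T ->
        (u (s, x))%:E =
          (transition_op P s T g x +
           \int[dV]_(r in `[s, T])
             transition_op P s r (fun y => driver f u v (r, y)) x)%E /\
        forall i,
          (u (s, x) * psi i (s, x))%:E =
            (transition_op P s T (fun y => (g y * psi i (T, y))%R) x -
             \int[dV]_(r in `[s, T])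
               transition_op P s r (fun y =>
                 (v i (r, y) + u (r, y) * a (psi i) (r, y)
                    - psi i (r, y) * driver f u v (r, y))%R) x)%E].

Definition decoupled_mild_solution
    (P : R -> R -> R.-pker (borel E) ~> (borel E))
    (a : (measurableTypeR R * borel E -> R) ->
         (measurableTypeR R * borel E -> R))
    (psi : 'I_n -> measurableTypeR R * borel E -> R)
    (f : measurableTypeR R * borel E * R * n.-tuple R -> R) (g : borel E -> R)
    (u : measurableTypeR R * borel E -> R) : Prop :=
  exists v, solves_IP P a psi f g u v.

End pde.
End operators.
End markov.

(* Main.v *)
(** Write [M = u(., X) - u(s, x) + int f(., ., u, v) dV] and
    [N = psi_i(., X) - psi_i(s, x) - int a(psi_i) dV].  By the Markov property
    the two equations of [IP(f, g)] say that [M] and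
    [u psi_i(., X) - int (v_i + u a(psi_i) - psi_i f) dV] are martingales.
    Integration by parts turns the latter into [M N - int v_i dV], so that
    [<M, N> = int v_i dV], a continuous, hence predictable, process.  Cadlag
    versions exist because the number of [e]-oscillations of a square integrable
    martingale along dyadic grids is bounded in mean and the filtration is
    right-continuous.  Conversely, a second version [w] of [G^psi_i(u)] makes
    [int (w - v_i) dV] a martingale; a continuous martingale of finite variation
    vanishes, so [w = v_i] up to zero potential sets. *)
Require Import Defs.
From HB Require Import structures.
From mathcomp Require Import all_boot all_order all_algebra finmap.
From mathcomp Require Import all_classical all_reals all_analysis.
From mathcomp Require Import measurable_realfun ring lra.
Import Order.TTheory GRing.Theory Num.Theory.
Import numFieldNormedType.Exports.

Set Implicit Arguments.
Unset Strict Implicit.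
Unset Printing Implicit Defensive.

Local Open Scope classical_set_scope.
Local Open Scope ring_scope.

(** * Integration *)

(** Two obstacles shape the development. First, no localization is available: the martingale
    [int (w - v_i) dV] has paths of finite variation, but its variation has no known moment. Instead
    of being stopped, it is multiplied by a weight [1 - Lam / n] whose slope is a density with
    respect to [dV] and which vanishes once the variation exceeds [n]. In the same spirit no
    stochastic integral is built: a product of a martingale with an integral [int b dV] is handled
    by Fubini in time and the martingale property at each fixed time. Second, the basis is
    completed, so that the processes of the statement are known only up to null sets. All
    computations are made on the raw right-continuous filtration with progressive processes, and are
    transferred to modifications on the completed basis afterwards. Finally, the Markov property
    restarts the class from [(t, X t)], which may be any point: integrability is therefore
    established under every [PP t y], not only under the law of interest. *)

Section integral_toolkit.
Context d (W : measurableType d) (R : realType) (mu : {measure set W -> \bar R}).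
Implicit Types f g h : W -> R.

Import HBNNSimple.

(** Meant for processes that are measurable for a completion only, hence argued on the supremum over
    simple functions: multiplying one below [f] by the indicator of the complement of the null set
    [N] keeps its integral and puts it below [g]. By symmetry one inequality is enough. *)
Lemma ge0_integral_ae_congr (f g : W -> \bar R) :
  (forall x, (0 <= f x)%E) -> (forall x, (0 <= g x)%E) ->
  {ae mu, forall x, f x = g x} ->
  (\int[mu]_x f x = \int[mu]_x g x)%E.
Proof.
wlog suff : f g / (forall x, (0 <= f x)%E) -> (forall x, (0 <= g x)%E) ->
  {ae mu, forall x, f x = g x} -> (\int[mu]_x f x <= \int[mu]_x g x)%E.
  move=> le f0 g0 fg; apply/eqP; rewrite eq_le le//= le//.
  by apply: filterS fg => x ->.
move=> f0 g0 [N [mN N0 subN]].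
rewrite ge0_integralTE//; apply: ge_ereal_sup => _ [h /= hf <-].
pose h' : {nnsfun W >-> R} := mul_nnsfun h (indic_nnsfun R (measurableC mN)).
have <- : sintegral mu h' = sintegral mu h.
  rewrite -!integralT_nnsfun; apply: ge0_ae_eq_integral => //.
  - exact/measurable_EFinP.
  - exact/measurable_EFinP.
  - by move=> x _; rewrite lee_fin; exact: fun_ge0.
  - by move=> x _; rewrite lee_fin; exact: fun_ge0.
  - exists N; split => // x /= hx; apply: contrapT => Nx; apply: hx => _.
    by rewrite /= mindicE mem_set// mulr1.
rewrite ge0_integralTE//; apply: ereal_sup_ubound; exists h' => //= x.
rewrite /= mindicE; have [/set_mem Nx|/negP Nx] := boolP (x \in ~` N).
  rewrite mulr1; apply: le_trans (hf x) _.
  suff -> : f x = g x by [].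
  by apply: contrapT => fg; apply: Nx; apply: subN.
by rewrite mulr0.
Qed.

Lemma integral_ae_congr (f g : W -> \bar R) :
  {ae mu, forall x, f x = g x} -> (\int[mu]_x f x = \int[mu]_x g x)%E.
Proof.
move=> fg; rewrite integralE [RHS]integralE; congr (_ - _)%E;
  apply: ge0_integral_ae_congr => //; apply: filterS fg => x fgx.
- by rewrite !funeposE fgx.
- by rewrite !funenegE fgx.
Qed.

(** In the applications [A] belongs to a completed sigma-algebra and [B] is its representative
    before completion. *)
Lemma integral_ae_congr_in (A B : set W) (f g : W -> \bar R) :
  mu.-negligible ((A `\` B) `|` (B `\` A)) ->
  {ae mu, forall x, f x = g x} ->
  (\int[mu]_(x in A) f x = \int[mu]_(x in B) g x)%E.
Proof.
move=> nAB fg; rewrite integral_mkcond [RHS]integral_mkcond.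
apply: integral_ae_congr.
have : {ae mu, forall x, ~ ((A `\` B) `|` (B `\` A)) x}.
  by apply: negligibleS nAB => x /=; apply: contrapT.
move=> nAB'; apply: filterS2 fg nAB' => x fgx nx; rewrite !patchE.
case: ifPn => [/set_mem Ax|/negP Ax]; case: ifPn => [/set_mem Bx|/negP Bx] //.
- by exfalso; apply: nx; left; split=> // Bx'; apply: Bx; exact: mem_set.
- by exfalso; apply: nx; right; split=> // Bx'; apply: Ax; exact: mem_set.
Qed.

Definition intg f := mu.-integrable setT (EFin \o f).

Lemma intgP f : intg f <->
  measurable_fun setT f /\ (\int[mu]_x `|f x|%:E < +oo)%E.
Proof.
rewrite /intg; split=> [/integrableP[mf fi]|[mf fi]]; last first.
  by apply/integrableP; split => //; exact/measurable_EFinP.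
by split => //; exact/measurable_EFinP.
Qed.

Lemma intg_meas f : intg f -> measurable_fun setT f.
Proof. by move=> /intgP[]. Qed.

Lemma intgD f g : intg f -> intg g -> intg (fun x => f x + g x).
Proof. exact: integrableD. Qed.

Lemma intgN f : intg f -> intg (fun x => - f x).
Proof. exact: integrableN. Qed.

Lemma intgB f g : intg f -> intg g -> intg (fun x => f x - g x).
Proof. by move=> fi gi; apply: intgD => //; apply: intgN. Qed.

Lemma intgZ k f : intg f -> intg (fun x => k * f x).
Proof. exact: integrableZl. Qed.

Lemma intg_le f g : measurable_fun setT f -> (forall x, `|f x| <= `|g x|) ->
  intg g -> intg f.
Proof.
move=> mf fg; apply: le_integrable => //; first exact/measurable_EFinP.
by move=> x _ /=; rewrite lee_fin.
Qed.

Lemma intg_abs f : intg f -> intg (fun x => `|f x|).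
Proof.
by move=> fi; apply: intg_le (fi) => [|x]; rewrite ?normr_id//; apply: measurableT_comp => //; exact: intg_meas fi.
Qed.

Lemma intg_indic (B : set W) f : measurable B -> intg f -> intg (fun x => \1_B x * f x).
Proof.
move=> mB fi; apply: intg_le (fi).
  by apply: measurable_funM; [exact: measurable_indic|exact: intg_meas fi].
by move=> x; rewrite normrM ler_piMl// indicE; case: (_ \in _); rewrite ?normr0 ?normr1.
Qed.

Lemma intg_ae f g : measurable_fun setT g -> intg f ->
  {ae mu, forall x, f x = g x} -> intg g.
Proof.
move=> mg /intgP[mf fi] fg; apply/intgP; split => //.
rewrite (_ : integral _ _ _ = \int[mu]_x `|f x|%:E)%E//.
by apply: integral_ae_congr; apply: filterS fg => x ->.
Qed.

Lemma intg_aele f g : measurable_fun setT f ->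
  {ae mu, forall x, `|f x| <= `|g x|} -> intg g -> intg f.
Proof.
move=> mf fg gi; pose f' x := if `|f x| <= `|g x| then f x else 0.
have mg := intg_meas gi.
apply: (@intg_ae f') => //; last by apply: filterS fg => x; rewrite /f' => ->.
apply: intg_le gi; last by move=> x; rewrite /f'; case: ifPn; rewrite ?normr0.
apply: measurable_fun_ifT => //.
by apply: measurable_fun_ler; apply: measurableT_comp.
Qed.

Lemma Rint_ae f g : {ae mu, forall x, f x = g x} ->
  \int[mu]_x f x = \int[mu]_x g x.
Proof.
move=> fg; rewrite /Rintegral; congr fine; apply: integral_ae_congr.
by apply: filterS fg => x ->.
Qed.

Lemma Rint_EFin f : intg f -> (\int[mu]_x f x)%:E = (\int[mu]_x (f x)%:E)%E.
Proof. by move=> fi; rewrite /Rintegral fineK//; exact: integrable_fin_num. Qed.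

Lemma RintD f g : intg f -> intg g ->
  \int[mu]_x (f x + g x) = \int[mu]_x f x + \int[mu]_x g x.
Proof. exact: RintegralD. Qed.

Lemma RintB f g : intg f -> intg g ->
  \int[mu]_x (f x - g x) = \int[mu]_x f x - \int[mu]_x g x.
Proof. exact: RintegralB. Qed.

Lemma RintZ k f : intg f -> \int[mu]_x (k * f x) = k * \int[mu]_x f x.
Proof. exact: RintegralZl. Qed.

Lemma RintN f : intg f -> \int[mu]_x (- f x) = - \int[mu]_x f x.
Proof.
move=> fi; rewrite -[RHS]mulN1r -RintZ//.
by apply: eq_Rintegral => x _; rewrite mulN1r.
Qed.

Lemma Rint_indic (B : set W) f : \int[mu]_(x in B) f x = \int[mu]_x (\1_B x * f x).
Proof.
rewrite Rintegral_mkcond; apply: eq_Rintegral => x _.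
by rewrite patchE indicE; case: ifP; rewrite ?mul1r ?mul0r.
Qed.

Lemma Rint_ge0 f : (forall x, 0 <= f x) -> 0 <= \int[mu]_x f x.
Proof. by move=> f0; apply: Rintegral_ge0. Qed.

Lemma Rint_le f g : intg f -> intg g -> (forall x, f x <= g x) ->
  \int[mu]_x f x <= \int[mu]_x g x.
Proof. by move=> fi gi fg; apply: le_Rintegral. Qed.

Lemma Rint_norm f : intg f -> `|\int[mu]_x f x| <= \int[mu]_x `|f x|.
Proof. by move=> fi; apply: le_normr_Rintegral. Qed.

Lemma Rint_eq0 f : intg f -> (forall x, 0 <= f x) -> \int[mu]_x f x = 0 ->
  {ae mu, forall x, f x = 0}.
Proof.
move=> fi f0 i0.
have /ae_eq_integral_abs : measurable_fun setT (EFin \o f).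
  exact/measurable_EFinP/(intg_meas fi).
move=> /(_ mu measurableT)[+ _].
have -> : (\int[mu]_x `|(EFin \o f) x| = 0)%E.
  rewrite -[RHS]/(0%:E) -i0 Rint_EFin//; apply: eq_integral => x _ /=.
  by rewrite ger0_norm.
by move=> /(_ erefl); apply: filterS => x /= /(_ I) [].
Qed.

End integral_toolkit.

Section square_integrable.
Context d (W : measurableType d) (R : realType)
  (mu : {measure set W -> \bar R}).
Implicit Types f g h : W -> R.

Definition sqi f := measurable_fun setT f /\ intg mu (fun x => f x ^+ 2).

Lemma sqiM f g : sqi f -> sqi g -> intg mu (fun x => f x * g x).
Proof.
move=> [mf fi] [mg gi]; apply: (@intg_le _ _ _ _ _ (fun x => f x ^+ 2 + g x ^+ 2)) => //.
- exact: measurable_funM.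
- move=> x; rewrite [leRHS]ger0_norm; last by rewrite addr_ge0// sqr_ge0.
  rewrite ler_norml; apply/andP; split.
    by have := sqr_ge0 (f x + g x); nra.
  by have := sqr_ge0 (f x - g x); nra.
- exact: intgD.
Qed.

Lemma sqiD f g : sqi f -> sqi g -> sqi (fun x => f x + g x).
Proof.
move=> sf sg; have fg := sqiM sf sg; case: sf sg => mf fi [mg gi].
split; first exact: measurable_funD.
rewrite (_ : (fun x => _) = (fun x => f x ^+ 2 + (2 * (f x * g x) + g x ^+ 2))).
  by apply: intgD => //; apply: intgD => //; apply: intgZ.
by apply/funext => x; ring.
Qed.

Lemma sqiN f : sqi f -> sqi (fun x => - f x).
Proof.
move=> [mf fi]; split; first exact: measurableT_comp.
by apply: eq_integrable fi => // x _ /=; rewrite sqrrN.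
Qed.

Lemma sqiB f g : sqi f -> sqi g -> sqi (fun x => f x - g x).
Proof. by move=> fi gi; apply: sqiD => //; apply: sqiN. Qed.

Lemma sqiZ k f : sqi f -> sqi (fun x => k * f x).
Proof.
move=> [mf fi]; split; first exact: measurable_funM.
by rewrite (_ : (fun x => _) = (fun x => k ^+ 2 * f x ^+ 2)); [exact: intgZ|apply/funext => x; rewrite exprMn].
Qed.

Lemma sqi_le f g : measurable_fun setT f -> (forall x, `|f x| <= `|g x|) ->
  sqi g -> sqi f.
Proof.
move=> mf fg [mg gi]; split => //; apply: intg_le gi.
  exact: measurable_funX.
by move=> x; rewrite !normrX lerXn2r ?nnegrE.
Qed.

Lemma sqi_abs f : sqi f -> sqi (fun x => `|f x|).
Proof.
move=> sf; apply: sqi_le (sf) => [|x]; rewrite ?normr_id//.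
by case: sf => mf _; apply: measurableT_comp.
Qed.

Lemma sqi_indic (B : set W) f : measurable B -> sqi f -> sqi (fun x => \1_B x * f x).
Proof.
move=> mB [mf sf]; apply: (@sqi_le _ f) => //.
  by apply: measurable_funM => //; exact: measurable_indic.
by move=> x; rewrite normrM ler_piMl// indicE; case: (_ \in _); rewrite ?normr0 ?normr1.
Qed.

End square_integrable.

Section finite_toolkit.
Context d (W : measurableType d) (R : realType)
  (mu : {finite_measure set W -> \bar R}).
Implicit Types f g h : W -> R.

Lemma intg_cst k : intg mu (fun=> k).
Proof. exact: finite_measure_integrable_cst. Qed.

Lemma intg_bounded f k : measurable_fun setT f -> (forall x, `|f x| <= k) -> intg mu f.
Proof.
move=> mf fk; apply: intg_le (intg_cst k) => // x; apply: le_trans (fk x) _.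
exact: ler_norm.
Qed.

Lemma sqi_intg f : sqi mu f -> intg mu f.
Proof.
move=> [mf fi]; apply: (@intg_le _ _ _ _ _ (fun x => 1 + f x ^+ 2)) => //.
  move=> x; rewrite [leRHS]ger0_norm; last by rewrite addr_ge0// sqr_ge0.
  rewrite -[f x ^+ 2]real_normK ?num_real//; move: `|f x| => a.
  by have := sqr_ge0 (a - 1); nra.
by apply: intgD => //; exact: intg_cst.
Qed.

Lemma sqi_cst k : sqi mu (fun=> k).
Proof. by split => //; exact: intg_cst. Qed.

(** With [k] the total mass, expanding the integral of [(k |f| - J) ^+ 2] gives
    [k * (k * Q - J ^+ 2) >= 0]. One divides by [k], unless the measure is null. *)
Lemma cauchy_schwarz_total f : sqi mu f ->
  (\int[mu]_x `|f x|) ^+ 2 <= fine (mu setT) * \int[mu]_x (f x ^+ 2).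
Proof.
move=> sf; have fi := intg_abs (sqi_intg sf); case: sf => mf f2.
set J := \int[mu]_x _; set k := fine _; set Q := \int[mu]_x _.
have k0 : 0 <= k by rewrite fine_ge0.
have J0 : 0 <= J by apply: Rint_ge0.
have : 0 <= \int[mu]_x (k ^+ 2 * f x ^+ 2 + (- (2 * k * J) * `|f x| + J ^+ 2)).
  apply: Rint_ge0 => x; rewrite -[f x ^+ 2]real_normK ?num_real//.
  by have := sqr_ge0 (k * `|f x| - J); nra.
have iZ a : intg mu (fun x => a * `|f x|) by apply: intgZ.
rewrite RintD//; last 2 first.
- exact: intgZ.
- by apply: intgD => //; exact: intg_cst.
rewrite RintD//; last exact: intg_cst.
rewrite Rintegral_cst// (RintZ _ f2) (RintZ _ fi) -/k -/J -/Q => h.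
have [k00|k_neq0] := eqVneq k 0; last first.
  have {k_neq0}k0 : 0 < k by rewrite lt_neqAle eq_sym k_neq0.
  have : 0 <= k * (k * Q - J ^+ 2) by nra.
  by rewrite pmulr_rge0// subr_ge0.
have mu0 : mu setT = 0%E.
  have : (mu setT \is a fin_num)%E by exact: fin_num_measure.
  by move=> /fineK <-; rewrite -/k k00.
suff -> : J = 0 by rewrite k00 expr0n/= mul0r.
rewrite /J /Rintegral (_ : integral _ _ _ = 0)%E//.
by apply: null_set_integral => //; exact/measurable_EFinP/(intg_meas fi).
Qed.

End finite_toolkit.
Lemma cvg_EFin_seq (R : realType) (u : nat -> R) (l : R) :
  u @ \oo --> l -> (fun n => (u n)%:E) @ \oo --> l%:E.
Proof. by move=> ul; apply/fine_cvgP; split; [exact: nearW|]. Qed.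

Section limits_of_integrals.
Context d (W : measurableType d) (R : realType) (mu : {measure set W -> \bar R}).
Implicit Types f g h : W -> R.

Lemma Rint_dct (f_ : nat -> W -> R) f g : (forall n, measurable_fun setT (f_ n)) ->
  measurable_fun setT f -> {ae mu, forall x, f_ ^~ x @ \oo --> f x} ->
  (forall n x, `|f_ n x| <= g x) -> intg mu g ->
  (fun n => \int[mu]_x f_ n x) @ \oo --> \int[mu]_x f x.
Proof.
move=> mf_ mf ff fg gi.
have [fi _ cv] := @dominated_convergence _ _ _ mu setT measurableT
  (fun n => EFin \o f_ n) (EFin \o f) (EFin \o g)
  (fun n => (measurable_EFinP _ _).2 (mf_ n)) ((measurable_EFinP _ _).2 mf)
  (filterS (fun x (h : f_ ^~ x @ \oo --> f x) _ => cvg_EFin_seq h) ff) gi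
  (aeW _ (fun x n _ => fg n x)).
apply: fine_cvg; rewrite fineK//.
exact: integrable_fin_num.
Qed.

Lemma intg_fatou (f_ : nat -> W -> R) f k : (forall n, intg mu (f_ n)) ->
  (forall n x, 0 <= f_ n x) -> measurable_fun setT f ->
  {ae mu, forall x, f_ ^~ x @ \oo --> f x} ->
  (forall n, \int[mu]_x f_ n x <= k) ->
  intg mu f /\ \int[mu]_x f x <= k.
Proof.
move=> fi f0 mf ff fk.
have le : (\int[mu]_x `|f x|%:E <= k%:E)%E.
  rewrite (@integral_ae_congr _ _ _ _ _ (fun x => limn_einf (fun n => (f_ n x)%:E))); last first.
    apply: filterS ff => x fx.
    have cv : (fun n => (f_ n x)%:E) @ \oo --> (f x)%:E by exact: cvg_EFin_seq.
    rewrite is_cvg_limn_einfE; last by apply/cvg_ex; exists (f x)%:E.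
    rewrite (cvg_lim _ cv)// ger0_norm//.
    by rewrite -(cvg_lim _ fx)//; apply: limr_ge; [apply/cvg_ex; exists (f x)|exact: nearW].
  apply: le_trans (fatou _ _ _ _) _ => //.
  - by move=> n; exact/measurable_EFinP/(intg_meas (fi n)).
  - by move=> n x _; rewrite lee_fin.
  - rewrite limn_einf_lim; apply: lime_le; first exact: is_cvg_einfs.
    apply: nearW => n; apply: le_trans (_ : (\int[mu]_x (f_ n x)%:E <= _)%E).
      by apply: ereal_inf_lbound; exists n => /=.
    by rewrite -Rint_EFin// lee_fin.
have fI : intg mu f by apply/intgP; split => //; apply: le_lt_trans le _; rewrite ltry.
split => //; rewrite -lee_fin Rint_EFin//; apply: le_trans le.
apply: le_integral => //; first by apply: intg_abs fI.
by move=> x _; rewrite lee_fin ler_norm.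
Qed.

Lemma Rint_sum (I : Type) (r : seq I) (f : I -> W -> R) : (forall i, intg mu (f i)) ->
  intg mu (fun x => \sum_(i <- r) f i x) /\
  \int[mu]_x (\sum_(i <- r) f i x) = \sum_(i <- r) \int[mu]_x f i x.
Proof.
move=> fi; elim: r => [|i r [IH1 IH2]].
  rewrite big_nil (_ : (fun x => _) = fun=> 0); last by apply/funext => x; rewrite big_nil.
  split; first exact: integrable0.
  by rewrite Rintegral_cst// mul0r.
rewrite big_cons (_ : (fun x => _) = fun x => f i x + \sum_(j <- r) f j x); last first.
  by apply/funext => x; rewrite big_cons.
by split; [exact: intgD|rewrite RintD// IH2].
Qed.

End limits_of_integrals.

(** * Conditional expectations, tested on the sets of a sub-sigma-algebra *)

Section sub_sigma_algebra.
Context d (W : measurableType d) (R : realType) (P : probability W R).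
Implicit Types (G : set (set W)) (Y Z : W -> R).

Definition sub_sigma G := sigma_algebra setT G /\ G `<=` measurable.

(** Going through the type [g_sigma_algebraType G] makes the closure properties of [measurable_fun]
    available; by [gmeasP] this is [measurable_wrt G] when [G] is a sub-sigma-algebra. *)
Definition gmeas G Y := measurable_fun [set: g_sigma_algebraType G] (Y : g_sigma_algebraType G -> R).

Lemma sub_sigmaE G : sub_sigma G -> @measurable _ (g_sigma_algebraType G) = G.
Proof. by move=> [/sigma_algebra_id]. Qed.

Lemma gmeasP G Y : sub_sigma G -> gmeas G Y <-> measurable_wrt G Y.
Proof.
move=> sG; rewrite /gmeas /measurable_wrt; split=> mY.
  move=> B mB; have := mY measurableT B mB.
  by rewrite setTI sub_sigmaE.
by move=> _ B mB; rewrite setTI sub_sigmaE//; exact: mY.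
Qed.

Lemma sub_sigma_id G : sub_sigma G ->
  measurable_fun setT (id : W -> g_sigma_algebraType G).
Proof.
by move=> sG _ B; rewrite sub_sigmaE// setTI => GB; apply: sG.2.
Qed.

Lemma gmeas_meas G Y : sub_sigma G -> gmeas G Y -> measurable_fun setT Y.
Proof.
by move=> sG mY; apply: (measurableT_comp (f := Y : g_sigma_algebraType G -> R) mY (sub_sigma_id sG)).
Qed.

Lemma gmeasS G G' Y : sub_sigma G -> sub_sigma G' -> G `<=` G' -> gmeas G Y -> gmeas G' Y.
Proof.
by move=> sG sG' GG' /(gmeasP _ sG) mY; apply/(gmeasP _ sG') => B mB; apply: GG'; exact: mY.
Qed.

Lemma gmeas_indic G (B : set W) : sub_sigma G -> G B -> gmeas G (\1_B).
Proof. by move=> sG GB; apply: measurable_indic; rewrite sub_sigmaE. Qed.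

Import HBNNSimple.

(** [G]-simple functions increase to [Y]. For each of them the integral is a finite combination of
    integrals of [Z] over sets of [G], and [|Y Z|] dominates the whole sequence. *)
Let Rint_mul_eq0_pos G Z Y : sub_sigma G -> intg P Z ->
  (forall B, G B -> \int[P]_w (\1_B w * Z w) = 0) ->
  gmeas G Y -> (forall w, 0 <= Y w) -> intg P (fun w => Y w * Z w) ->
  \int[P]_w (Y w * Z w) = 0.
Proof.
move=> sG iZ Z0 mY Y0 iYZ.
have mY' : measurable_fun [set: g_sigma_algebraType G] (EFin \o Y).
  exact/measurable_EFinP.
pose y_ : {nnsfun (g_sigma_algebraType G) >-> R}^nat := nnsfun_approx measurableT mY'.
have y_cvg w : (y_ n w) @[n --> \oo] --> Y w.
  have := cvg_nnsfun_approx measurableT mY' (fun w _ => Y0 w : (0%:E <= (Y w)%:E)%E) (I : setT w).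
  move=> /fine_cvgP[_]; apply: cvg_trans.
  by apply: near_eq_cvg; apply: nearW.
have y_nd w : nondecreasing_seq (fun n => y_ n w).
  move=> a b ab; have := nd_nnsfun_approx measurableT mY' ab.
  by move=> /lefP/(_ w).
have y_le n w : y_ n w <= Y w.
  by rewrite -(cvg_lim _ (y_cvg w))//; apply: nondecreasing_cvgn_le => //; apply/cvg_ex; exists (Y w).
have y_ge0 n w : 0 <= y_ n w by rewrite /y_; exact: fun_ge0.
have y0 n : \int[P]_w (y_ n w * Z w) = 0.
  have E w : y_ n w * Z w = \sum_(k <- fset_set (range (y_ n)))
      k * (\1_(y_ n @^-1` [set k]) w * Z w).
    rewrite /y_ {1}fimfunE fsbig_finite//= mulr_suml.
    by apply: eq_bigr => k _; rewrite mulrA.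
  have GB k : G (y_ n @^-1` [set k]).
    have : measurable (y_ n @^-1` [set k]) by rewrite /y_; exact: measurable_sfunP.
    by rewrite sub_sigmaE.
  have iB k : intg P (fun w => \1_(y_ n @^-1` [set k]) w * Z w).
    by apply: intg_indic => //; apply: sG.2.
  under eq_Rintegral do rewrite E.
  have [_ ->] := @Rint_sum _ _ _ P _ (fset_set (range (y_ n)))
    (fun k w => k * (\1_(y_ n @^-1` [set k]) w * Z w)) (fun k => intgZ k (iB k)).
  by rewrite big1// => k _; rewrite RintZ// Z0// mulr0.
have mZ := intg_meas iZ.
have cv := @Rint_dct _ _ _ P (fun n w => y_ n w * Z w) (fun w => Y w * Z w)
  (fun w => `|Y w * Z w|) _ (intg_meas iYZ) _ _ (intg_abs iYZ).
have {cv} : (fun n => \int[P]_w (y_ n w * Z w)) @ \oo --> \int[P]_w (Y w * Z w).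
  apply: cv.
  - move=> n; apply: measurable_funM => //.
    by apply: gmeas_meas sG _; rewrite /y_ /gmeas; exact: measurable_funPT.
  - by apply: aeW => w; apply: cvgM => //; exact: cvg_cst.
  - move=> n w; rewrite !normrM ler_wpM2r// !ger0_norm//.
rewrite (_ : (fun n => _) = fun=> 0); last by apply/funext.
by move=> /cvg_lim <-//; rewrite lim_cst.
Qed.

(** Stands in for taking a known factor out of a conditional expectation: [Z] has zero conditional
    expectation given [G]. *)
Lemma Rint_mul_eq0 G Z Y : sub_sigma G -> intg P Z ->
  (forall B, G B -> \int[P]_w (\1_B w * Z w) = 0) ->
  gmeas G Y -> intg P (fun w => Y w * Z w) ->
  \int[P]_w (Y w * Z w) = 0.
Proof.
move=> sG iZ Z0 mY iYZ.
have mZ := intg_meas iZ.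
have mp : gmeas G (fun w => Num.max (Y w) 0) by apply: measurable_maxr.
have mn : gmeas G (fun w => Num.max (- Y w) 0).
  by apply: measurable_maxr => //; exact: measurableT_comp.
have ip : intg P (fun w => Num.max (Y w) 0 * Z w).
  apply: intg_le iYZ; first by apply: measurable_funM => //; exact: gmeas_meas mp.
  by move=> w; rewrite !normrM ler_wpM2r//; case: (lerP (Y w) 0) => h; rewrite ?normr0.
have in_ : intg P (fun w => Num.max (- Y w) 0 * Z w).
  apply: intg_le iYZ; first by apply: measurable_funM => //; exact: gmeas_meas mn.
  by move=> w; rewrite !normrM ler_wpM2r//; case: (lerP (- Y w) 0) => h; rewrite ?normr0 ?normrN.
rewrite (_ : Rintegral _ _ _ = \int[P]_w (Num.max (Y w) 0 * Z w - Num.max (- Y w) 0 * Z w)).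
  by rewrite RintB// !(@Rint_mul_eq0_pos G)// ?subrr// => w; rewrite le_max lexx orbT.
apply: eq_Rintegral => w _; rewrite -mulrBl; congr (_ * _).
by case: (lerP (Y w) 0) => h; case: (lerP (- Y w) 0) => h'; lra.
Qed.

(** The difference is tested against its own sign, which is [G]-measurable and turns the integral
    into that of [|Y - Z|]. *)
Lemma gmeas_ae_eq G Y Z : sub_sigma G -> gmeas G Y -> gmeas G Z -> intg P Y -> intg P Z ->
  (forall B, G B -> \int[P]_w (\1_B w * Y w) = \int[P]_w (\1_B w * Z w)) ->
  {ae P, forall w, Y w = Z w}.
Proof.
move=> sG mY mZ iY iZ YZ.
have iD : intg P (fun w => Y w - Z w) by apply: intgB.
have mD : gmeas G (fun w => Y w - Z w) by apply: measurable_funB.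
have D0 B : G B -> \int[P]_w (\1_B w * (Y w - Z w)) = 0.
  move=> GB; under eq_Rintegral do rewrite mulrBr.
  have mB := sG.2 _ GB.
  by rewrite RintB ?YZ ?subrr//; apply: intg_indic.
have mS : gmeas G (fun w => Num.sg (Y w - Z w)).
  rewrite (_ : (fun w => _) = fun w => if 0 < Y w - Z w then 1 else if Y w - Z w < 0 then -1 else 0).
    apply: measurable_fun_ifT => //; first by apply: measurable_fun_ltr.
    by apply: measurable_fun_ifT => //; apply: measurable_fun_ltr.
  by apply/funext => w; case: sgrP.
have absE w : Num.sg (Y w - Z w) * (Y w - Z w) = `|Y w - Z w| by rewrite normrEsg.
have /(Rint_eq0 (intg_abs iD)) : \int[P]_w `|Y w - Z w| = 0.
  rewrite -(@Rint_mul_eq0 G _ (fun w => Num.sg (Y w - Z w)) sG iD D0 mS).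
    by apply: eq_Rintegral => w _; rewrite absE.
  rewrite (_ : (fun w => _) = fun w => `|Y w - Z w|); first exact: intg_abs.
  by apply/funext => w; rewrite absE.
move=> /(_ (fun=> normr_ge0 _)); apply: filterS => w /eqP.
by rewrite normr_eq0 subr_eq0 => /eqP.
Qed.

(** Since [Z] is not known to be square integrable, it is cut off on the sets [|Z| <= n] of [G]. The
    truncation [Zn] satisfies [E Zn^2 = E (Zn Z) = E (Zn xi) <= (E Zn^2 + E xi^2) / 2], and Fatou's
    lemma removes the cut-off. *)
Lemma cond_exp_contraction G Z xi : sub_sigma G -> sqi P xi -> gmeas G Z -> intg P Z ->
  (forall B, G B -> \int[P]_w (\1_B w * Z w) = \int[P]_w (\1_B w * xi w)) ->
  sqi P Z /\ \int[P]_w (Z w ^+ 2) <= \int[P]_w (xi w ^+ 2).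
Proof.
move=> sG sxi mZ iZ Zxi; have mZ' := gmeas_meas sG mZ.
have ixi := sqi_intg sxi.
pose Zn (n : nat) w := \1_[set w | `|Z w| <= n%:R] w * Z w.
have GA (n : nat) : G [set w | `|Z w| <= n%:R].
  have mA : measurable_fun [set: g_sigma_algebraType G] (fun w => `|Z w| <= n%:R).
    by apply: measurable_fun_ler => //; exact: measurableT_comp.
  have mt : measurable [set true] by [].
  have := mA measurableT [set true] mt.
  by rewrite setTI sub_sigmaE.
have mZn n : gmeas G (Zn n).
  by apply: measurable_funM => //; exact: gmeas_indic.
have Znb n w : `|Zn n w| <= n%:R.
  rewrite /Zn indicE; have [/set_mem/=|] := boolP (w \in _); first by rewrite mul1r.
  by rewrite mul0r normr0.
have sZn n : sqi P (Zn n).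
  by apply: sqi_le (sqi_cst P n%:R) => [|w]; [exact: gmeas_meas (mZn n)|rewrite (le_trans (Znb n w))// ler_norm].
have bnd n : \int[P]_w (Zn n w ^+ 2) <= \int[P]_w (xi w ^+ 2).
  have iD : intg P (fun w => Z w - xi w) by exact: intgB.
  have iZnZ : intg P (fun w => Zn n w * Z w).
    rewrite (_ : (fun w => _) = fun w => Zn n w ^+ 2); first by case: (sZn n).
    apply/funext => w; rewrite /Zn exprMn expr2 indicE.
    by case: (_ \in _); rewrite ?mulr0 ?mul0r// ?mul1r ?expr1n expr2 ?mul1r.
  have iZnxi := sqiM (sZn n) sxi.
  have : \int[P]_w (Zn n w * (Z w - xi w)) = 0.
    apply: (@Rint_mul_eq0 G) => //.
      move=> B GB; under eq_Rintegral do rewrite mulrBr.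
      by have mB := sG.2 _ GB; rewrite RintB ?Zxi ?subrr//; apply: intg_indic.
    under eq_fun do rewrite mulrBr.
    exact: intgB.
  under eq_Rintegral do rewrite mulrBr.
  rewrite RintB// (_ : (\int[P]_w (Zn n w * Z w)) = \int[P]_w (Zn n w ^+ 2)); last first.
    apply: eq_Rintegral => w _; rewrite /Zn indicE.
    by case: (_ \in _); rewrite ?mul1r ?mul0r// expr0n.
  move=> /eqP; rewrite subr_eq0 => /eqP E.
  have : \int[P]_w (Zn n w * xi w) <= \int[P]_w (2^-1 * Zn n w ^+ 2 + 2^-1 * xi w ^+ 2).
    apply: Rint_le => //; first by apply: intgD; apply: intgZ; [case: (sZn n)|case: sxi].
    by move=> w; have := sqr_ge0 (Zn n w - xi w); nra.
  rewrite RintD; [|by apply: intgZ; case: (sZn n)|by apply: intgZ; case: sxi].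
  have i1 : intg P (fun w => Zn n w ^+ 2) by case: (sZn n).
  have i2 : intg P (fun w => xi w ^+ 2) by case: sxi.
  rewrite (RintZ _ i1) (RintZ _ i2); lra.
have [] // := @intg_fatou _ _ _ P (fun n w => Zn n w ^+ 2) (fun w => Z w ^+ 2)
  (\int[P]_w (xi w ^+ 2)) _ _ _ _ bnd.
- by move=> n; case: (sZn n).
- by move=> n w; exact: sqr_ge0.
- exact: measurable_funX.
- apply: aeW => w; apply: cvg_near_cst; exists (Num.trunc `|Z w|).+1 => // n /= hn.
  rewrite /Zn indicE mem_set ?mul1r//=.
  by rewrite ltW// (lt_le_trans (truncnS_gt _))// ler_nat.
Qed.

End sub_sigma_algebra.

(** * Fubini's theorem for real-valued integrals *)

Section fubini_toolkit.
Context d1 d2 (T1 : measurableType d1) (T2 : measurableType d2) (R : realType).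
Implicit Types f : T1 * T2 -> R.

Lemma measurable_Rint1 (m2 : {sigma_finite_measure set T2 -> \bar R}) f :
  measurable_fun setT f -> measurable_fun setT (fun x => \int[m2]_y f (x, y)).
Proof.
move=> mf; have mEf : measurable_fun setT (EFin \o f) by exact/measurable_EFinP.
rewrite (_ : (fun x => _) = fine \o ((fun x => \int[m2]_y (EFin \o f)^\+ (x, y)) \-
    (fun x => \int[m2]_y (EFin \o f)^\- (x, y))))%E; last first.
  apply/funext => x /=; rewrite /Rintegral [in LHS]integralE.
  by congr (fine (_ - _)%E); apply: eq_integral => y _; rewrite ?funeposE ?funenegE.
apply: measurableT_comp; first exact: fine_measurable.
have mp := measurable_funepos mEf; have mn := measurable_funeneg mEf.
by apply: emeasurable_funB;
  [apply: measurable_fun_fubini_tonelli_F mp _ => z; exact: funepos_ge0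
  |apply: measurable_fun_fubini_tonelli_F mn _ => z; exact: funeneg_ge0].
Qed.

Lemma measurable_Rint2 (m1 : {sigma_finite_measure set T1 -> \bar R}) f :
  measurable_fun setT f -> measurable_fun setT (fun y => \int[m1]_x f (x, y)).
Proof.
move=> mf; have mEf : measurable_fun setT (EFin \o f) by exact/measurable_EFinP.
rewrite (_ : (fun x => _) = fine \o ((fun y => \int[m1]_x (EFin \o f)^\+ (x, y)) \-
    (fun y => \int[m1]_x (EFin \o f)^\- (x, y))))%E; last first.
  apply/funext => x /=; rewrite /Rintegral [in LHS]integralE.
  by congr (fine (_ - _)%E); apply: eq_integral => y _; rewrite ?funeposE ?funenegE.
apply: measurableT_comp; first exact: fine_measurable.
have mp := measurable_funepos mEf; have mn := measurable_funeneg mEf.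
by apply: emeasurable_funB;
  [apply: measurable_fun_fubini_tonelli_G mp _ => z; exact: funepos_ge0
  |apply: measurable_fun_fubini_tonelli_G mn _ => z; exact: funeneg_ge0].
Qed.

Variables (m1 : {sigma_finite_measure set T1 -> \bar R})
  (m2 : {sigma_finite_measure set T2 -> \bar R}) (f : T1 * T2 -> R).

Lemma intg_prodP1 : measurable_fun setT f ->
  (\int[m1]_x \int[m2]_y `|f (x, y)|%:E < +oo)%E -> intg (m1 \x m2)%E f.
Proof.
by move=> mf lt; apply/integrable12ltyP => //; exact/measurable_EFinP.
Qed.

Lemma intg_prodP2 : measurable_fun setT f ->
  (\int[m2]_y \int[m1]_x `|f (x, y)|%:E < +oo)%E -> intg (m1 \x m2)%E f.
Proof.
by move=> mf lt; apply/integrable21ltyP => //; exact/measurable_EFinP.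
Qed.

Hypothesis fi : intg (m1 \x m2)%E f.

Lemma intg_sect1 : {ae m1, forall x, intg m2 (fun y => f (x, y))}.
Proof. exact: ae_integrable1 fi. Qed.

Lemma intg_sect2 : {ae m2, forall y, intg m1 (fun x => f (x, y))}.
Proof. exact: ae_integrable2 fi. Qed.

Let ae1 : {ae m1, forall x, (\int[m2]_y (f (x, y))%:E = (\int[m2]_y f (x, y))%:E)%E}.
Proof. by apply: filterS intg_sect1 => x ix; rewrite Rint_EFin. Qed.

Let ae2 : {ae m2, forall y, (\int[m1]_x (f (x, y))%:E = (\int[m1]_x f (x, y))%:E)%E}.
Proof. by apply: filterS intg_sect2 => x ix; rewrite Rint_EFin. Qed.

Lemma intg_Rint2 : intg m2 (fun y => \int[m1]_x f (x, y)).
Proof.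
apply/intgP; split; first exact: (measurable_Rint2 m1 (intg_meas fi)).
have mf := intg_meas fi.
have mEf : measurable_fun setT (EFin \o f) by exact/measurable_EFinP.
apply: le_lt_trans ((integrable21ltyP m1 m2 mEf).1 fi).
apply: ae_ge0_le_integral => //.
- by apply/measurable_EFinP/measurableT_comp => //; exact: measurable_Rint2.
- by move=> y _; exact: integral_ge0.
- apply: (measurable_fun_fubini_tonelli_G (abse \o (EFin \o f))) => //.
  exact: measurableT_comp.
  by move=> z; exact: abse_ge0.
apply: filterS ae2 => y e _; have -> : (`|\int[m1]_x f (x, y)|%:E = `|\int[m1]_x (f (x, y))%:E|)%E by rewrite e.
apply: le_abse_integral => //.
apply/measurable_EFinP; apply: (measurableT_comp (f := f) mf).
exact: measurable_fun_pair.
Qed.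

Lemma Rint_prod1 : \int[(m1 \x m2)%E]_z f z = \int[m1]_x (\int[m2]_y f (x, y)).
Proof.
rewrite /Rintegral; congr fine.
rewrite -(integral12_prod_meas1 fi); apply: integral_ae_congr.
exact: ae1.
Qed.

Lemma Rint_prod2 : \int[(m1 \x m2)%E]_z f z = \int[m2]_y (\int[m1]_x f (x, y)).
Proof.
rewrite /Rintegral; congr fine.
rewrite -(integral21_prod_meas1 fi); apply: integral_ae_congr.
exact: ae2.
Qed.

End fubini_toolkit.

(* Processes on [s, T] are functions on R; composing with [clamp s T] keeps only
   their values at times in [s, T]. *)
Definition clamp (R : realType) (s t q : R) : R := Num.max s (Num.min q t).

Section clamp.
Context (R : realType).
Implicit Types s t q : R.

Lemma clamp_itv s t q : s <= t -> s <= clamp s t q <= t.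
Proof. by move=> st; rewrite /clamp le_max lexx/= ge_max st ge_min lexx orbT. Qed.

Lemma clamp_id s t q : s <= q <= t -> clamp s t q = q.
Proof. by move=> /andP[sq qt]; rewrite /clamp min_l// max_r. Qed.

Lemma clamp_le s t t' q : q <= t -> t <= t' -> clamp s t' q = clamp s t q.
Proof. by move=> qt tt'; rewrite /clamp !min_l// (le_trans qt). Qed.

Lemma measurable_clamp s t : measurable_fun [set: measurableTypeR R] (clamp s t).
Proof. by apply: measurable_maxr => //; apply: measurable_minr. Qed.

End clamp.

(** * Martingales for an uncompleted filtration *)

Section filtered_space.
Context d (W : measurableType d) (R : realType) (P : probability W R).
Context (F : R -> set (set W)) (s T : R).
Hypothesis sT : s <= T.
Hypothesis sF : forall t, s <= t <= T -> sub_sigma (F t).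
Hypothesis monoF : forall r t, s <= r -> r <= t -> t <= T -> F r `<=` F t.
Implicit Types (Y M b : R -> W -> R).

(** Kept on the uncompleted filtration, where products and Fubini apply to genuinely measurable
    functions; [rmart_martingale] and [martingale_rmart] translate to and from the completed one. *)
Definition rmart Y :=
  [/\ forall t, s <= t <= T -> gmeas (F t) (Y t),
      forall t, s <= t <= T -> intg P (Y t) &
      forall r t B, s <= r -> r <= t -> t <= T -> F r B ->
        \int[P]_w (\1_B w * Y t w) = \int[P]_w (\1_B w * Y r w)].

Lemma rmart_ae Y Y' : rmart Y -> (forall t, s <= t <= T -> gmeas (F t) (Y' t)) ->
  (forall t, s <= t <= T -> {ae P, forall w, Y t w = Y' t w}) -> rmart Y'.
Proof.
move=> [mY iY eY] mY' YY'; split => //.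
  move=> t st; apply: intg_ae (iY t st) (YY' t st).
  by apply: gmeas_meas (mY' t st); exact: sF.
move=> r t B sr rt tT FB.
have rI : s <= r <= T by rewrite sr (le_trans rt).
have tI : s <= t <= T by rewrite tT (le_trans sr).
transitivity (\int[P]_w (\1_B w * Y t w)).
  by apply/esym/Rint_ae; apply: filterS (YY' t tI) => w ->.
rewrite (eY r t)//; apply: Rint_ae; apply: filterS (YY' r rI) => w -> //.
Qed.

Lemma rmartD Y Y' : rmart Y -> rmart Y' -> rmart (fun t w => Y t w + Y' t w).
Proof.
move=> [mY iY eY] [mY' iY' eY']; split => [t st|t st|r t B sr rt tT FB].
- by apply: measurable_funD; [exact: mY|exact: mY'].
- by apply: intgD; [exact: iY|exact: iY'].
have rI : s <= r <= T by rewrite sr (le_trans rt).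
have tI : s <= t <= T by rewrite tT (le_trans sr).
have mB := (sF rI).2 _ FB.
under eq_Rintegral do rewrite mulrDr.
under [RHS]eq_Rintegral do rewrite mulrDr.
by rewrite !RintD ?(eY r t) ?(eY' r t)//; apply: intg_indic => //; auto.
Qed.

Lemma rmartZ k Y : rmart Y -> rmart (fun t w => k * Y t w).
Proof.
move=> [mY iY eY]; split => [t st|t st|r t B sr rt tT FB].
- by apply: measurable_funM => //; exact: mY.
- by apply: intgZ; exact: iY.
have rI : s <= r <= T by rewrite sr (le_trans rt).
have tI : s <= t <= T by rewrite tT (le_trans sr).
have mB := (sF rI).2 _ FB.
under eq_Rintegral do rewrite mulrCA.
under [RHS]eq_Rintegral do rewrite mulrCA.
by rewrite !RintZ ?(eY r t)//; apply: intg_indic => //; auto.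
Qed.

Lemma rmartB Y Y' : rmart Y -> rmart Y' -> rmart (fun t w => Y t w - Y' t w).
Proof.
move=> rY rY'; have := rmartD rY (rmartZ (-1) rY').
rewrite (_ : (fun t w => _) = (fun t w => Y t w - Y' t w))//.
by apply/funext => t; apply/funext => w; rewrite mulN1r.
Qed.

Lemma rmart_cst k : rmart (fun _ _ => k).
Proof. by split => // *; [exact: measurable_cst|exact: intg_cst]. Qed.

Lemma rmart_orth Y r t xi : rmart Y -> s <= r -> r <= t -> t <= T ->
  gmeas (F r) xi -> intg P (fun w => xi w * Y t w) -> intg P (fun w => xi w * Y r w) ->
  \int[P]_w (xi w * Y t w) = \int[P]_w (xi w * Y r w).
Proof.
move=> [mY iY eY] sr rt tT mxi i1 i2.
have rI : s <= r <= T by rewrite sr (le_trans rt).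
have tI : s <= t <= T by rewrite tT (le_trans sr).
apply/eqP; rewrite -subr_eq0 -RintB//; apply/eqP.
under eq_Rintegral do rewrite -mulrBr.
apply: (Rint_mul_eq0 (sF rI)) => //.
- by apply: intgB; auto.
- move=> B FB; have mB := (sF rI).2 _ FB.
  under eq_Rintegral do rewrite mulrBr.
  by rewrite RintB ?(eY r t) ?subrr//; apply: intg_indic => //; auto.
- by under eq_fun do rewrite mulrBr; exact: intgB.
Qed.

(** [Y t] is a conditional expectation of [Y T], and such expectations contract second moments. *)
Lemma rmart_sqi Y : rmart Y -> sqi P (Y T) -> forall t, s <= t <= T ->
  sqi P (Y t) /\ \int[P]_w (Y t w ^+ 2) <= \int[P]_w (Y T w ^+ 2).
Proof.
move=> [mY iY eY] sYT t /andP[st tT]; have tI : s <= t <= T by rewrite st.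
apply: (cond_exp_contraction (sF tI)); rewrite ?st//; auto.
by move=> B FB; rewrite -(eY t T).
Qed.

(** Progressive measurability. Clamping the time to [[s, t]] replaces the restriction to that
    interval and keeps a full product type as domain. *)
Definition prog b := forall t, s <= t <= T ->
  measurable_fun [set: measurableTypeR R * g_sigma_algebraType (F t)]
    (fun z => b (clamp s t z.1) z.2).

Lemma prog_gmeas b t : prog b -> s <= t <= T -> gmeas (F t) (b t).
Proof.
move=> pb tI; rewrite /gmeas.
rewrite (_ : b t = (fun z => b (clamp s t z.1) z.2) \o (fun w => (t, w))); last first.
  by apply/funext => w /=; rewrite clamp_id//; case/andP : tI => -> _ /=.
by apply: measurableT_comp (pb t tI) _; exact: measurable_fun_pair.
Qed.

Lemma prog_joint b : prog b ->
  measurable_fun [set: measurableTypeR R * W] (fun z => b (clamp s T z.1) z.2).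
Proof.
move=> pb; have TI : s <= T <= T by rewrite sT lexx.
pose i (z : measurableTypeR R * W) : measurableTypeR R * g_sigma_algebraType (F T) := (z.1, z.2).
have mi : measurable_fun setT i.
  apply: measurable_fun_pair => //.
  exact: measurableT_comp (sub_sigma_id (sF TI)) measurable_snd.
exact: measurableT_comp (pb T TI) mi.
Qed.

Lemma prog_cst k : prog (fun _ _ => k).
Proof. by move=> t tI. Qed.

Lemma progD b b' : prog b -> prog b' -> prog (fun q w => b q w + b' q w).
Proof. by move=> pb pb' t tI; apply: measurable_funD; [exact: pb|exact: pb']. Qed.

Lemma progB b b' : prog b -> prog b' -> prog (fun q w => b q w - b' q w).
Proof. by move=> pb pb' t tI; apply: measurable_funB; [exact: pb|exact: pb']. Qed.

Lemma progM b b' : prog b -> prog b' -> prog (fun q w => b q w * b' q w).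
Proof. by move=> pb pb' t tI; apply: measurable_funM; [exact: pb|exact: pb']. Qed.

Lemma prog_abs b : prog b -> prog (fun q w => `|b q w|).
Proof. by move=> pb t tI; apply: measurableT_comp => //; exact: pb. Qed.

Lemma prog_indic_le b k : prog b -> prog (fun q w => \1_[set x | x <= k] (b q w)).
Proof.
move=> pb t tI; have mI : measurable_fun setT (\1_[set x : R | x <= k] : R -> R).
  apply: measurable_indic; rewrite (_ : [set _ | _] = `]-oo, k]%classic).
    exact: measurable_itv.
  by apply/seteqP; split => x /=; rewrite in_itv.
exact: measurableT_comp mI (pb t tI).
Qed.

Variable m : {finite_measure set (measurableTypeR R) -> \bar R}.
Hypothesis msupp : m (~` `]s, T]%classic) = 0%E.

Local Notation cl := (clamp s T).

Definition pint b := intg (m \x P)%E (fun z : measurableTypeR R * W => b (cl z.1) z.2).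

(** As [m] is carried by []s, T]], this is the integral over []s, t]]. The ray is chosen so that,
    path by path, [Iint] is by conversion the deterministic indefinite integral [cumint] studied
    below. *)
Definition Iint b (t : R) (w : W) : R :=
  \int[m]_q (\1_`]-oo, t]%classic q * b (cl q) w).

Lemma Iint_prog b : prog b -> prog (Iint b).
Proof.
move=> pb t tI.
(* Only times [q <= t] contribute, where the clamps to [[s, T]] and to [[s, t]] agree: hence only
   the information in [F t] is used. *)
rewrite (_ : (fun z => _) = fun z : measurableTypeR R * g_sigma_algebraType (F t) =>
   \int[m]_q (\1_`]-oo, clamp s t z.1]%classic q * b (clamp s t q) z.2)); last first.
  apply/funext => z; apply: eq_Rintegral => q _.
  rewrite indicE mem_setE in_itv/=; case: (lerP q _) => h; last by rewrite !mul0r.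
  rewrite (@clamp_le _ _ t)//; last by case/andP : tI.
  apply: le_trans h _.
  by have /andP[] := @clamp_itv _ s t z.1 (proj1 (andP tI)).
pose f (z : (measurableTypeR R * g_sigma_algebraType (F t)) * measurableTypeR R) :=
  (if z.2 <= clamp s t z.1.1 then 1 else 0) * b (clamp s t z.2) z.1.2.
rewrite (_ : (fun z => _) = fun z => \int[m]_q f (z, q)); last first.
  apply/funext => z; apply: eq_Rintegral => q _.
  by rewrite /f /= indicE mem_setE in_itv/=; case: ifP.
apply: measurable_Rint1; apply: measurable_funM.
  apply: measurable_fun_ifT => //; apply: measurable_fun_ler => //.
  apply: measurableT_comp; first exact: measurable_clamp.
  by apply: measurableT_comp => //; exact: measurable_fst.
have mi : measurable_fun setT (fun z : (measurableTypeR R * g_sigma_algebraType (F t)) * measurableTypeR R =>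
    (z.2, z.1.2)).
  apply: measurable_fun_pair => //.
  exact: measurableT_comp measurable_snd measurable_fst.
exact: measurableT_comp (pb t tI) mi.
Qed.

Lemma Iint_gmeas b t : prog b -> s <= t <= T -> gmeas (F t) (Iint b t).
Proof. by move=> pb tI; apply: prog_gmeas => //; exact: Iint_prog. Qed.

Lemma measurable_Iocc (A : set R) : (exists i : interval R, A = [set` i]) ->
  measurable_fun [set: measurableTypeR R * W] (fun z => \1_A z.1 : R).
Proof.
move=> [i ->]; have mI : measurable_fun setT (\1_[set` i] : measurableTypeR R -> R).
  by apply: measurable_indic; exact: measurable_itv.
exact: measurableT_comp mI measurable_fst.
Qed.

Lemma pint_indic (A : set R) b : (exists i : interval R, A = [set` i]) -> pint b ->
  intg (m \x P)%E (fun z => \1_A z.1 * b (cl z.1) z.2).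
Proof.
move=> Ai ib; apply: intg_le (ib).
  by apply: measurable_funM; [exact: measurable_Iocc|exact: intg_meas ib].
by move=> z; rewrite normrM ler_piMl// indicE; case: (_ \in _); rewrite ?normr0 ?normr1.
Qed.

Lemma Iint_intg b t : pint b -> intg P (Iint b t).
Proof.
move=> ib; apply: (@intg_Rint2 _ _ _ _ _ m P
  (fun z => \1_`]-oo, t]%classic z.1 * b (cl z.1) z.2)).
by apply: pint_indic => //; eexists.
Qed.

Lemma pint_path b : pint b -> {ae P, forall w, intg m (fun q => b (cl q) w)}.
Proof. exact: intg_sect2. Qed.

Definition pint2 b := sqi (m \x P)%E (fun z : measurableTypeR R * W => b (cl z.1) z.2).

Let sqi1 : sqi (m \x P)%E (fun=> 1 : R).
Proof.
split => //; under eq_fun do rewrite expr1n.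
apply/intgP; split => //; rewrite integral_cst// normr1 mul1e.
have E : (m \x P)%E (setT `*` setT) = (m setT * P setT)%E by exact: product_measure1E.
have : (m setT * P setT < +oo)%E by rewrite probability_setT mule1 ltey_eq fin_num_measure.
by rewrite -E setXTT.
Qed.

Lemma pint2_pint b : pint2 b -> pint b.
Proof.
move=> b2; have := sqiM b2 sqi1; rewrite /pint (_ : (fun=> _) = fun z => b (cl z.1) z.2)//.
by apply/funext => z; rewrite mulr1.
Qed.

Lemma pint2M b b' : pint2 b -> pint2 b' -> pint (fun q w => b q w * b' q w).
Proof. by move=> *; apply: sqiM. Qed.

Lemma pint2_bounded b k : prog b -> (forall t, s <= t <= T ->
  sqi P (b t) /\ \int[P]_w (b t w ^+ 2) <= k) -> pint2 b.
Proof.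
move=> pb bk; split; first exact: prog_joint.
apply: intg_prodP1; first by apply: measurable_funX; exact: prog_joint.
apply: (@le_lt_trans _ _ (\int[m]_x (k%:E))%E); last first.
  by rewrite integral_cst// ltey_eq fin_numM// fin_num_measure.
apply: ge0_le_integral => //.
- by move=> x _; apply: integral_ge0.
- apply: (@measurable_fun_fubini_tonelli_F _ _ _ _ _ P (fun z : measurableTypeR R * W => (`|b (cl z.1) z.2 ^+ 2|)%:E)) => //.
  apply/measurable_EFinP; apply: measurableT_comp => //.
  by apply: measurable_funX; exact: prog_joint.
move=> x _; have [[_ i] le] := bk _ (clamp_itv x sT).
under eq_integral do rewrite ger0_norm ?sqr_ge0//.
by rewrite -Rint_EFin// lee_fin.
Qed.

(** Cauchy-Schwarz along almost every path: the square is at most the mass of [m] times the integral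
    of [b ^+ 2], which has finite mean by Fubini. *)
Lemma Iint_sqi b t : pint2 b -> sqi P (Iint b t).
Proof.
move=> b2; have ib := pint2_pint b2; have mI := intg_meas (Iint_intg t ib).
split => //; case: b2 => mb ib2.
have iS : intg P (fun w => fine (m setT) * \int[m]_q (b (cl q) w ^+ 2)).
  by apply: intgZ; apply: (@intg_Rint2 _ _ _ _ _ m P (fun z => b (cl z.1) z.2 ^+ 2)).
apply: intg_aele iS; first exact: measurable_funX.
have aeI := pint_path ib; have aeI2 := intg_sect2 ib2.
apply: filterS2 aeI aeI2 => w iw iw2 /=.
have sw : sqi m (fun q => \1_`]-oo, t]%classic q * b (cl q) w).
  apply: sqi_indic; first exact: measurable_itv.
  by split; [exact: intg_meas iw|exact: iw2].
rewrite [leLHS]ger0_norm ?sqr_ge0// [leRHS]ger0_norm; last first.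
  by apply: mulr_ge0; [exact: fine_ge0|apply: Rint_ge0 => q; exact: sqr_ge0].
apply: (@le_trans _ _ ((\int[m]_q `|\1_`]-oo, t]%classic q * b (cl q) w|) ^+ 2)).
  rewrite -[leLHS]real_normK ?num_real// lerXn2r ?nnegrE//.
    by apply: Rint_ge0.
  by apply: Rint_norm; apply: intg_indic => //; exact: measurable_itv.
apply: le_trans (cauchy_schwarz_total sw) _.
rewrite ler_wpM2l ?fine_ge0//; apply: Rint_le => //; first by case: sw.
move=> q; rewrite exprMn ler_piMl ?sqr_ge0// expr_le1//.
Qed.

Lemma ind_itv_split (r t q : R) : r <= t ->
  \1_`]-oo, t]%classic q = \1_`]-oo, r]%classic q + \1_`]r, t]%classic q :> R.
Proof.
move=> rt; rewrite !indicE !mem_setE !in_itv/=.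
case: (lerP q r) => qr /=; first by rewrite (le_trans qr rt) addr0.
by rewrite add0r.
Qed.

Lemma Iint_split b r t w : r <= t -> intg m (fun q => b (cl q) w) ->
  Iint b t w = Iint b r w + \int[m]_q (\1_`]r, t]%classic q * b (cl q) w).
Proof.
move=> rt ib; rewrite -RintD; last 2 first.
- by apply: intg_indic => //; exact: measurable_itv.
- by apply: intg_indic => //; exact: measurable_itv.
by apply: eq_Rintegral => q _; rewrite (ind_itv_split _ rt) mulrDl.
Qed.

(** By Fubini it is enough to fix a time [q] in []r, t]]. There [\1_B * b q] is [F q]-measurable, so
    the martingale property allows [Y t] to be replaced by [Y q]. *)
Lemma projection Y b r t B : rmart Y -> prog Y -> prog b -> pint b ->
  s <= r -> r <= t -> t <= T -> F r B ->
  intg (m \x P)%E (fun z => Y t z.2 * b (cl z.1) z.2) ->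
  pint (fun q w => Y q w * b q w) ->
  \int[P]_w (\1_B w * (Y t w * \int[m]_q (\1_`]r, t]%classic q * b (cl q) w))) =
  \int[P]_w (\1_B w * \int[m]_q (\1_`]r, t]%classic q * (Y (cl q) w * b (cl q) w))).
Proof.
move=> rY pY pb ib sr rt tT FB i1 i2.
have rI : s <= r <= T by rewrite sr (le_trans rt).
have tI : s <= t <= T by rewrite tT (le_trans sr).
have mB := (sF rI).2 _ FB.
pose f1 (z : measurableTypeR R * W) :=
  \1_`]r, t]%classic z.1 * (\1_B z.2 * (Y t z.2 * b (cl z.1) z.2)).
pose f2 (z : measurableTypeR R * W) :=
  \1_`]r, t]%classic z.1 * (\1_B z.2 * (Y (cl z.1) z.2 * b (cl z.1) z.2)).
have mI : measurable_fun [set: measurableTypeR R * W] (fun z => \1_`]r, t]%classic z.1 : R).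
  by apply: measurable_Iocc; eexists.
have mBz : measurable_fun [set: measurableTypeR R * W] (fun z => \1_B z.2 : R).
  have mB' : measurable_fun setT (\1_B : W -> R) by exact: measurable_indic.
  exact: measurableT_comp mB' measurable_snd.
have ind1 (A : Type) (D : set A) (x : A) (y : R) : `|\1_D x * y| <= `|y|.
  by rewrite normrM ler_piMl// indicE; case: (_ \in _); rewrite ?normr0 ?normr1.
have if1 : intg (m \x P)%E f1.
  apply: intg_le (i1); first by do 2 apply: measurable_funM => //; exact: intg_meas i1.
  by move=> z; apply: le_trans (ind1 _ _ _ _) _; exact: ind1.
have if2 : intg (m \x P)%E f2.
  apply: intg_le (i2); first by do 2 apply: measurable_funM => //; exact: intg_meas i2.
  by move=> z; apply: le_trans (ind1 _ _ _ _) _; exact: ind1.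
transitivity (\int[(m \x P)%E]_z f1 z).
  rewrite Rint_prod2//; apply: Rint_ae; apply: filterS (pint_path ib) => w iw.
  rewrite mulrA -RintZ; last by apply: intg_indic => //; exact: measurable_itv.
  by apply: eq_Rintegral => q _; rewrite /f1 /= mulrCA -mulrA.
transitivity (\int[(m \x P)%E]_z f2 z); last first.
  rewrite Rint_prod2//; apply: Rint_ae; apply: filterS (intg_sect2 i2) => w iw.
  rewrite -RintZ; last by apply: intg_indic => //; exact: measurable_itv.
  by apply: eq_Rintegral => q _; rewrite /f2 /= mulrCA.
rewrite (Rint_prod1 if1) (Rint_prod1 if2); apply: Rint_ae.
apply: filterS2 (intg_sect1 i1) (intg_sect1 i2) => q iq1 iq2.
(* Outside []r, t]] both inner integrals are 0; inside, the clamp is the identity. *)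
rewrite /f1 /f2 /= indicE mem_setE in_itv/=.
case: (lerP q r) => /= rq; first by apply: eq_Rintegral => w _; rewrite !mul0r.
case: (lerP q t) => /= qt; last by apply: eq_Rintegral => w _; rewrite !mul0r.
have sq : s <= q by rewrite (le_trans sr)// ltW.
have qI : s <= q <= T by rewrite sq (le_trans qt).
rewrite /= clamp_id// in iq1 iq2 *.
have E x : forall w, 1 * (\1_B w * (Y x w * b q w)) = (\1_B w * b q w) * Y x w.
  by move=> w; rewrite mul1r -mulrA [b q w * _]mulrC.
under eq_Rintegral do rewrite E.
under [RHS]eq_Rintegral do rewrite E.
have E' x : (fun w => \1_B w * b q w * Y x w) = fun w => \1_B w * (Y x w * b q w).
  by apply/funext => w; rewrite -mulrA [b q w * _]mulrC.
apply: rmart_orth => //.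
- apply: measurable_funM; last exact: prog_gmeas.
  by apply: gmeas_indic; [exact: sF|apply: (monoF sr (ltW rq)) => //; case/andP: qI].
- by rewrite E'; exact: intg_indic.
- by rewrite E'; exact: intg_indic.
Qed.

Lemma intg_mul_tensor Y b t : s <= t <= T -> sqi P (Y t) -> pint2 b ->
  intg (m \x P)%E (fun z => Y t z.2 * b (cl z.1) z.2).
Proof.
move=> tI [mY iY] b2; apply: sqiM b2; split.
  exact: measurableT_comp mY measurable_snd.
apply: intg_prodP1.
  by apply: measurable_funX; exact: measurableT_comp mY measurable_snd.
rewrite /= integral_cst//; apply: lte_mul_pinfty => //.
- exact: integral_ge0.
- by rewrite ge0_fin_numE; [by case/intgP: iY|exact: integral_ge0].
- by rewrite ltey_eq fin_num_measure.
Qed.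

(** This process is formally [int I dM] with [I = Iint b], an integral that is never constructed.
    Its increment over []r, t]] is the sum of [I_r (M_t - M_r)], centred by orthogonality, and of
    [M_t (I_t - I_r) - int_r^t M b dm], centred by [projection]. *)
Lemma rmart_ibp M b : rmart M -> prog M -> sqi P (M T) -> prog b -> pint2 b ->
  rmart (fun t w => M t w * Iint b t w - Iint (fun q w => M q w * b q w) t w).
Proof.
move=> rM pM sMT pb b2; have sM := rmart_sqi rM sMT.
have M2 : pint2 M by apply: pint2_bounded (pM) _ => t tI; exact: sM.
have iMb : pint (fun q w => M q w * b q w) by exact: pint2M.
have ib := pint2_pint b2.
have sI t := Iint_sqi t b2.
have pMb : prog (fun q w => M q w * b q w) by exact: progM.
have iMI r t : s <= r <= T -> intg P (fun w => M r w * Iint b t w).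
  by move=> rI; apply: sqiM => //; case: (sM r rI).
have [mM _ _] := rM.
split => [t tI|t tI|r t B sr rt tT FB].
- apply: measurable_funB; last exact: Iint_gmeas.
  by apply: measurable_funM; [exact: mM|exact: Iint_gmeas].
- by apply: intgB; [exact: iMI|exact: Iint_intg].
have rI : s <= r <= T by rewrite sr (le_trans rt).
have tI : s <= t <= T by rewrite tT (le_trans sr).
have mB := (sF rI).2 _ FB.
pose D w := \int[m]_q (\1_`]r, t]%classic q * b (cl q) w).
pose D' w := \int[m]_q (\1_`]r, t]%classic q * (M (cl q) w * b (cl q) w)).
have proj : \int[P]_w (\1_B w * (M t w * D w)) = \int[P]_w (\1_B w * D' w).
  by apply: projection => //; apply: intg_mul_tensor => //; case: (sM t tI).
have DE : {ae P, forall w, D w = Iint b t w - Iint b r w}.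
  by apply: filterS (pint_path ib) => w iw; rewrite (Iint_split rt iw) addrAC subrr add0r.
have D'E : {ae P, forall w, D' w = Iint (fun q w => M q w * b q w) t w - Iint (fun q w => M q w * b q w) r w}.
  by apply: filterS (pint_path iMb) => w iw; rewrite (Iint_split rt iw) addrAC subrr add0r.
have E x : (fun w => (\1_B w * Iint b r w) * M x w) = fun w => \1_B w * (M x w * Iint b r w).
  by apply/funext => w; ring.
have orth : \int[P]_w ((\1_B w * Iint b r w) * M t w) = \int[P]_w ((\1_B w * Iint b r w) * M r w).
  apply: rmart_orth => //.
  - by apply: measurable_funM; [exact: gmeas_indic (sF rI) FB|exact: Iint_gmeas].
  - by rewrite E; apply: intg_indic => //; exact: iMI.
  - by rewrite E; apply: intg_indic => //; exact: iMI.
transitivity (\int[P]_w (\1_B w * (M r w * Iint b r w - Iint (fun q w => M q w * b q w) r w)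
   + (((\1_B w * Iint b r w) * M t w - (\1_B w * Iint b r w) * M r w)
   + (\1_B w * (M t w * D w) - \1_B w * D' w)))).
  apply: Rint_ae; apply: filterS2 DE D'E => w -> ->; ring.
have i1 : intg P (fun w => \1_B w * Iint b r w * M t w) by rewrite E; apply: intg_indic => //; exact: iMI.
have i2 : intg P (fun w => \1_B w * Iint b r w * M r w) by rewrite E; apply: intg_indic => //; exact: iMI.
have mD (c : R -> W -> R) : measurable_fun [set: measurableTypeR R * W] (fun z => c (cl z.1) z.2) ->
    measurable_fun [set: W] (fun w => \int[m]_q (\1_`]r, t]%classic q * c (cl q) w)).
  move=> mc; apply: (@measurable_Rint2 _ _ _ _ _ m (fun z => \1_`]r, t]%classic z.1 * c (cl z.1) z.2)).
  by apply: measurable_funM => //; apply: measurable_Iocc; eexists.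
have i3 : intg P (fun w => \1_B w * (M t w * D w)).
  apply: intg_indic => //; apply: (@intg_ae _ _ _ _ (fun w => M t w * Iint b t w - M t w * Iint b r w)).
  - apply: measurable_funM; first by case: (sM t tI) => -[].
    by apply: mD; exact: (prog_joint pb).
  - by apply: intgB; exact: iMI.
  - by apply: filterS DE => w ->; ring.
have i4 : intg P (fun w => \1_B w * D' w).
  apply: intg_indic => //; apply: (@intg_ae _ _ _ _ (fun w => Iint (fun q w => M q w * b q w) t w - Iint (fun q w => M q w * b q w) r w)).
  - by apply: (mD (fun q w => M q w * b q w)); exact: (prog_joint pMb).
  - by apply: intgB; exact: Iint_intg.
  - by apply: filterS D'E => w ->.
rewrite RintD; last 2 first.
- by apply: intg_indic => //; apply: intgB; [exact: iMI|exact: Iint_intg].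
- by apply: intgD; exact: intgB.
rewrite RintD; [|exact: intgB|exact: intgB].
by rewrite (RintB i1 i2) (RintB i3 i4) orth proj !subrr !addr0.
Qed.

End filtered_space.

(** * Indefinite integrals with respect to an atomless measure *)

Section atomless_measure.
Context (R : realType) (m : {finite_measure set (measurableTypeR R) -> \bar R}).
Hypothesis atomless : forall q : R, m [set q] = 0%E.
Implicit Types f g l : R -> R.

Definition cumint f (t : R) : R := \int[m]_q (\1_`]-oo, t]%classic q * f q).

Let mI (t : R) : measurable (`]-oo, t]%classic : set (measurableTypeR R)).
Proof. exact: measurable_itv. Qed.

Lemma indicE_ray (t q : R) : \1_`]-oo, t]%classic q = (if q <= t then 1 else 0) :> R.
Proof. by rewrite indicE mem_setE in_itv/=; case: ifP. Qed.

Lemma cumint_intg f t : intg m f -> intg m (fun q => \1_`]-oo, t]%classic q * f q).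
Proof. exact: intg_indic. Qed.

Lemma cumint_le f g t : intg m f -> intg m g -> (forall q, f q <= g q) ->
  cumint f t <= cumint g t.
Proof.
move=> fi gi fg; apply: Rint_le; [exact: cumint_intg|exact: cumint_intg|move=> q].
by rewrite ler_wpM2l.
Qed.

Lemma cumint_ge0 f t : (forall q, 0 <= f q) -> 0 <= cumint f t.
Proof. by move=> f0; apply: Rint_ge0 => q; rewrite mulr_ge0. Qed.

Lemma cumintD f g t : intg m f -> intg m g ->
  cumint (fun q => f q + g q) t = cumint f t + cumint g t.
Proof.
move=> fi gi; rewrite -RintD; [|exact: cumint_intg..].
by apply: eq_Rintegral => q _; rewrite mulrDr.
Qed.

Lemma cumintZ k f t : intg m f -> cumint (fun q => k * f q) t = k * cumint f t.
Proof.
move=> fi; rewrite -RintZ; [|exact: cumint_intg].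
by apply: eq_Rintegral => q _; rewrite mulrCA.
Qed.

Lemma cumintB f g t : intg m f -> intg m g ->
  cumint (fun q => f q - g q) t = cumint f t - cumint g t.
Proof.
move=> fi gi; rewrite -RintB; [|exact: cumint_intg..].
by apply: eq_Rintegral => q _; rewrite mulrBr.
Qed.

Lemma cumint_ae f g t : {ae m, forall q : measurableTypeR R, f q = g q} -> cumint f t = cumint g t.
Proof. by move=> fg; apply: Rint_ae; apply: filterS fg => q ->. Qed.

Lemma cumint_norm f t : intg m f -> `|cumint f t| <= cumint (fun q => `|f q|) t.
Proof.
move=> fi; apply: le_trans (Rint_norm (cumint_intg t fi)) _.
rewrite le_eqVlt; apply/orP; left; apply/eqP; apply: eq_Rintegral => q _.
by rewrite normrM ger0_norm.
Qed.

Lemma cumint_nd f r t : intg m f -> (forall q, 0 <= f q) -> r <= t -> cumint f r <= cumint f t.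
Proof.
move=> fi f0 rt; apply: Rint_le; [exact: cumint_intg..|move=> q].
rewrite ler_wpM2r// !indicE_ray; case: ifPn => qr; last by case: ifP.
by rewrite (le_trans qr rt).
Qed.

Lemma cumint_le_total f t : intg m f -> (forall q, 0 <= f q) -> cumint f t <= \int[m]_q f q.
Proof.
move=> fi f0; apply: Rint_le => //; first exact: cumint_intg.
by move=> q; rewrite ler_piMl// indicE_ray; case: ifP => _ //; exact: ler01.
Qed.

Lemma cumint_bounded f t : intg m f -> `|cumint f t| <= \int[m]_q `|f q|.
Proof.
move=> fi; apply: le_trans (cumint_norm t fi) _.
by apply: cumint_le_total => //; exact: intg_abs.
Qed.

Lemma ae_neq (p : R) : {ae m, forall q : measurableTypeR R, q <> p}.
Proof.
exists [set p]; split; [exact: measurable_set1|exact: atomless|].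
by move=> q /= h; apply: contrapT => h'; apply: h.
Qed.

(** Dominated convergence: as [u n] tends to [t], the indicators of the rays are eventually constant
    at every [q] other than [t], and [[set t]] is null. *)
Lemma cumint_continuous f : intg m f -> continuous (cumint f).
Proof.
move=> fi t; apply/(@cvg_nbhsP R R^o (cumint f : R^o -> R^o)) => u ut.
apply: (@Rint_dct _ _ _ m (fun n q => \1_`]-oo, u n]%classic q * f q)
  (fun q => \1_`]-oo, t]%classic q * f q) (fun q => `|f q|)).
- by move=> n; exact: intg_meas (cumint_intg _ fi).
- exact: intg_meas (cumint_intg _ fi).
- apply: filterS (ae_neq t) => q qt; apply: cvgMl.
  apply: cvg_near_cst; rewrite indicE_ray.
  have /cvgrPdist_lt/(_ `|t - q|) := ut.
  have d0 : 0 < `|t - q| by rewrite normr_gt0 subr_eq0 eq_sym; apply/eqP.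
  move=> /(_ d0); apply: filterS => n tun; rewrite indicE_ray.
  move: tun qt; case: (ltgtP q t) => // qt tun _.
    rewrite ifT// ltW//; move: tun; rewrite [X in _ < X]gtr0_norm ?subr_gt0// ltr_norml => /andP[_]; lra.
  by rewrite ifF//; apply/negbTE; rewrite -ltNge; move: tun; rewrite [X in _ < X]ltr0_norm ?subr_lt0// ltr_norml => /andP[]; lra.
- by move=> n q; rewrite normrM ler_piMl// indicE_ray; case: ifP; rewrite ?normr0 ?normr1.
- exact: intg_abs.
Qed.

Lemma measurable_cumint f : intg m f -> measurable_fun [set: measurableTypeR R] (cumint f).
Proof. by move=> fi; apply: continuous_measurable_fun; exact: cumint_continuous. Qed.

Lemma intg_cumintM f g : intg m f -> intg m g -> intg m (fun q => cumint f q * g q).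
Proof.
move=> fi gi; set k := \int[m]_q `|f q|.
apply: (@intg_le _ _ _ m _ (fun q => k * g q)); last exact: intgZ.
  by apply: measurable_funM; [exact: measurable_cumint|exact: intg_meas gi].
move=> q; rewrite !normrM ler_wpM2r// (le_trans (cumint_bounded q fi))// ler_norm//.
Qed.

(** Integration by parts: the product is an integral over the square of []-oo, t]], which is cut
    along the diagonal into [B] ([q <= r]) and [C] ([r < q]); each half is integrated first in its
    smaller variable. *)
Lemma cumintM f g t : intg m f -> intg m g ->
  cumint f t * cumint g t = cumint (fun q => cumint f q * g q) t + cumint (fun q => cumint g q * f q) t.
Proof.
move=> fi gi.
have mf : measurable_fun [set: measurableTypeR R * measurableTypeR R] (fun z => f z.1).
  by have mf := intg_meas fi; exact: measurableT_comp mf measurable_fst.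
have mg : measurable_fun [set: measurableTypeR R * measurableTypeR R] (fun z => g z.2).
  by have mg := intg_meas gi; exact: measurableT_comp mg measurable_snd.
pose A (z : measurableTypeR R * measurableTypeR R) := f z.1 * g z.2.
have iA : intg (m \x m)%E A.
  apply: intg_prodP1; first exact: measurable_funM.
  have /intgP[_ f1] := fi; have /intgP[_ g1] := gi.
  rewrite (_ : integral _ _ _ = \int[m]_x (`|f x|%:E * (\int[m]_y `|g y|%:E)))%E; last first.
    apply: eq_integral => x _; rewrite -ge0_integralZl//.
      by apply: eq_integral => y _; rewrite /A normrM EFinM.
    by apply/measurable_EFinP; apply: measurableT_comp => //; exact: intg_meas gi.
  rewrite ge0_integralZr//; last 2 first.
    by apply/measurable_EFinP; apply: measurableT_comp => //; exact: intg_meas fi.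
    exact: integral_ge0.
  apply: lte_mul_pinfty => //; first exact: integral_ge0.
  by rewrite ge0_fin_numE//; exact: integral_ge0.
have mle (p1 p2 : measurableTypeR R * measurableTypeR R -> R) :
    measurable_fun setT p1 -> measurable_fun setT p2 ->
    measurable_fun setT (fun z => if p1 z <= p2 z then 1 else 0 : R).
  by move=> m1 m2; apply: measurable_fun_ifT => //; exact: measurable_fun_ler.
pose i1 (z : measurableTypeR R * measurableTypeR R) : R := if (z.1 : R) <= z.2 then 1 else 0.
pose B (z : measurableTypeR R * measurableTypeR R) :=
  \1_`]-oo, t]%classic z.2 * (i1 z * A z).
pose C (z : measurableTypeR R * measurableTypeR R) :=
  \1_`]-oo, t]%classic z.1 * ((1 - i1 z) * A z).
have m1 : measurable_fun [set: measurableTypeR R * measurableTypeR R] i1 by exact: mle.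
have mi2 : measurable_fun [set: measurableTypeR R * measurableTypeR R] (fun z => \1_`]-oo, t]%classic z.2 : R).
  by under eq_fun do rewrite indicE_ray; exact: mle.
have mi3 : measurable_fun [set: measurableTypeR R * measurableTypeR R] (fun z => \1_`]-oo, t]%classic z.1 : R).
  by under eq_fun do rewrite indicE_ray; exact: mle.
have mA := intg_meas iA.
have iB : intg (m \x m)%E B.
  apply: intg_le (iA); first by do 2 apply: measurable_funM => //.
  move=> z; rewrite /B /i1 indicE_ray; do 2 case: ifP => _; rewrite ?mul1r ?mul0r ?normr0//.
have iC : intg (m \x m)%E C.
  apply: intg_le (iA).
    by do 2 apply: measurable_funM => //; exact: measurable_funB.
  by move=> z; rewrite /C /i1 indicE_ray; do 2 case: ifP => _; rewrite ?subrr ?subr0 ?mul1r ?mul0r ?normr0.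
have -> : cumint f t * cumint g t = \int[(m \x m)%E]_z (B z + C z).
  transitivity (\int[(m \x m)%E]_z (\1_`]-oo, t]%classic z.1 * (\1_`]-oo, t]%classic z.2 * A z))).
    rewrite Rint_prod1; last first.
      apply: intg_le (iA); first by do 2 apply: measurable_funM => //.
      by move=> z; rewrite !indicE_ray; do 2 case: ifP => _; rewrite ?mul1r ?mul0r ?normr0.
    rewrite mulrC -RintZ; last exact: cumint_intg.
    apply: eq_Rintegral => q _; rewrite -mulrC /= -RintZ; last exact: cumint_intg.
    by apply: eq_Rintegral => r _; rewrite /A/=; ring.
  apply: eq_Rintegral => -[q r] _; rewrite /B /C /i1 !indicE_ray /=.
  case: (lerP q r) => qr; case: (lerP q t) => qt; case: (lerP r t) => rt; rewrite !(mul0r, mul1r, mulr0, addr0, add0r, subrr, subr0)//; exfalso; lra.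
rewrite (RintD iB iC) (Rint_prod2 iB) (Rint_prod1 iC); congr (_ + _).
  apply: eq_Rintegral => r _.
  transitivity (\1_`]-oo, t]%classic r * g r * \int[m]_q (\1_`]-oo, r]%classic q * f q)); last by rewrite /cumint; ring.
  rewrite -RintZ; last exact: cumint_intg.
  by apply: eq_Rintegral => q _; rewrite /B /A /i1 /= !indicE_ray; do 2 case: ifP => _; ring.
apply: eq_Rintegral => q _; rewrite /cumint.
transitivity (\1_`]-oo, t]%classic q * f q * \int[m]_r (\1_`]-oo, q]%classic r * g r)); last by ring.
rewrite -RintZ; last exact: cumint_intg.
(* [C] has the strict inequality [r < q] and [cumint] the large one; they differ at [r = q] only, a
   null set. *)
apply: Rint_ae; apply: filterS (ae_neq q) => r rq; rewrite /C /A /i1 /= !indicE_ray.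
by move: rq; case: (ltgtP r q) => // rq _; rewrite ?subr0 ?subrr; ring.
Qed.

End atomless_measure.

(** * Pathwise weights that cut off the variation *)

Section truncation.
Context (R : realType) (m : {finite_measure set (measurableTypeR R) -> \bar R}).
Hypothesis atomless : forall q : R, m [set q] = 0%E.
Variables (s T : R).
Hypothesis sT : s <= T.
Hypothesis msupp : m (~` `]s, T]%classic) = 0%E.
Local Notation ci := (cumint m).

Lemma ae_supp : {ae m, forall q : measurableTypeR R, s < (q : R) <= T}.
Proof.
exists (~` `]s, T]%classic); split; [|exact: msupp|].
  by apply: measurableC; exact: measurable_itv.
by move=> q /= h; rewrite in_itv.
Qed.

Lemma cumint_start f t : t <= s -> ci f t = 0.
Proof.
move=> ts; rewrite /cumint.
rewrite (@Rint_ae _ _ _ _ _ (fun=> 0)); first by rewrite Rintegral_cst// mul0r.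
apply: filterS ae_supp => q /andP[sq _]; rewrite indicE_ray ifF ?mul0r//.
by apply/negbTE; rewrite -ltNge (le_lt_trans ts).
Qed.

Lemma cumint_end f t : T <= t -> ci f t = \int[m]_q f q.
Proof.
move=> Tt; apply: Rint_ae; apply: filterS ae_supp => q /andP[_ qT].
by rewrite indicE_ray (le_trans qT Tt) mul1r.
Qed.

Lemma cumint_ocitv f : ci f T = \int[m]_q (\1_`]s, T]%classic q * f q).
Proof.
rewrite cumint_end//; apply: Rint_ae; apply: filterS ae_supp => q qI.
by rewrite indicE mem_setE in_itv/= qI mul1r.
Qed.

Section path.
Variables (l : R -> R) (n : R).
Hypotheses (n0 : 0 < n) (l0 : forall q, 0 <= l q) (li : intg m l).

Let lam q := \1_[set x | x <= n] (ci l q) * l q.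

Lemma trunc_le q : 0 <= lam q <= l q.
Proof.
rewrite /lam mulr_ge0//= ler_piMl//.
Qed.

Lemma trunc_intg : intg m lam.
Proof.
apply: (@intg_le _ _ _ m _ l) => //.
  apply: measurable_funM; last exact: intg_meas li.
  have mL := measurable_cumint atomless li.
  rewrite (_ : (fun q => _) = fun q => if ci l q <= n then 1 else 0); last first.
    apply/funext => q; rewrite indicE; case: ifPn => h; first by rewrite mem_set.
    by rewrite memNset//; exact/negP.
  by apply: measurable_fun_ifT => //; exact: measurable_fun_ler.
by move=> q; have /andP[h1 h2] := trunc_le q; rewrite !ger0_norm.
Qed.

Let L_nd r t : r <= t -> ci l r <= ci l t.
Proof. exact: cumint_nd. Qed.

Let ivt t v : 0 <= v -> v <= ci l t -> s <= t -> exists2 tau, s <= tau <= t & ci l tau = v.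
Proof.
move=> v0 vt st; have [|||tau] := @IVT R (ci l) s t v.
- by [].
- by apply: continuous_subspaceT; exact: cumint_continuous.
- rewrite (cumint_start _ (lexx s)) min_l; last by apply: cumint_ge0.
  by rewrite max_r ?v0//; apply: cumint_ge0.
by rewrite in_itv/= => ? ?; exists tau.
Qed.

(** [ci lam] is [ci l] capped at [n]: by continuity [ci l] takes every intermediate value, and [lam]
    is [l] as long as [ci l <= n] and 0 afterwards. The present lemma is the upper bound,
    [trunc_cumint_eq] the equality past the level. *)
Lemma trunc_cumint_le t : ci lam t <= n.
Proof.
(* The slack [e] ensures that [lam] vanishes after [tau]: at level [n] exactly, [ci l] may stay flat
   for a while and the indicator in [lam] is still 1 there. *)
apply/ler_addgt0Pr => e e0.
have [Lt|Lt] := lerP (ci l t) (n + e).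
  apply: le_trans Lt; apply: cumint_le => //; first exact: trunc_intg.
  by move=> q; have /andP[] := trunc_le q.
have st : s <= t.
  rewrite leNgt; apply/negP => /ltW/cumint_start H; move: Lt; rewrite H.
  by rewrite ltNge ltW// addr_gt0.
have [|tau tauI tauE] := ivt _ (ltW Lt) st; first by rewrite addr_ge0// ltW.
rewrite -tauE; apply: Rint_le; [exact/cumint_intg/trunc_intg|exact: cumint_intg|].
move=> q; rewrite /lam !indicE_ray; case: (leP q tau) => qtau.
  by do 2 case: ifP => _; rewrite ?mul1r ?mul0r.
rewrite [X in _ * (X * _)]ifF ?mul0r ?mulr0//.
apply/negbTE; rewrite -ltNge; apply: lt_le_trans (L_nd (ltW qtau)).
by rewrite tauE ltrDl.
Qed.

Lemma trunc_cumint_eq t : n < ci l t -> ci lam t = n.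
Proof.
move=> nL; apply/eqP; rewrite eq_le trunc_cumint_le/=.
have st : s <= t.
  rewrite leNgt; apply/negP => /ltW/cumint_start H; move: nL; rewrite H.
  by rewrite ltNge ltW.
have [tau /andP[_ taut] tauE] := ivt (ltW n0) (ltW nL) st.
rewrite -{1}tauE; apply: Rint_le; [exact: cumint_intg|exact/cumint_intg/trunc_intg|].
move=> q; rewrite !indicE_ray; case: (leP q tau) => qtau; last first.
  by rewrite mul0r; apply: mulr_ge0; [case: ifP|have /andP[] := trunc_le q].
rewrite (le_trans qtau taut) !mul1r /lam indicE mem_set ?mul1r//=.
by rewrite -tauE; exact: L_nd.
Qed.

End path.

Section weights.
Variables (c : R -> R) (n : R).
Hypotheses (n0 : 0 < n) (ic : intg m c).

Let l q := `|c q|.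
Let lam q := \1_[set x | x <= n] (ci l q) * l q.
(** A continuous nonincreasing weight that starts at 1 and is 0 once the variation [ci l] of
    [C = ci c] exceeds [n]; it replaces stopping [C] at that level. [h] below is the density of
    [C y]. *)
Let y q := 1 - ci lam q / n.
Let h q := c q * y q - ci c q * (lam q / n).

Let l0 q : 0 <= l q. Proof. by rewrite /l. Qed.
Let il : intg m l. Proof. exact: intg_abs. Qed.
Let ilam : intg m lam. Proof. exact: trunc_intg. Qed.
Let lam0 q : 0 <= lam q. Proof. by have /andP[] := trunc_le n l0 q. Qed.
Let laml q : lam q <= l q. Proof. by have /andP[] := trunc_le n l0 q. Qed.

Lemma weight_itv q : 0 <= y q <= 1.
Proof.
rewrite /y subr_ge0 ler_pdivrMr// mul1r trunc_cumint_le//= gerBl.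
by apply: divr_ge0; [exact: cumint_ge0|exact: ltW].
Qed.

Lemma weight_ge q : ci l q <= n / 2 -> 2^-1 <= y q.
Proof.
move=> Lq; have : ci lam q <= n / 2.
  by apply: le_trans Lq; exact: cumint_le.
have ni : n / n = 1 by rewrite divff// gt_eqF.
move=> H; have : ci lam q / n <= 2^-1 by rewrite ler_pdivrMr// mulrC.
rewrite /y; lra.
Qed.

(** Past the level, [lam] and [y] vanish together, hence [h] too; before it, [|ci c| <= ci l <= n].
    All the bounds that follow rest on this alternative. *)
Let case_n q : (ci l q <= n /\ lam q = l q) \/ (n < ci l q /\ lam q = 0 /\ y q = 0).
Proof.
case: (lerP (ci l q) n) => H; [left|right]; split => //.
  by rewrite /lam indicE mem_set// mul1r.
rewrite /lam indicE memNset ?mul0r//=; last by apply/negP; rewrite -ltNge.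
by rewrite /y trunc_cumint_eq// divff ?subrr// gt_eqF.
Qed.

Let C_le q : `|ci c q| <= ci l q.
Proof. exact: cumint_norm. Qed.

(** Below the level, [lam = l]: the term [c y] is at most [l], and so is [C lam / n] because
    [|C| <= n]. The bound by [lam] matters because the total integral of [lam] is at most [n],
    whatever the path. *)
Lemma weight_bound_h q : `|h q| <= 2 * lam q.
Proof.
have /andP[y0 y1] := weight_itv q.
have [[Ln lE]|[_ [l_0 y_0]]] := case_n q; last first.
  by rewrite /h l_0 y_0 !(mul0r, mulr0) subr0 normr0.
rewrite lE; have -> : 2 * l q = l q + l q by ring.
rewrite /h lE; apply: le_trans (ler_normB _ _) _; apply: lerD.
  by rewrite normrM (ger0_norm y0) ler_piMr.
have ln0 : 0 <= l q / n by apply: divr_ge0; [exact: l0|exact: ltW].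
rewrite normrM (ger0_norm ln0) mulrCA ler_piMr//.
by rewrite ler_pdivrMr// mul1r (le_trans (C_le q)).
Qed.

Lemma weight_bound_Ch q : `|ci c q * h q| <= n * (2 * lam q).
Proof.
rewrite normrM; have [[Ln _]|[_ [l_0 _]]] := case_n q.
  apply: ler_pM => //; [exact: le_trans (C_le q) Ln|exact: weight_bound_h].
by have := weight_bound_h q; rewrite l_0 !mulr0 normr_le0 => /eqP ->; rewrite normr0 mulr0.
Qed.

Lemma weight_bound_Ccy q : `|ci c q * c q * y q| <= n * lam q.
Proof.
have /andP[y0 y1] := weight_itv q.
have [[Ln ->]|[_ [l_0 y_0]]] := case_n q; last first.
  by rewrite y_0 l_0 !mulr0 normr0.
rewrite normrM (ger0_norm y0); apply: (@le_trans _ _ `|ci c q * c q|); first by rewrite ler_piMr.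
by rewrite normrM ler_wpM2r// (le_trans (C_le q)).
Qed.

Lemma weight_bound_C2lam q : 0 <= ci c q ^+ 2 * lam q <= n ^+ 2 * lam q.
Proof.
rewrite mulr_ge0 ?sqr_ge0//=; have [[Ln _]|[_ [-> _]]] := case_n q; last by rewrite !mulr0.
rewrite ler_wpM2r// -[leLHS]real_normK ?num_real// lerXn2r ?nnegrE//; first exact: ltW.
exact: le_trans (C_le q) Ln.
Qed.

Let iy f : intg m f -> intg m (fun q => f q * y q).
Proof.
move=> fi; apply: (@intg_le _ _ _ m _ f) => //.
  apply: measurable_funM; first exact: intg_meas fi.
  apply: measurable_funB => //; apply: measurable_funM => //.
  exact: measurable_cumint.
by move=> q; have /andP[y0 y1] := weight_itv q; rewrite normrM (ger0_norm y0) ler_piMr.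
Qed.

Let iCc : intg m (fun q => ci c q * c q).
Proof. exact: intg_cumintM. Qed.

Let iln : intg m (fun q => lam q / n).
Proof. by under eq_fun do rewrite mulrC; exact: intgZ. Qed.

Let iCln : intg m (fun q => ci c q * (lam q / n)).
Proof. exact: intg_cumintM. Qed.

Lemma weight_intg_h : intg m h.
Proof. by apply: intgB => //; exact: iy. Qed.

Lemma weight_intg_Ccy : intg m (fun q => ci c q * c q * y q).
Proof. exact: iy. Qed.

Lemma weight_intg_C2lam : intg m (fun q => ci c q ^+ 2 * lam q).
Proof.
apply: (@intg_le _ _ _ m _ (fun q => n ^+ 2 * lam q)).
- apply: measurable_funM; last exact: intg_meas ilam.
  by apply: measurable_funX; exact: measurable_cumint.
- by move=> q; have /andP[h0 h1] := weight_bound_C2lam q; rewrite !ger0_norm// (le_trans h0).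
- exact: intgZ.
Qed.

Let lnE t : ci (fun q => lam q / n) t = ci lam t / n.
Proof.
rewrite mulrC -cumintZ//.
by congr (cumint m _ t); apply/funext => q; rewrite mulrC.
Qed.

(* d(C y) = y dC + C dy *)
Lemma weight_product t : ci h t = ci c t * y t.
Proof.
rewrite cumintB//; last exact: iy.
rewrite /y mulrBr mulr1 -lnE cumintM//.
rewrite (_ : ci (fun q => c q * y q) t = ci c t - ci (fun q => ci (fun q => lam q / n) q * c q) t).
  by ring.
rewrite -cumintB//; last by apply: intg_cumintM.
by apply: cumint_ae; apply: aeW => q; rewrite /y lnE; ring.
Qed.

Lemma weight_Ch t : ci (fun q => ci c q * h q) t =
  ci (fun q => ci c q * c q * y q) t - n^-1 * ci (fun q => ci c q ^+ 2 * lam q) t.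
Proof.
rewrite -cumintZ; [|exact: weight_intg_C2lam].
rewrite -cumintB; [|exact: weight_intg_Ccy|by apply: intgZ; exact: weight_intg_C2lam].
by apply: cumint_ae; apply: aeW => q; rewrite /h; ring.
Qed.

(* d(C^2 y) = 2 C y dC + C^2 dy *)
Lemma weight_square t : ci c t ^+ 2 * y t =
  2 * ci (fun q => ci c q * c q * y q) t - n^-1 * ci (fun q => ci c q ^+ 2 * lam q) t.
Proof.
(* The density of [C ^+ 2], by [cumintM] applied to [c] twice. *)
pose g q := 2 * (ci c q * c q).
have ig : intg m g by exact: intgZ.
have gE q : ci g q = ci c q ^+ 2.
  by rewrite cumintZ// expr2 cumintM//; ring.
rewrite -gE /y mulrBr mulr1 -lnE cumintM//.
have E1 : ci (fun q => ci g q * (lam q / n)) t = n^-1 * ci (fun q => ci c q ^+ 2 * lam q) t.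
  rewrite -cumintZ; [|exact: weight_intg_C2lam].
  by apply: cumint_ae; apply: aeW => q; rewrite gE; ring.
rewrite E1 opprD addrA addrAC; congr (_ - _).
rewrite -cumintB//; last exact: intg_cumintM.
rewrite -cumintZ; [|exact: weight_intg_Ccy].
by apply: cumint_ae; apply: aeW => q; rewrite /g lnE /y; ring.
Qed.

End weights.

(** The sets over which [f] integrates to 0 form a lambda-system. It contains the half-open
    intervals, where the integral is a difference of two values of [cumint], and these are stable
    under intersection and generate the Borel sets. *)
Lemma cumint_eq0 f : intg m f -> (forall t, cumint m f t = 0) -> {ae m, forall q : measurableTypeR R, f q = 0}.
Proof.
move=> fi f0.
pose H := [set A : set (measurableTypeR R) | measurable A /\ \int[m]_q (\1_A q * f q) = 0].
have subH : @measurable _ (measurableTypeR R) `<=` H.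
  apply: lambda_system_subset; [exact: ocitvI| |  |by []].
  - split => //.
    + split => //; rewrite -[RHS](f0 T) cumint_end//.
      by apply: eq_Rintegral => q _; rewrite indicT mul1r.
    + move=> A B BA [mA A0] [mB B0]; split; first exact: measurableD.
      transitivity (\int[m]_q (\1_A q * f q - \1_B q * f q)).
        apply: eq_Rintegral => q _; rewrite -mulrBl; congr (_ * _).
        rewrite !indicE in_setD; case: (boolP (q \in B)) => qB /=.
          by rewrite (_ : q \in A) ?subrr//; apply: mem_set; apply: BA; exact: set_mem.
        by rewrite andbT subr0.
      by rewrite RintB ?A0 ?B0 ?subr0//; exact: intg_indic.
    + move=> A ndA HA; have mA n : measurable (A n) by case: (HA n).
      split; first exact: bigcupT_measurable.
      have := @Rint_dct _ _ _ m (fun n q => \1_(A n) q * f q)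
        (fun q => \1_(\bigcup_n A n) q * f q) (fun q => `|f q|) _ _ _ _ (intg_abs fi).
      have -> : (fun n => \int[m]_q (\1_(A n) q * f q)) = fun=> 0.
        by apply/funext => n; case: (HA n).
      move=> cv; rewrite -(cvg_lim _ (cv _ _ _ _)) ?lim_cst//.
      * by move=> n; apply: intg_meas (intg_indic _ fi).
      * by apply: intg_meas (intg_indic _ fi) => //; exact: bigcupT_measurable.
      * apply: aeW => q; apply: cvgMl; apply: cvg_near_cst.
        have [[n _ An]|nA] := pselect ((\bigcup_n A n) q).
          exists n => // k /= nk; rewrite !indicE !mem_set//; first by exists n.
          by have /subsetPset := ndA _ _ nk; exact.
        apply: nearW => k; rewrite !indicE !memNset// => Ak; apply: nA; by exists k.
      * move=> n q; rewrite normrM ler_piMl// indicE; case: (_ \in _); rewrite ?normr0 ?normr1//.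
  - move=> _ [[a b] _ <-]; split; first exact: measurable_itv.
    have [ab|ba] := leP a b; last first.
      rewrite (_ : [set` _] = set0); last by rewrite set_itv_ge// -leNgt bnd_simp ltW.
      under eq_Rintegral do rewrite indicE in_set0 mul0r.
      by rewrite Rintegral_cst// mul0r.
    transitivity (cumint m f b - cumint m f a); last by rewrite !f0 subrr.
    rewrite -RintB; [|exact: cumint_intg..].
    apply: eq_Rintegral => q _; rewrite -mulrBl; congr (_ * _).
    by rewrite (ind_itv_split _ ab) addrAC subrr add0r.
have /= := @integral_ae_eq _ _ _ m setT measurableT (cst 0%E) (EFin \o f) fi (measurable_cst _).
suff A E : E `<=` setT -> measurable E -> (\int[m]_(q in E) (EFin \o f) q = \int[m]_(q in E) cst 0 q)%E.
  by move=> /(_ A); apply: filterS => q /= /(_ I) [].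
move=> _ mE; rewrite integral0.
have := (subH E mE).2; rewrite -Rint_indic /Rintegral => E0.
have : (\int[m]_(q in E) (EFin \o f) q)%E \is a fin_num.
  by apply: integrable_fin_num => //; apply: integrableS fi.
by move=> /fineK <-; rewrite E0.
Qed.

End truncation.
Lemma intg_prod_bound d1 d2 (T1 : measurableType d1) (T2 : measurableType d2) (R : realType)
  (m1 : {sigma_finite_measure set T1 -> \bar R}) (m2 : {sigma_finite_measure set T2 -> \bar R})
  (f : T1 * T2 -> R) (k : T2 -> R) : measurable_fun setT f -> intg m2 k ->
  {ae m2, forall y, intg m1 (fun x => f (x, y)) /\ \int[m1]_x `|f (x, y)| <= k y} ->
  intg (m1 \x m2)%E f.
Proof.
move=> mf ik fk; apply: intg_prodP2 => //.
have /intgP[mk kfin] := ik; apply: le_lt_trans kfin.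
apply: ae_ge0_le_integral => //.
- by move=> y _; exact: integral_ge0.
- apply: (measurable_fun_fubini_tonelli_G (fun z => `|f z|%:E)) => //.
  by apply/measurable_EFinP; exact: measurableT_comp.
- by apply/measurable_EFinP; exact: measurableT_comp.
apply: filterS fk => y [iy le] _.
by rewrite -Rint_EFin ?lee_fin; [exact: le_trans le (ler_norm _)|exact: intg_abs].
Qed.

(** * Martingales of finite variation *)

Section finite_variation_martingale.
Context d (W : measurableType d) (R : realType) (P : probability W R).
Context (F : R -> set (set W)) (s T : R).
Hypothesis sT : s <= T.
Hypothesis sF : forall t, s <= t <= T -> sub_sigma (F t).
Hypothesis monoF : forall r t, s <= r -> r <= t -> t <= T -> F r `<=` F t.
Variable m : {finite_measure set (measurableTypeR R) -> \bar R}.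
Hypothesis atomless : forall q : R, m [set q] = 0%E.
Hypothesis msupp : m (~` `]s, T]%classic) = 0%E.
Local Notation cl := (clamp s T).
Local Notation Iint := (Iint s T m).
Local Notation rmart := (rmart P F s T).
Local Notation prog := (prog F s T).

Lemma ae_clamp : {ae m, forall q : measurableTypeR R, cl q = q}.
Proof. by apply: filterS (ae_supp msupp) => q /andP[sq qT]; rewrite clamp_id// ltW. Qed.

Variable c : R -> W -> R.
Hypotheses (pc : prog c) (mc : rmart (Iint c)).
Hypothesis ic : {ae P, forall w, intg m (fun q => c (cl q) w)}.

Section fixed_level.
Variable n : R.
Hypothesis n0 : 0 < n.

Let C := Iint c.
Let L := Iint (fun q w => `|c q w|).
Let lam q w := \1_[set x | x <= n] (L q w) * `|c q w|.
Let y q w := 1 - Iint lam q w / n.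
Let h q w := c q w * y q w - C q w * (lam q w / n).

Let pC : prog C. Proof. exact: Iint_prog. Qed.
Let pL : prog L. Proof. by apply: Iint_prog => //; exact: prog_abs. Qed.
Let plam : prog lam.
Proof. by apply: progM; [exact: prog_indic_le|exact: prog_abs]. Qed.
Let py : prog y.
Proof.
apply: progB; first exact: prog_cst.
by apply: progM; [exact: Iint_prog|exact: prog_cst].
Qed.
Let ph : prog h.
Proof.
apply: progB; first exact: progM.
by apply: progM => //; apply: progM => //; exact: prog_cst.
Qed.

Section path.
Variable w : W.
Hypothesis iw : intg m (fun q => c (cl q) w).
Let cw q := c (cl q) w.
(** Deterministic copies, for one path, of the processes above, to which the lemmas on weights
    apply. They agree with the processes at [m]-almost every time, where nested clamps collapse. *)
Let lw q := \1_[set x | x <= n] (cumint m (fun q => `|cw q|) q) * `|cw q|.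
Let yw q := 1 - cumint m lw q / n.
Let hw q := cw q * yw q - cumint m cw q * (lw q / n).

Let lamE : {ae m, forall q : measurableTypeR R, lam (cl q) w = lw q}.
Proof. by apply: filterS ae_clamp => q qE; rewrite /lam /lw /cw !qE. Qed.

Let IlamE t : Iint lam t w = cumint m lw t.
Proof. by apply: cumint_ae; exact: lamE. Qed.

Let yE t : y t w = yw t. Proof. by rewrite /y /yw IlamE. Qed.

Let hE : {ae m, forall q : measurableTypeR R, h (cl q) w = hw q}.
Proof.
apply: filterS2 ae_clamp lamE => q qE lE.
by rewrite /h /hw lE yE qE /cw qE.
Qed.

Let ihw : intg m hw. Proof. exact: (weight_intg_h atomless msupp n0 iw). Qed.
Let ilw : intg m lw. Proof. by apply: (trunc_intg atomless) => //; exact: intg_abs. Qed.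

Let mpath b : prog b -> measurable_fun [set: measurableTypeR R] (fun q => b (cl q) w).
Proof.
move=> pb; have mb := prog_joint sT sF pb.
have mi : measurable_fun setT (fun q : measurableTypeR R => (q, w)) by exact: measurable_fun_pair.
exact: measurableT_comp mb mi.
Qed.

Let int_lw : \int[m]_q lw q <= n.
Proof.
rewrite -(cumint_end msupp _ (lexx T)).
by apply: (trunc_cumint_le atomless msupp) => //; exact: intg_abs.
Qed.

Let bound b (bw : R -> R) k : prog b -> 0 <= k -> intg m bw ->
  {ae m, forall q : measurableTypeR R, b (cl q) w = bw q} ->
  (forall q, `|bw q| <= k * lw q) ->
  intg m (fun q => b (cl q) w) /\ \int[m]_q `|b (cl q) w| <= k * n.
Proof.
move=> pb k0 ibw bE bk; split.
  apply: intg_ae (ibw) _; first exact: mpath.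
  by apply: filterS bE => q ->.
rewrite (@Rint_ae _ _ _ m _ (fun q => `|bw q|)); last by apply: filterS bE => q ->.
apply: (@le_trans _ _ (\int[m]_q (k * lw q))).
  by apply: Rint_le => //; [exact: intg_abs|exact: intgZ].
by rewrite RintZ// ler_wpM2l.
Qed.

Lemma path_bound_h :
  intg m (fun q => h (cl q) w) /\ \int[m]_q `|h (cl q) w| <= 2 * n.
Proof. by apply: (bound (bw := hw)) => // q; exact: (weight_bound_h atomless msupp n0 iw). Qed.

Lemma path_bound_Ch : intg m (fun q => C (cl q) w * h (cl q) w) /\
  \int[m]_q `|C (cl q) w * h (cl q) w| <= (n * 2) * n.
Proof.
apply: (bound (b := fun q w => C q w * h q w) (bw := fun q => cumint m cw q * hw q)) => //.
- exact: progM.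
- by rewrite mulr_ge0// ltW.
- exact: (intg_cumintM atomless).
- by apply: filterS2 ae_clamp hE => q qE ->; rewrite qE.
- by move=> q; rewrite -mulrA; exact: (weight_bound_Ch atomless msupp n0 iw).
Qed.

Lemma path_bound_Ccy : intg m (fun q => C (cl q) w * c (cl q) w * y (cl q) w) /\
  \int[m]_q `|C (cl q) w * c (cl q) w * y (cl q) w| <= n * n.
Proof.
apply: (bound (b := fun q w => C q w * c q w * y q w) (bw := fun q => cumint m cw q * cw q * yw q)) => //.
- by do 2 apply: progM => //.
- by rewrite ltW.
- exact: (weight_intg_Ccy atomless msupp n0 iw).
- by apply: filterS ae_clamp => q qE; rewrite yE /cw !qE.
- by move=> q; exact: (weight_bound_Ccy atomless msupp n0 iw).
Qed.

Lemma path_bound_C2lam : intg m (fun q => C (cl q) w ^+ 2 * lam (cl q) w) /\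
  \int[m]_q `|C (cl q) w ^+ 2 * lam (cl q) w| <= n ^+ 2 * n.
Proof.
apply: (bound (b := fun q w => C q w ^+ 2 * lam q w) (bw := fun q => cumint m cw q ^+ 2 * lw q)) => //.
- by apply: progM => //; under eq_fun do under eq_fun do rewrite expr2; exact: progM.
- exact: sqr_ge0.
- exact: (weight_intg_C2lam atomless msupp n0 iw).
- by apply: filterS2 ae_clamp lamE => q qE ->; rewrite qE.
- move=> q; have /andP[h0 h1] := weight_bound_C2lam atomless msupp n0 iw q.
  by rewrite ger0_norm.
Qed.

Let IintCcyE t : cumint m (fun q => cumint m cw q * cw q * yw q) t =
  Iint (fun q w => C q w * c q w * y q w) t w.
Proof. by apply: cumint_ae; apply: filterS ae_clamp => q qE; rewrite yE /cw !qE. Qed.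

Let IintC2lamE t : cumint m (fun q => cumint m cw q ^+ 2 * lw q) t =
  Iint (fun q w => C q w ^+ 2 * lam q w) t w.
Proof.
by apply: cumint_ae; apply: filterS2 ae_clamp lamE => q qE ->; rewrite qE.
Qed.

Lemma path_square t : C t w ^+ 2 * y t w =
  2 * Iint (fun q w => C q w * c q w * y q w) t w - n^-1 * Iint (fun q w => C q w ^+ 2 * lam q w) t w.
Proof.
rewrite yE; etransitivity; first exact: (weight_square atomless msupp n0 iw t).
exact: (congr2 (fun a b => 2 * a - n^-1 * b) (IintCcyE t) (IintC2lamE t)).
Qed.

Lemma path_product : \int[m]_q (\1_`]s, T]%classic q * h (cl q) w) = C T w * y T w.
Proof.
rewrite -(cumint_ocitv msupp) (cumint_ae _ hE).
by rewrite yE; exact: (weight_product atomless msupp n0 iw T).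
Qed.

Lemma path_Ch : \int[m]_q (\1_`]s, T]%classic q * (C (cl q) w * h (cl q) w)) =
  Iint (fun q w => C q w * c q w * y q w) T w - n^-1 * Iint (fun q w => C q w ^+ 2 * lam q w) T w.
Proof.
rewrite -(cumint_ocitv msupp).
rewrite (@cumint_ae _ _ _ (fun q => cumint m cw q * hw q)); last first.
  by apply: filterS2 ae_clamp hE => q qE ->; rewrite qE.
etransitivity; first exact: (weight_Ch atomless msupp n0 iw T).
exact: (congr2 (fun a b => a - n^-1 * b) (IintCcyE T) (IintC2lamE T)).
Qed.

Lemma path_weight_ge0 t : 0 <= y t w.
Proof.
by rewrite yE; have /andP[] := weight_itv atomless msupp n0 iw t.
Qed.

Lemma path_weight_gt0 t : L t w <= n / 2 -> 0 < y t w.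
Proof.
move=> Ln; rewrite yE.
have h2 : (0 : R) < 2^-1 by rewrite invr_gt0.
have h3 : 2^-1 <= yw t := weight_ge atomless n0 iw Ln.
exact: lt_le_trans h3.
Qed.

End path.

Let TI : s <= T <= T. Proof. by rewrite sT lexx. Qed.

(* With [Lam = int lam dm <= n] and [y = 1 - Lam / n], the martingale property
   of [C] gives [E (C_T (C_T y_T)) = E int C d(C y) = E A - E B / n], whereas
   [E (C_T^2 y_T) = 2 E A - E B / n]: hence [E A = 0] and
   [E (C_T^2 y_T) = - E B / n <= 0]. *)
Lemma fixed_level_eq0 : {ae P, forall w, C T w ^+ 2 * y T w = 0}.
Proof.
have ih : pint P s T m h.
  apply: (@intg_prod_bound _ _ _ _ _ m P _ (fun=> 2 * n)); [exact: (prog_joint sT sF ph)|exact: intg_cst|].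
  by apply: filterS ic => w; exact: path_bound_h.
have iCh : pint P s T m (fun q w => C q w * h q w).
  apply: (@intg_prod_bound _ _ _ _ _ m P _ (fun=> n * 2 * n)); [|exact: intg_cst|].
    by apply: (prog_joint sT sF (b := fun q w => C q w * h q w)); exact: progM.
  by apply: filterS ic => w; exact: path_bound_Ch.
have iCcy : pint P s T m (fun q w => C q w * c q w * y q w).
  apply: (@intg_prod_bound _ _ _ _ _ m P _ (fun=> n * n)); [|exact: intg_cst|].
    by apply: (prog_joint sT sF (b := fun q w => C q w * c q w * y q w)); do 2 apply: progM => //.
  by apply: filterS ic => w; exact: path_bound_Ccy.
have iC2 : pint P s T m (fun q w => C q w ^+ 2 * lam q w).
  apply: (@intg_prod_bound _ _ _ _ _ m P _ (fun=> n ^+ 2 * n)); [|exact: intg_cst|].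
    apply: (prog_joint sT sF (b := fun q w => C q w ^+ 2 * lam q w)); apply: progM => //.
    by under eq_fun do under eq_fun do rewrite expr2; exact: progM.
  by apply: filterS ic => w; exact: path_bound_C2lam.
have [mC iC _] := mc.
have iCTh : intg (m \x P)%E (fun z => C T z.2 * h (cl z.1) z.2).
  apply: (@intg_prod_bound _ _ _ _ _ m P _ (fun w => `|C T w| * (2 * n))).
  - apply: measurable_funM; last exact: (prog_joint sT sF ph).
    have mCT := intg_meas (iC T TI).
    exact: measurableT_comp mCT measurable_snd.
  - by under eq_fun do rewrite mulrC; apply: intgZ; apply: intg_abs; exact: iC.
  - apply: filterS ic => w iw; have [i le] := path_bound_h iw; split; first exact: (intgZ (C T w) i).
    under eq_Rintegral do rewrite /= normrM.
    by rewrite RintZ; [rewrite ler_wpM2l|exact: intg_abs].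
pose A := Iint (fun q w => C q w * c q w * y q w) T.
pose B := Iint (fun q w => C q w ^+ 2 * lam q w) T.
have iA : intg P A by exact: Iint_intg.
have iB : intg P (fun w => n^-1 * B w) by apply: intgZ; exact: Iint_intg.
have FsT : F s setT.
  have sI : s <= s <= T by rewrite lexx sT.
  have [[f0 fD _] _] := sF sI.
  by rewrite -(setD0 setT); exact: fD.
have proj := projection sF monoF mc pC ph ih (lexx s) sT (lexx T) FsT iCTh iCh.
have {proj}proj : \int[P]_w (C T w ^+ 2 * y T w) = \int[P]_w (A w - n^-1 * B w).
  transitivity (\int[P]_w (\1_setT w * (C T w * \int[m]_q (\1_`]s, T]%classic q * h (cl q) w)))).
    apply: Rint_ae; apply: filterS ic => w iw.
    by rewrite path_product// indicT mul1r; ring.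
  rewrite proj.
  apply: Rint_ae; apply: filterS ic => w iw.
  by rewrite path_Ch// indicT mul1r.
have sq : {ae P, forall w, C T w ^+ 2 * y T w = 2 * A w - n^-1 * B w}.
  by apply: filterS ic => w iw; rewrite path_square.
move: proj; rewrite (Rint_ae sq) (RintB (intgZ 2 iA) iB) (RintZ _ iA) (RintB iA iB) => proj.
have A0 : \int[P]_w A w = 0 by lra.
have B0 : 0 <= \int[P]_w (n^-1 * B w).
  apply: Rint_ge0 => w; apply: mulr_ge0; first by rewrite invr_ge0 ltW.
  by apply: Rint_ge0 => q; apply: mulr_ge0 => //; rewrite mulr_ge0 ?sqr_ge0// /lam mulr_ge0.
have nn : {ae P, forall w, `|2 * A w - n^-1 * B w| = 2 * A w - n^-1 * B w}.
  apply: filterS2 ic sq => w iw <-; rewrite ger0_norm// mulr_ge0 ?sqr_ge0//.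
  exact: path_weight_ge0.
have iD : intg P (fun w => 2 * A w - n^-1 * B w) by apply: intgB => //; exact: intgZ.
have D0 : \int[P]_w `|2 * A w - n^-1 * B w| = 0.
  apply/eqP; rewrite eq_le; apply/andP; split; last exact: Rint_ge0.
  rewrite (Rint_ae nn) (RintB (intgZ 2 iA) iB) (RintZ _ iA) A0; lra.
have := Rint_eq0 (intg_abs iD) (fun=> normr_ge0 _) D0.
by move=> z; apply: filterS2 sq z => w -> /eqP; rewrite normr_eq0 => /eqP.
Qed.

End fixed_level.

(** The variation of a path is finite but not bounded uniformly over paths. Level [n] of
    [fixed_level_eq0] settles the paths of variation at most [n / 2], and countably many levels
    reach almost every path. *)
Lemma rmart_Iint_eq0 t : s <= t <= T -> {ae P, forall w, Iint c t w = 0}.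
Proof.
have CT0 : {ae P, forall w, Iint c T w = 0}.
  have := ae_foralln (fun k : nat => fixed_level_eq0 (ltr0Sn R k)).
  (* At a level [n > 2 L] nothing is truncated and [y_T > 0]. *)
  move=> H; apply: filterS2 ic H => w iw.
  set L := Iint (fun q w => `|c q w|) T w.
  move=> /(_ (Num.trunc (2 * L)).+1) /eqP.
  rewrite mulf_eq0 sqrf_eq0 => /orP[/eqP//|/eqP y0].
  have := @path_weight_gt0 _ (ltr0Sn R (Num.trunc (2 * L)).+1) w iw T.
  rewrite y0 ltxx => H0; exfalso; suff : false by []; apply: H0.
  have := truncnS_gt (2 * L); rewrite -[in X in _ -> X]natr1 -/L => HL; lra.
move=> tI; have [mC iC eC] := mc.
have t0 : s <= T <= T by rewrite sT lexx.
(* From [T] back to [t]: [C t] is a conditional expectation of [C T], which is almost surely 0. *)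
apply: (gmeas_ae_eq (sF tI)); [exact: mC|exact: measurable_cst|exact: iC|exact: intg_cst|].
move=> B FB; have /andP[st tT] := tI; rewrite -(eC t T)//.
apply: Rint_ae; by apply: filterS CT0 => w ->.
Qed.

End finite_variation_martingale.
Lemma cvg_cauchyP (R : realType) (I : Type) (G : set_system I) (FG : ProperFilter G) (f : I -> R) :
  (forall e, 0 < e -> exists c, \forall i \near G, `|f i - c| <= e) -> cvg (f @ G).
Proof.
move=> H; apply/cauchy_cvgP; apply: cauchy_exP => e e0.
have e2 : 0 < e / 2 by rewrite divr_gt0.
have [c Hc] := H _ e2; exists c; apply: filterS Hc => i /=.
by rewrite -ball_normE /= distrC => h; apply: le_lt_trans h _; lra.
Qed.

Lemma norm_lim_le (R : realType) (u v : nat -> R) a b e : u @ \oo --> a -> v @ \oo --> b ->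
  (\forall n \near \oo, `|u n - v n| <= e) -> `|a - b| <= e.
Proof.
move=> ua vb uv; have cv : (fun n => `|u n - v n|) @ \oo --> `|a - b|.
  by apply: cvg_norm; exact: cvgB.
by rewrite -(cvg_lim _ cv)//; apply: limr_le => //; apply/cvg_ex; exists `|a - b|.
Qed.

(** * Cadlag modifications *)

Section greedy.
Context (R : realType) (e : R) (x : nat -> R).
Hypothesis e0 : 0 <= e.

(** A greedy discretization of the path: the anchor moves only when the path gets further than [e]
    from it, and [jumps] counts these moves. *)
Fixpoint anchor (k : nat) : R :=
  if k is j.+1 then (if e < `|x j.+1 - anchor j| then x j.+1 else anchor j) else x 0.

Fixpoint jumps (k : nat) : nat :=
  if k is j.+1 then (jumps j + (e < `|x j.+1 - anchor j|)%R)%N else 0%N.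

(* For a martingale the sum on the right is centred, because [anchor j] only
   depends on [x 0], ..., [x j]: this bounds the mean number of jumps. *)
Lemma jumps_bound k : e ^+ 2 * (jumps k)%:R <=
  x k ^+ 2 - x 0 ^+ 2 - 2 * \sum_(j < k) anchor j * (x j.+1 - x j).
Proof.
(* The extra square makes the induction close: with [a = anchor k], the right side grows by
   [(x k.+1 - a) ^+ 2 - (x k - a) ^+ 2]. *)
suff : e ^+ 2 * (jumps k)%:R + (x k - anchor k) ^+ 2 <=
  x k ^+ 2 - x 0 ^+ 2 - 2 * \sum_(j < k) anchor j * (x j.+1 - x j).
  by apply: le_trans; rewrite lerDl sqr_ge0.
elim: k => [|k IH]; first by rewrite big_ord0 /= !subrr expr0n/= mulr0 !mulr0 addr0 subr0.
rewrite big_ord_recr/=.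
have step : e ^+ 2 * ((e < `|x k.+1 - anchor k|)%R : nat)%:R +
    (x k.+1 - (if e < `|x k.+1 - anchor k| then x k.+1 else anchor k)) ^+ 2 <=
    (x k.+1 - anchor k) ^+ 2.
  case: ifPn => h /=; last by rewrite mulr0 add0r.
  rewrite subrr expr0n/= addr0 mulr1 -[leRHS]real_normK ?num_real//.
  by rewrite lerXn2r ?nnegrE// ltW.
rewrite natrD mulrDr.
move: IH step; set S := \sum_(_ < _) _; set a := if _ then _ else _.
move: (e ^+ 2 * _) (e ^+ 2 * _) => G J; nra.
Qed.

Lemma jumpsD i j : (jumps i <= jumps (i + j))%N.
Proof. by elim: j => [|j IH]; rewrite ?addn0// addnS /= (leq_trans IH)// leq_addr. Qed.

Lemma jumps_nd i j : (i <= j)%N -> (jumps i <= jumps j)%N.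
Proof. by move=> ij; rewrite -(subnKC ij); exact: jumpsD. Qed.

Lemma anchor_near k : `|x k - anchor k| <= e.
Proof. by case: k => [|k] /=; rewrite ?subrr ?normr0//; case: ltP => //; rewrite subrr normr0. Qed.

Lemma anchor_const i j : jumps (i + j) = jumps i -> anchor (i + j) = anchor i.
Proof.
elim: j => [|j IH]; first by rewrite addn0.
rewrite addnS /=; case: ifP => _; last by rewrite addn0.
move=> H; exfalso; have := jumpsD i j; rewrite -H.
by rewrite addn1 ltnn.
Qed.

(** Two values more than [2 * e] apart cannot both be within [e] of the same anchor, so the anchor
    moves at least once along each link of the chain. *)
Lemma jumps_chain i l :
  path (fun i j => (i < j)%N && (2 * e < `|x j - x i|)) i l ->
  (jumps i + size l <= jumps (last i l))%N.
Proof.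
elim: l i => [|j l IH] i /=; first by rewrite addn0.
move=> /andP[/andP[ij osc] /IH]; apply: leq_trans.
rewrite addnS -addSn leq_add2r ltn_neqAle jumps_nd ?(ltnW ij)// andbT.
apply/eqP => E; move: osc; apply/negP; rewrite -leNgt.
have := anchor_const (esym (_ : jumps i = jumps (i + (j - i)))).
rewrite subnKC ?(ltnW ij)// => /(_ E) A.
have := anchor_near j; have := anchor_near i; rewrite A => h1 h2.
apply: le_trans (ler_distD (anchor i) _ _) _.
by rewrite [X in _ + X]distrC mulr_natl mulr2n lerD.
Qed.

End greedy.

Section regularization.
Context (R : realType) (s T : R) (D : set R) (y : R -> R) (q_ : nat -> R -> R).

Definition osc_chain e := path (fun p q : R => (p < q) && (e < `|y q - y p|)).

(** A bound on the number of successive oscillations larger than [e] along [D]: this is what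
    provides one-sided limits along [D] at every point. *)
Definition finite_oscillation := forall e, 0 < e -> exists K : nat, forall p l,
  (forall q, q \in p :: l -> D q) -> osc_chain e p l -> (size l <= K)%N.

Hypothesis fo : finite_oscillation.

Let pick_far e a b c : e < `|y a - y b| ->
  e / 2 < `|y a - y c| \/ e / 2 < `|y b - y c|.
Proof.
move=> ab; case: (ltP (e / 2) `|y a - y c|) => [h|h]; [by left|right].
rewrite ltNge; apply/negP => h'; move: ab; apply/negP; rewrite -leNgt.
apply: le_trans (ler_distD (y c) _ _) _; rewrite (distrC (y c)); lra.
Qed.

(** A failure at [t] would give arbitrarily long chains, built from right to left: arbitrarily close
    to [t] there are two points with values more than [e] apart, and one of them is [e / 2] away
    from the current head of the chain. *)
Lemma right_osc t e : 0 < e -> exists2 del, 0 < del & forall q q', D q -> D q' ->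
  t < q < t + del -> t < q' < t + del -> `|y q - y q'| <= e.
Proof.
move=> e0; apply: contrapT => H.
have {}H del : 0 < del -> exists q q', [/\ D q, D q', t < q < t + del,
    t < q' < t + del & e < `|y q - y q'|].
  move=> d0; apply: contrapT => H'; apply: H; exists del => // q q' Dq Dq' qI qI'.
  by rewrite leNgt; apply/negP => H2; apply: H'; exists q, q'.
have chain k : exists p l, [/\ size l = k, forall q, q \in p :: l -> D q /\ t < q &
    osc_chain (e / 2) p l].
  elim: k => [|k [p [l [sl Dl pl]]]].
    have [q [q' [Dq _ /andP[tq _] _ _]]] := H 1 ltr01.
    by exists q, [::]; split => // r; rewrite inE => /eqP ->.
  have [Dp tp] := Dl p (mem_head _ _).
  have pt : 0 < p - t by rewrite subr_gt0.
  (* The radius [p - t] places the new points strictly between [t] and the head [p]. *)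
  have [q [q' [Dq Dq' qI qI' far]]] := H _ pt.
  have [r [Dr /andP[tr rp] rfar]] : exists r, [/\ D r, t < r < p & e / 2 < `|y r - y p|].
    move: qI qI'; rewrite (addrC t) subrK => qI qI'.
    by case: (pick_far p far) => h; [exists q|exists q'].
  exists r, (p :: l); split; first by rewrite /= sl.
    move=> z; rewrite inE => /orP[/eqP ->//|]; exact: Dl.
  by rewrite /osc_chain /= rp distrC rfar.
have e2 : 0 < e / 2 by rewrite divr_gt0.
have [K HK] := fo e2.
have [p [l [sl Dl pl]]] := chain K.+1.
by have := HK p l (fun q ql => (Dl q ql).1) pl; rewrite sl ltnn.
Qed.

Lemma left_osc t e : 0 < e -> exists2 del, 0 < del & forall q q', D q -> D q' ->
  t - del < q < t -> t - del < q' < t -> `|y q - y q'| <= e.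
Proof.
move=> e0; apply: contrapT => H.
have {}H del : 0 < del -> exists q q', [/\ D q, D q', t - del < q < t,
    t - del < q' < t & e < `|y q - y q'|].
  move=> d0; apply: contrapT => H'; apply: H; exists del => // q q' Dq Dq' qI qI'.
  by rewrite leNgt; apply/negP => H2; apply: H'; exists q, q'.
have chain k : exists p l, [/\ size l = k, forall q, q \in p :: l -> D q /\ q < t &
    osc_chain (e / 2) p l].
  elim: k => [|k [p [l [sl Dl pl]]]].
    have [q [q' [Dq _ /andP[_ tq] _ _]]] := H 1 ltr01.
    by exists q, [::]; split => // r; rewrite inE => /eqP ->.
  have [Dp tp] := Dl (last p l) (mem_last _ _).
  have pt : 0 < t - last p l by rewrite subr_gt0.
  have [q [q' [Dq Dq' qI qI' far]]] := H _ pt.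
  have [r [Dr /andP[tr rp] rfar]] : exists r, [/\ D r, last p l < r < t & e / 2 < `|y r - y (last p l)|].
    move: qI qI'; rewrite opprB addrC subrK => qI qI'.
    by case: (pick_far (last p l) far) => h; [exists q|exists q'].
  exists p, (rcons l r); split; first by rewrite size_rcons sl.
    move=> z; rewrite -rcons_cons mem_rcons inE => /orP[/eqP ->//|]; exact: Dl.
  by rewrite /osc_chain rcons_path -/(osc_chain _ _ _) pl tr.
have e2 : 0 < e / 2 by rewrite divr_gt0.
have [K HK] := fo e2.
have [p [l [sl Dl pl]]] := chain K.+1.
by have := HK p l (fun q ql => (Dl q ql).1) pl; rewrite sl ltnn.
Qed.

Hypothesis qD : forall n t, s <= t < T -> D (q_ n t) /\ t < q_ n t.
Hypothesis q_cvg : forall t, s <= t < T -> (fun n => q_ n t) @ \oo --> t.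

(** The right limit along the grid points [q_ n t]. At [T], which has no grid point to its right,
    the value is kept. *)
Definition regularize t := if t < T then limn (fun n => y (q_ n t)) else y t.

Let near_q t del : s <= t < T -> 0 < del -> \forall n \near \oo, t < q_ n t < t + del.
Proof.
move=> tI d0; have /cvgrPdist_lt/(_ _ d0) := q_cvg tI.
apply: filterS => n; have [_ tq] := qD n tI; rewrite tq/=.
by rewrite ltr0_norm ?subr_lt0// opprB; lra.
Qed.

Lemma regularize_cvg t : s <= t < T -> (fun n => y (q_ n t)) @ \oo --> regularize t.
Proof.
move=> tI; rewrite /regularize; have /andP[_ ->] := tI.
suff : cvgn (fun n => y (q_ n t)) by [].
apply: cvg_cauchyP => e e0.
have [del d0 Hdel] := right_osc t e0.
have near_I := near_q tI d0.
have [n0 In0] := @filter_ex _ _ _ _ near_I.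
exists (y (q_ n0 t)); apply: filterS near_I => n In.
by apply: Hdel => //; case: (qD n tI) (qD n0 tI) => ? ? [].
Qed.

Lemma regularize_right t : s <= t < T -> regularize @ t^'+ --> regularize t.
Proof.
move=> tI; have /andP[st tT] := tI; apply/cvgrPdist_le => e e0.
have [del d0 Hdel] := right_osc t e0.
near=> r.
have tr : t < r by near: r; exact: nbhs_right_gt.
have rT : r < T by near: r; exact: nbhs_right_lt.
have rd : r < t + del by near: r; apply: nbhs_right_lt; rewrite ltrDl.
have rI : s <= r < T by rewrite (le_trans st (ltW tr)).
have dr : 0 < t + del - r by rewrite subr_gt0.
apply: norm_lim_le (regularize_cvg tI) (regularize_cvg rI) _.
apply: filterS2 (near_q tI d0) (near_q rI dr) => n tn rn.
apply: Hdel => //; [by case: (qD n tI)|by case: (qD n rI)|].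
have /andP[h1 h2] := rn; rewrite (lt_trans tr h1)/=; apply: lt_le_trans h2 _; by rewrite addrC subrK.
Unshelve. all: by end_near. Qed.

Lemma regularize_left t : s < t <= T -> cvg (regularize @ t^'-).
Proof.
move=> /andP[st tT]; apply: cvg_cauchyP => e e0.
have [del d0 Hdel] := left_osc t e0.
have near_ok : \forall r \near t^'-, s < r < t /\ t - del < r.
  near=> r; split; last by near: r; apply: nbhs_left_gt; rewrite ltrBlDr ltrDl.
  by apply/andP; split; near: r; [exact: nbhs_left_gt|exact: nbhs_left_lt].
have [r0 [/andP[sr0 r0t] dr0]] := @filter_ex _ _ _ _ near_ok.
exists (regularize r0); apply: filterS near_ok => r [/andP[sr rt] dr].
have rI : s <= r < T by rewrite (ltW sr) (lt_le_trans rt).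
have r0I : s <= r0 < T by rewrite (ltW sr0) (lt_le_trans r0t).
have rd : 0 < t - r by rewrite subr_gt0.
have rd0 : 0 < t - r0 by rewrite subr_gt0.
apply: norm_lim_le (regularize_cvg rI) (regularize_cvg r0I) _.
apply: filterS2 (near_q rI rd) (near_q r0I rd0) => n /andP[a1 a2] /andP[b1 b2].
apply: Hdel => //; [by case: (qD n rI)|by case: (qD n r0I)|apply/andP; split; lra..].
Unshelve. all: by end_near. Qed.

Lemma regularize_cadlag : cadlag_on s T regularize.
Proof.
split=> t tI; first exact: regularize_right.
by have /cvg_ex := regularize_left tI.
Qed.

End regularization.

Section dyadic_grid.
Context (R : realType) (s T : R).
Hypothesis sT : s < T.

Definition grid (n k : nat) : R := s + (T - s) * (k%:R / (2 ^ n)%:R).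

Definition on_grid (n : nat) (q : R) := exists2 k, (k <= 2 ^ n)%N & q = grid n k.

Lemma grid_itv n k : (k <= 2 ^ n)%N -> s <= grid n k <= T.
Proof.
move=> kn; have n0 : 0 < (2 ^ n)%:R :> R by rewrite ltr0n expn_gt0.
have h1 : 0 <= k%:R / (2 ^ n)%:R :> R by apply: divr_ge0.
have h2 : k%:R / (2 ^ n)%:R <= 1 :> R by rewrite ler_pdivrMr// mul1r ler_nat.
have D0 : 0 <= T - s by rewrite subr_ge0 ltW.
by rewrite /grid lerDl mulr_ge0//= -lerBrDl ler_piMr.
Qed.

Lemma grid_last n : grid n (2 ^ n) = T.
Proof.
have n0 : (2 ^ n)%:R != 0 :> R by rewrite pnatr_eq0 -lt0n expn_gt0.
by rewrite /grid divff// mulr1 addrC subrK.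
Qed.

Lemma grid_lt n i j : (grid n i < grid n j) = (i < j)%N.
Proof.
have n0 : 0 < (2 ^ n)%:R :> R by rewrite ltr0n expn_gt0.
by rewrite /grid ltrD2l ltr_pM2l ?subr_gt0// ltr_pM2r ?invr_gt0// ltr_nat.
Qed.

Lemma grid_le n i j : (i <= j)%N -> grid n i <= grid n j.
Proof. by rewrite leNgt grid_lt -leqNgt. Qed.

Lemma grid_refine n m k : (n <= m)%N -> grid n k = grid m (k * 2 ^ (m - n)).
Proof.
move=> nm; rewrite /grid; congr (_ + _ * _).
have n0 i : (2 ^ i)%:R != 0 :> R by rewrite pnatr_eq0 -lt0n expn_gt0.
have -> : (2 ^ m = 2 ^ n * 2 ^ (m - n))%N by rewrite -expnD subnKC.
by rewrite !natrM invfM mulrACA divff// mulr1.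
Qed.

Lemma on_grid_refine n m q : (n <= m)%N -> on_grid n q -> on_grid m q.
Proof.
move=> nm [k kn ->]; exists (k * 2 ^ (m - n))%N; last exact: grid_refine.
by rewrite -[in leqRHS](subnKC nm) expnD leq_mul2r kn orbT.
Qed.

(** The successor makes the grid point strictly larger than [t], even if [t] itself lies on the
    grid. *)
Definition next_index (n : nat) (t : R) : nat := (Num.trunc ((2 ^ n)%:R * ((t - s) / (T - s)))).+1.

Definition next_grid (n : nat) (t : R) : R := grid n (next_index n t).

Let frac_itv t : s <= t < T -> 0 <= (t - s) / (T - s) < 1.
Proof.
move=> /andP[st tT]; rewrite divr_ge0 ?subr_ge0 ?(ltW sT)//=.
by rewrite ltr_pdivrMr ?subr_gt0// mul1r ltrD2r.
Qed.

Let frac_mul t : (T - s) * ((t - s) / (T - s)) = t - s.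
Proof. by rewrite mulrC divfK// gt_eqF// subr_gt0. Qed.

Lemma next_on_grid n t : s <= t < T -> on_grid n (next_grid n t).
Proof.
move=> /frac_itv/andP[f0 f1]; exists (next_index n t) => //.
have n0 : 0 < (2 ^ n)%:R :> R by rewrite ltr0n expn_gt0.
have k0 : 0 <= (2 ^ n)%:R * ((t - s) / (T - s)) by rewrite mulr_ge0.
by rewrite /next_index truncn_lt_nat// gtr_pMr.
Qed.

Lemma next_gt n t : s <= t < T -> t < next_grid n t <= t + (T - s) / (2 ^ n)%:R.
Proof.
move=> /frac_itv/andP[f0 f1].
have n0 : 0 < (2 ^ n)%:R :> R by rewrite ltr0n expn_gt0.
have k0 : 0 <= (2 ^ n)%:R * ((t - s) / (T - s)) by rewrite mulr_ge0.
have h1 : (2 ^ n)%:R * ((t - s) / (T - s)) < (next_index n t)%:R by exact: truncnS_gt.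
have h2 : (next_index n t)%:R <= (2 ^ n)%:R * ((t - s) / (T - s)) + 1.
  by rewrite /next_index -natr1 lerD2r truncn_le.
have E := frac_mul t; have D0 : 0 < T - s by rewrite subr_gt0.
rewrite /next_grid /grid.
set f := (t - s) / (T - s) in f0 f1 k0 h1 h2 E *; set k := (next_index n t)%:R : R.
have tE : t = s + (T - s) * f by rewrite E addrC subrK.
have l1 : f < k / (2 ^ n)%:R by rewrite ltr_pdivlMr// mulrC.
have l2 : k / (2 ^ n)%:R <= f + (2 ^ n)%:R^-1.
  by rewrite ler_pdivrMr// mulrDl mulVf ?gt_eqF// mulrC.
rewrite {1 2}tE ltrD2l ltr_pM2l// l1/= -addrA lerD2l -mulrDr ler_pM2l//.
Qed.

Lemma next_nonincr n t : s <= t < T -> next_grid n.+1 t <= next_grid n t.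
Proof.
move=> /frac_itv/andP[f0 f1]; rewrite /next_grid (@grid_refine n n.+1)// grid_le//.
rewrite subSnn expn1 -[leqRHS]/((_ * 2)%N).
have k0 : 0 <= (2 ^ n)%:R * ((t - s) / (T - s)) by rewrite mulr_ge0.
have h1 : (2 ^ n)%:R * ((t - s) / (T - s)) < (next_index n t)%:R by exact: truncnS_gt.
have k1 : 0 <= (2 ^ n.+1)%:R * ((t - s) / (T - s)) by rewrite mulr_ge0.
rewrite {1}/next_index truncn_lt_nat//.
by rewrite expnSr !natrM mulrAC ltr_pM2r.
Qed.

Lemma next_cvg t : s <= t < T -> (fun n => next_grid n t) @ \oo --> t.
Proof.
move=> tI; apply: (@squeeze_cvgr _ _ _ _ (fun=> t) (fun n => t + (T - s) / (2 ^ n)%:R)).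
- by apply: nearW => n; have /andP[/ltW -> ->] := next_gt n tI.
- exact: cvg_cst.
- rewrite -[X in _ --> X]addr0; apply: cvgD; first exact: cvg_cst.
  rewrite -(mulr0 (T - s)); apply: cvgMr.
  under eq_fun do rewrite natrX -exprVn.
  by apply: cvg_expr; rewrite ger0_norm ?invr_ge0// invf_lt1 ?ltr1n.
Qed.

End dyadic_grid.

(** * Regularization of a square integrable martingale *)

Section martingale_regularization.
Context d (W : measurableType d) (R : realType) (P : probability W R).
Context (F : R -> set (set W)) (s T : R).
Hypothesis sT : s < T.
Hypothesis sF : forall t, s <= t <= T -> sub_sigma (F t).
Hypothesis monoF : forall r t, s <= r -> r <= t -> t <= T -> F r `<=` F t.
Hypothesis rcF : forall t, s <= t < T -> forall A,
  (forall u, t < u <= T -> F u A) -> F t A.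
Variable Y : R -> W -> R.
Hypotheses (mY : rmart P F s T Y) (sY : sqi P (Y T)).

Let E2 := \int[P]_w (Y T w ^+ 2).
Let sYt t : s <= t <= T -> sqi P (Y t) /\ \int[P]_w (Y t w ^+ 2) <= E2.
Proof. exact: (rmart_sqi sF mY sY). Qed.
Let gY t : s <= t <= T -> gmeas (F t) (Y t). Proof. by case: mY => h _ _; exact: h. Qed.
Let iY t : s <= t <= T -> intg P (Y t). Proof. by case: mY => _ h _; exact: h. Qed.

Section grid_level.
Variables (e : R) (n : nat).
Hypothesis e0 : 0 < e.

Let x w k := Y (grid s T n k) w.
Let anc k w := anchor e (x w) k.

Let TI k : (k <= 2 ^ n)%N -> s <= grid s T n k <= T. Proof. exact: grid_itv. Qed.

Let gsub i j : (i <= j)%N -> (j <= 2 ^ n)%N -> F (grid s T n i) `<=` F (grid s T n j).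
Proof.
move=> ij jn; have /andP[h1 h2] := TI jn; have /andP[h3 h4] := TI (leq_trans ij jn).
by apply: monoF => //; exact: grid_le.
Qed.

Let anchor_ok k : (k <= 2 ^ n)%N -> gmeas (F (grid s T n k)) (anc k) /\ sqi P (anc k).
Proof.
elim: k => [|k IH] kn; first by split; [exact: gY (TI kn)|case: (sYt (TI kn))].
have [IH1 IH2] := IH (ltnW kn).
have g1 : gmeas (F (grid s T n k.+1)) (anc k).
  by apply: gmeasS IH1; [exact: sF (TI (ltnW kn))|exact: sF (TI kn)|exact: gsub].
have gx := gY (TI kn); have [sx _] := sYt (TI kn).
have gA : gmeas (F (grid s T n k.+1)) (anc k.+1).
  apply: measurable_fun_ifT => //; apply: measurable_fun_ltr => //.
  by apply: measurableT_comp => //; exact: measurable_funB.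
split => //; apply: (@sqi_le _ _ _ _ _ (fun w => `|x w k.+1| + `|anc k w|)).
- exact: gmeas_meas (sF (TI kn)) gA.
- move=> w; rewrite [leRHS]ger0_norm ?addr_ge0// /anc /=.
  by case: ifP => _; rewrite ?lerDl ?lerDr.
- by apply: sqiD; exact: sqi_abs.
Qed.

Let jumps_meas k : (k <= 2 ^ n)%N -> measurable_fun setT (fun w => (jumps e (x w) k)%:R : R).
Proof.
elim: k => [|k IH] kn; first exact: measurable_cst.
rewrite (_ : (fun w => _) = fun w => (jumps e (x w) k)%:R + (if e < `|x w k.+1 - anc k w| then 1 else 0)); last first.
  by apply/funext => w /=; rewrite natrD /anc; case: ifP.
apply: measurable_funD; first exact: IH (ltnW kn).
apply: measurable_fun_ifT => //; apply: measurable_fun_ltr => //.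
apply: measurableT_comp => //; apply: measurable_funB; first exact: intg_meas (iY (TI kn)).
by case: (anchor_ok (ltnW kn)) => _ [].
Qed.

Let jumps_le k w : (jumps e (x w) k <= k)%N.
Proof. by elim: k => [//|k IH] /=; rewrite -addn1 leq_add//; case: (_ < _). Qed.

Definition grid_jumps w : R := (jumps e (x w) (2 ^ n))%:R.

Lemma grid_jumps_intg : intg P grid_jumps.
Proof.
apply: (@intg_bounded _ _ _ _ _ (2 ^ n)%:R); first exact: jumps_meas.
by move=> w; rewrite ger0_norm// ler_nat.
Qed.

(** The bound does not depend on the level [n], as Fatou's lemma requires in [jumps_bounded]. *)
Lemma grid_jumps_expect : \int[P]_w grid_jumps w <= E2 / e ^+ 2.
Proof.
have e2 : 0 < e ^+ 2 by rewrite exprn_gt0.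
rewrite ler_pdivlMr// mulrC -RintZ; last exact: grid_jumps_intg.
pose f (j : 'I_(2 ^ n)) w := anc j w * (x w j.+1 - x w j).
have jn (j : 'I_(2 ^ n)) : (j <= 2 ^ n)%N by exact: ltnW.
have jS (j : 'I_(2 ^ n)) : (j.+1 <= 2 ^ n)%N by [].
have i1 (j : 'I_(2 ^ n)) : intg P (fun w => anc j w * x w j.+1).
  by apply: sqiM; [case: (anchor_ok (jn j))|case: (sYt (TI (jS j)))].
have i2 (j : 'I_(2 ^ n)) : intg P (fun w => anc j w * x w j).
  by apply: sqiM; [case: (anchor_ok (jn j))|case: (sYt (TI (jn j)))].
have fE j : f j = fun w => anc j w * x w j.+1 - anc j w * x w j.
  by apply/funext => w; rewrite /f mulrBr.
have fi j : intg P (f j) by rewrite fE; exact: intgB.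
have [si sE] := @Rint_sum _ _ _ P _ (index_enum 'I_(2 ^ n)) f fi.
have s0 : \int[P]_w (\sum_(j < 2 ^ n) f j w) = 0.
  rewrite sE big1// => j _; rewrite fE RintB//.
  apply/eqP; rewrite subr_eq0; apply/eqP.
  have /andP[a1 a2] := TI (jn j); have /andP[b1 b2] := TI (jS j).
  apply: (rmart_orth sF mY) => //; first exact: grid_le.
  by case: (anchor_ok (jn j)).
have n0 : (0 <= 2 ^ n)%N by [].
have iN : intg P (fun w => x w (2 ^ n)%N ^+ 2) by case: (sYt (TI (leqnn _))) => -[].
have i0 : intg P (fun w => x w 0%N ^+ 2) by case: (sYt (TI n0)) => -[].
apply: (@le_trans _ _ (\int[P]_w (x w (2 ^ n)%N ^+ 2 - x w 0%N ^+ 2 - 2 * \sum_(j < 2 ^ n) f j w))).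
  apply: Rint_le.
  - by apply: intgZ; exact: grid_jumps_intg.
  - by apply: intgB; [exact: intgB|exact: intgZ].
  - by move=> w; exact: jumps_bound (ltW e0) _.
rewrite (RintB (intgB iN i0) (intgZ 2 si)) (RintB iN i0) (RintZ _ si) s0 mulr0 subr0.
have [_ le] := sYt (TI (leqnn _)).
by rewrite lerBlDr (le_trans le)// lerDl Rint_ge0// => w; exact: sqr_ge0.
Qed.

End grid_level.

(** By Fatou's lemma the lower limit of the numbers of jumps has finite mean, so it is almost surely
    finite. A finite lower limit bounds these numbers only along infinitely many levels, which is
    enough because the grids are nested. *)
Lemma jumps_bounded e : 0 < e -> {ae P, forall w, exists K : nat, forall N : nat,
  exists2 m, (N <= m)%N & (jumps e (fun k => Y (grid s T m k) w) (2 ^ m) <= K)%N}.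
Proof.
move=> e0; pose G m w := (grid_jumps e m w)%:E.
pose H w := limn_einf (G ^~ w).
have mG m : measurable_fun setT (G m) by exact/measurable_EFinP/(intg_meas (grid_jumps_intg _ _)).
have mH : measurable_fun setT H.
  rewrite /H; apply: (emeasurable_fun_cvg (fun m w => einfs (G ^~ w) m)).
    by move=> m; exact: measurable_fun_einfs.
  by move=> w _; rewrite limn_einf_lim; exact: is_cvg_einfs.
have H0 w : (0 <= H w)%E.
  rewrite /H limn_einf_lim; apply: lime_ge; first exact: is_cvg_einfs.
  by apply: nearW => m; apply: le_ereal_inf_tmp => _ [k _ <-]; rewrite lee_fin.
have iH : P.-integrable setT H.
  apply/integrableP; split => //; under eq_integral do rewrite gee0_abs//.
  apply: (@le_lt_trans _ _ (E2 / e ^+ 2)%:E); last exact: ltry.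
  apply: le_trans (fatou _ _ _ _) _ => //.
    by move=> m w _; rewrite lee_fin.
  rewrite limn_einf_lim; apply: lime_le; first exact: is_cvg_einfs.
  apply: nearW => m; apply: le_trans (_ : (\int[P]_w G m w <= _)%E).
    by apply: ereal_inf_lbound; exists m => /=.
  by rewrite -Rint_EFin ?lee_fin; [exact: grid_jumps_expect|exact: grid_jumps_intg].
apply: filterS (integrable_ae measurableT iH) => w /(_ I) finH.
pose K := (Num.trunc (fine (H w))).+1.
exists K => N.
have HK : (H w < K%:R%:E)%E.
  by rewrite -(fineK finH) lte_fin; exact: truncnS_gt.
have : (einfs (G ^~ w) N < K%:R%:E)%E.
  apply: le_lt_trans HK; rewrite /H limn_einf_lim.
  have cv := ereal_nondecreasing_cvgn (nondecreasing_einfs (G ^~ w)).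
  by rewrite (cvg_lim _ cv)//; apply: ereal_sup_ubound; exists N.
move=> /ereal_inf_lt[_ [m /= Nm <-]]; rewrite lte_fin ltr_nat => mK.
by exists m => //; exact: ltnW.
Qed.

(** The finitely many points of a chain all lie on one grid, and still do on any finer one; some
    finer level [m] has at most [K] jumps, and [jumps_chain] compares the chain with them. *)
Lemma path_finite_oscillation (y : R -> R) :
  (forall j : nat, exists K : nat, forall N : nat, exists2 m, (N <= m)%N &
    (jumps j.+1%:R^-1 (fun k => y (grid s T m k)) (2 ^ m) <= K)%N) ->
  finite_oscillation [set q | exists n, on_grid s T n q] y.
Proof.
(* Chosen so that [e] is at least twice the jump threshold [j.+1%:R^-1], as [jumps_chain]
   demands. *)
move=> H e e0; pose j := Num.trunc (2 / e).
have ej : 2 * j.+1%:R^-1 <= e.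
  have := truncnS_gt (2 / e); rewrite -/j => h.
  by rewrite ler_pdivrMr// mulrC -ler_pdivrMr// ltW.
have [K HK] := H j; exists K => p l Dl pl.
have [N HN] : exists N, forall q, q \in p :: l -> on_grid s T N q.
  elim: (p :: l) Dl => [|q l' IH] Dl'; first by exists 0%N.
  have [|N HN] := IH; first by move=> r rl; apply: Dl'; rewrite inE rl orbT.
  have [M HM] := Dl' q (mem_head _ _).
  exists (maxn N M) => r; rewrite inE => /orP[/eqP ->|/HN].
    by apply: on_grid_refine HM; rewrite leq_maxr.
  by apply: on_grid_refine; rewrite leq_maxl.
have [m Nm mK] := HK N.
pose idx q := xget 0%N [set k | (k <= 2 ^ m)%N /\ q = grid s T m k].
have idxP q : q \in p :: l -> (idx q <= 2 ^ m)%N /\ q = grid s T m (idx q).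
  move=> /HN/(on_grid_refine Nm)[k km qE].
  by have := @xgetPex _ 0%N [set k | (k <= 2 ^ m)%N /\ q = grid s T m k]; apply; exists k.
pose x k := y (grid s T m k).
have path_idx : path (fun i i' => (i < i')%N && (2 * j.+1%:R^-1 < `|x i' - x i|)) (idx p) (map idx l).
  elim: l p pl {Dl HN} idxP => [//|q l IH] p /= /andP[/andP[pq far] pl] iP.
  have [_ pE] := iP p (mem_head _ _).
  have [_ qE] : (idx q <= 2 ^ m)%N /\ q = grid s T m (idx q) by apply: iP; rewrite !inE eqxx orbT.
  apply/andP; split; last first.
    by apply: IH => // r rl; apply: iP; rewrite inE rl orbT.
  rewrite -(grid_lt sT m) -pE -qE pq/= /x -pE -qE.
  exact: le_lt_trans far.
have j0 : 0 <= j.+1%:R^-1 :> R by rewrite invr_ge0.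
have := jumps_chain j0 path_idx; rewrite size_map last_map => le1.
have [le2 _] := idxP (last p l) (mem_last _ _).
have := leq_trans le1 (leq_trans (jumps_nd _ _ le2) mK).
by apply: leq_trans; exact: leq_addl.
Qed.

Definition regular_version (t : R) (w : W) : R :=
  regularize T (Y ^~ w) (next_grid s T) t.

Let good : {ae P, forall w, finite_oscillation [set q | exists n, on_grid s T n q] (Y ^~ w)}.
Proof.
have H (j : nat) := @jumps_bounded j.+1%:R^-1 ltac:(by rewrite invr_gt0).
by apply: filterS (ae_foralln H) => w; exact: path_finite_oscillation.
Qed.

Let qD n t : s <= t < T -> [set q | exists n, on_grid s T n q] (next_grid s T n t) /\ t < next_grid s T n t.
Proof.
move=> tI; split; first by exists n; exact: next_on_grid.
by have /andP[] := next_gt sT n tI.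
Qed.

Let q_cvg t : s <= t < T -> (fun n => next_grid s T n t) @ \oo --> t.
Proof. exact: next_cvg. Qed.

Lemma regular_version_cadlag : {ae P, forall w, cadlag_on s T (regular_version ^~ w)}.
Proof.
by apply: filterS good => w fo; exact: (regularize_cadlag fo qD q_cvg).
Qed.

Section version_at.
Variable t : R.
Hypothesis tI : s <= t < T.

Let q n := next_grid s T n t.

Let qI n : s <= q n <= T.
Proof. by rewrite /q; have [k kn ->] := next_on_grid sT n tI; exact: grid_itv. Qed.

Let tq n : t < q n. Proof. by case: (qD n tI). Qed.

Let q_nonincr i j : (i <= j)%N -> q j <= q i.
Proof.
elim: j => [|j IH]; first by rewrite leqn0 => /eqP ->.
rewrite leq_eqVlt => /orP[/eqP ->//|]; rewrite ltnS => /IH; apply: le_trans.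
exact: next_nonincr.
Qed.

(** The grid values converge on almost every path only; the upper limit is a substitute that is
    measurable on the whole space. *)
Let Z w := fine (limn_esup (fun n => (Y (q n) w)%:E)).

Let esup_shift (u : nat -> \bar R) N : limn_esup u = limn_esup (fun n => u (n + N)%N).
Proof.
rewrite !limn_esup_lim.
have -> : esups (fun n => u (n + N)%N) = fun n => esups u (n + N)%N.
  apply/funext => n; rewrite /esups; congr ereal_sup.
  apply/seteqP; split => _ [k /= nk <-].
    by exists (k + N)%N => //=; rewrite leq_add2r.
  by exists (k - N)%N => /=; [rewrite leq_subRL ?(leq_trans _ nk) ?leq_addl// addnC|rewrite subnK// (leq_trans _ nk)// leq_addl].
have cv : cvgn (esups u) by exact: is_cvg_esups.
apply/esym/cvg_lim => //.
by rewrite (cvg_shiftn N (esups u)).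
Qed.

(** For each [u > t], the grid points used are eventually below [u], and an upper limit ignores the
    first terms: [Z] is [F u]-measurable. The right-continuity of the filtration concludes. *)
Let mZ : gmeas (F t) Z.
Proof.
have tI' : s <= t <= T by have /andP[-> /ltW ->] := tI.
apply/(gmeasP _ (sF tI')) => B mB; apply: (rcF tI) => u /andP[tu uT].
have uI : s <= u <= T by rewrite uT andbT; have /andP[st _] := tI; rewrite (le_trans st)// ltW.
suff mZu : gmeas (F u) Z by move/(gmeasP _ (sF uI)): mZu; exact.
have [N _ HN] : \forall n \near \oo, q n < u.
  have /cvgrPdist_lt/(_ (u - t)) := q_cvg tI.
  rewrite subr_gt0 => /(_ tu); apply: filterS => n.
  by rewrite ltr0_norm ?subr_lt0; [rewrite opprB ltrD2r|exact: tq].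
apply: (@measurableT_comp _ _ _ _ _ _ (@fine R)); first exact: fine_measurable.
under eq_fun do rewrite (esup_shift _ N).
apply: measurable_fun_limn_esup => n; apply/measurable_EFinP.
have qnu : q (n + N)%N <= u by apply/ltW/HN; exact: leq_addl.
apply: (gmeasS (sF (qI _)) (sF uI) _ (gY (qI (n + N)%N))).
by have /andP[h1 h2] := qI (n + N)%N; exact: monoF.
Qed.

Let Zlim : {ae P, forall w, (fun n => Y (q n) w) @ \oo --> Z w /\ regular_version t w = Z w}.
Proof.
apply: filterS good => w fo; have cv := regularize_cvg fo qD q_cvg tI.
suff -> : Z w = regular_version t w by [].
have cvE : (fun n => (Y (q n) w)%:E) @ \oo --> (regular_version t w)%:E by exact: cvg_EFin_seq.
rewrite /Z is_cvg_limn_esupE; last by apply/cvg_ex; eexists; exact: cvE.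
by rewrite (cvg_lim _ cvE).
Qed.

(** The increment of the martingale from [q j] to [q i] is orthogonal to [Y (q j)]. *)
Let incr_sq i j : (i <= j)%N -> \int[P]_w ((Y (q i) w - Y (q j) w) ^+ 2) =
  \int[P]_w (Y (q i) w ^+ 2) - \int[P]_w (Y (q j) w ^+ 2).
Proof.
move=> ij; have [si _] := sYt (qI i); have [sj _] := sYt (qI j).
have /andP[h1 h2] := qI i; have /andP[h3 h4] := qI j.
have iij : intg P (fun w => Y (q j) w * Y (q i) w) by exact: sqiM.
have ii : intg P (fun w => Y (q i) w ^+ 2) by case: si.
have jj : intg P (fun w => Y (q j) w ^+ 2) by case: sj.
have jj' : intg P (fun w => Y (q j) w * Y (q j) w) by exact: sqiM.
have orth := rmart_orth sF mY h3 (q_nonincr ij) h2 (gY (qI j)) iij jj'.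
transitivity (\int[P]_w (Y (q i) w ^+ 2 + Y (q j) w ^+ 2 - 2 * (Y (q j) w * Y (q i) w))).
  by apply: eq_Rintegral => w _; ring.
rewrite (RintB (intgD ii jj) (intgZ 2 iij)) (RintD ii jj) (RintZ _ iij) orth.
have -> : \int[P]_w (Y (q j) w * Y (q j) w) = \int[P]_w (Y (q j) w ^+ 2).
  by apply: eq_Rintegral => w _.
by ring.
Qed.

(** The second moments of [Y (q n)] decrease with [n] and thus converge; with [incr_sq] and Fatou's
    lemma the distance to [Z] is controlled by what remains of this decrease. *)
Let Z_L2 : exists2 eps : nat -> R, eps @ \oo --> (0 : R) &
  forall n, sqi P (fun w => Y (q n) w - Z w) /\ \int[P]_w ((Y (q n) w - Z w) ^+ 2) <= eps n.
Proof.
pose a n := \int[P]_w (Y (q n) w ^+ 2).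
have a0 n : 0 <= a n by apply: Rint_ge0 => w; exact: sqr_ge0.
have a_nd : nonincreasing_seq a.
  move=> i j ij; rewrite -subr_ge0 -incr_sq//; apply: Rint_ge0 => w; exact: sqr_ge0.
have ca : cvgn a.
  by apply: nonincreasing_is_cvgn => //; exists 0 => _ [n _ <-].
have lima n : limn a <= a n by exact: nonincreasing_cvgn_ge.
have mZ' : measurable_fun setT Z.
  by apply: gmeas_meas mZ; apply: sF; have /andP[-> /ltW ->] := tI.
exists (fun n => a n - limn a).
  by rewrite -(subrr (limn a)); apply: cvgB => //; exact: cvg_cst.
move=> n; have mD : measurable_fun setT (fun w => Y (q n) w - Z w).
  by apply: measurable_funB => //; exact: intg_meas (iY (qI n)).
suff [h1 h2] : intg P (fun w => (Y (q n) w - Z w) ^+ 2) /\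
  \int[P]_w ((Y (q n) w - Z w) ^+ 2) <= a n - limn a by [].
apply: (@intg_fatou _ _ _ P (fun k w => (Y (q n) w - Y (q (k + n)%N) w) ^+ 2)).
- move=> k; have [] : sqi P (fun w => Y (q n) w - Y (q (k + n)%N) w) by
    apply: sqiB; [case: (sYt (qI n))|case: (sYt (qI (k + n)%N))].
  by [].
- by move=> k w; exact: sqr_ge0.
- exact: measurable_funX.
- apply: filterS Zlim => w [cv _].
  have cv' : (fun k => Y (q (k + n)%N) w) @ \oo --> Z w by rewrite (cvg_shiftn n (fun k => Y (q k) w)).
  have cvd : (fun k => Y (q n) w - Y (q (k + n)%N) w) @ \oo --> Y (q n) w - Z w.
    by apply: cvgB => //; exact: cvg_cst.
  by under eq_fun do rewrite expr2; rewrite expr2; exact: cvgM.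
- by move=> k; rewrite incr_sq ?leq_addl// -/(a n) -/(a _) lerD2l lerN2.
Qed.

(** [Z] and [Y t] are both [F t]-measurable. Over a set [B] of [F t], [Y t] has the same integral as
    each [Y (q n)], and these integrals tend to that of [Z] by convergence in mean square. *)
Lemma regular_version_ae : {ae P, forall w, regular_version t w = Y t w}.
Proof.
have tI' : s <= t <= T by have /andP[-> /ltW ->] := tI.
have [eps eps0 Hn] := Z_L2.
have iZ : intg P Z.
  have [sD _] := Hn 0%N; have := intgB (iY (qI 0%N)) (sqi_intg sD).
  by under eq_fun do rewrite subKr.
suff ZY : {ae P, forall w, Z w = Y t w}.
  by apply: filterS2 ZY Zlim => w <- [].
apply: (gmeas_ae_eq (sF tI') mZ (gY tI') iZ (iY tI')) => B FB.
have mB := (sF tI').2 _ FB.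
apply/eqP; rewrite -subr_eq0 -normr_eq0 -sqrf_eq0 eq_le sqr_ge0 andbT.
have bnd n : `|\int[P]_w (\1_B w * Z w) - \int[P]_w (\1_B w * Y t w)| ^+ 2 <= eps n.
  have [sD le] := Hn n; apply: le_trans le.
  have [mY' iY' eY] := mY; have /andP[st _] := tI; have /andP[_ qT] := qI n.
  rewrite -(eY t (q n) B st (ltW (tq n)) qT FB).
  rewrite -RintB; [|exact: intg_indic..|exact: intg_indic (iY (qI n))].
  have P1 : fine (P setT) = 1 by rewrite probability_setT.
  have cs : (\int[P]_w `|Y (q n) w - Z w|) ^+ 2 <= 1 * \int[P]_w ((Y (q n) w - Z w) ^+ 2).
    by rewrite -[X in X * _]P1; exact: cauchy_schwarz_total.
  rewrite mul1r in cs; apply: le_trans cs; rewrite lerXn2r ?nnegrE//; first by apply: Rint_ge0.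
  have E w : \1_B w * Z w - \1_B w * Y (q n) w = \1_B w * (Z w - Y (q n) w) by rewrite mulrBr.
  under eq_Rintegral do rewrite E.
  have iD : intg P (fun w => Z w - Y (q n) w) by exact: intgB (iY (qI n)).
  apply: le_trans (Rint_norm (intg_indic mB iD)) _.
  apply: Rint_le; [exact/intg_abs/intg_indic|exact/intg_abs/sqi_intg|move=> w].
  by rewrite normrM distrC ler_piMl// indicE; case: (_ \in _); rewrite ?normr0 ?normr1.
rewrite -(cvg_lim _ eps0)//; apply: limr_ge; first by apply/cvg_ex; exists 0.
exact: nearW.
Qed.

End version_at.

Lemma cadlag_modification : exists M : R -> W -> R,
  (forall t, s <= t <= T -> {ae P, forall w, M t w = Y t w}) /\
  {ae P, forall w, cadlag_on s T (M ^~ w)}.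
Proof.
exists regular_version; split; last exact: regular_version_cadlag.
move=> t /andP[st]; rewrite le_eqVlt => /orP[/eqP ->|tT].
  by apply: aeW => w; rewrite /regular_version /regularize ltxx.
by apply: regular_version_ae; rewrite st.
Qed.

End martingale_regularization.

(** * Between the raw filtration and its completion *)

Section completed_martingales.
Context d (W : measurableType d) (R : realType) (P : probability W R).
Context (F : R -> set (set W)) (s T : R).
Hypothesis sF : forall t, s <= t <= T -> sub_sigma (F t).
Implicit Types (Y M : R -> W -> R).

Lemma measurable_wrt_completion d' (S : measurableType d') (G : set (set W)) (Y M : W -> S) :
  measurable_wrt G Y -> {ae P, forall w, M w = Y w} -> measurable_wrt (completion P G) M.
Proof.
move=> mY MY B mB; exists (Y @^-1` B); first exact: mY.
apply: negligibleS MY => w /= [[h1 h2]|[h1 h2]] h; [apply: h2|apply: h2]; by rewrite ?h// -h.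
Qed.

Lemma Rint_in (B : set W) (f : W -> R) : measurable B -> intg P f ->
  (\int[P]_(w in B) (f w)%:E)%E = (\int[P]_w (\1_B w * f w))%:E.
Proof.
move=> mB fi; rewrite -Rint_indic /Rintegral fineK//.
by apply: integrable_fin_num => //; exact: integrableS fi.
Qed.

(** A set of the completed sigma-algebra is exchanged for a representative in [F r] and [M] for [Y],
    neither of which affects the integrals. *)
Lemma rmart_martingale Y M : rmart P F s T Y ->
  (forall t, s <= t <= T -> {ae P, forall w, M t w = Y t w}) ->
  martingale P (fun t => completion P (F t)) s T M.
Proof.
move=> [mY iY eY] MY; split=> [t tI|t tI|r t sr rt tT].
- apply: (@measurable_wrt_completion _ _ _ (Y t)); last exact: MY.
  by apply/gmeasP; [exact: sF|exact: mY].
- have /intgP[_] := iY t tI; apply: le_lt_trans; rewrite le_eqVlt; apply/orP; left; apply/eqP.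
  by apply: integral_ae_congr; apply: filterS (MY t tI) => w ->.
have rI : s <= r <= T by rewrite sr (le_trans rt).
have tI : s <= t <= T by rewrite tT (le_trans sr).
split.
  apply: (@measurable_wrt_completion _ _ _ (EFin \o Y r)); last first.
    by apply: filterS (MY r rI) => w /= ->.
  move=> B mB; have /gmeasP : gmeas (F r) (Y r) by exact: mY.
  move=> /(_ (sF rI)) /(_ (EFin @^-1` B)); apply.
  by rewrite -[X in measurable X]setTI; exact: EFin_measurable.
move=> B [B' FB' nBB'].
have mB' := (sF rI).2 _ FB'.
rewrite (integral_ae_congr_in (f := EFin \o M t) (g := EFin \o Y t) nBB'); last first.
  by apply: filterS (MY t tI) => w /= ->.
rewrite (integral_ae_congr_in (f := EFin \o M r) (g := EFin \o Y r) nBB'); last first.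
  by apply: filterS (MY r rI) => w /= ->.
by rewrite !Rint_in ?(eY r t)//; [exact: iY|exact: iY].
Qed.

(** A martingale of the completed basis cannot be used directly in Fubini arguments; a version
    adapted to the raw filtration, here [Y], inherits the martingale property. *)
Lemma martingale_rmart Y M : martingale P (fun t => completion P (F t)) s T M ->
  (forall t, s <= t <= T -> gmeas (F t) (Y t)) ->
  (forall t, s <= t <= T -> {ae P, forall w, M t w = Y t w}) ->
  rmart P F s T Y.
Proof.
move=> [_ iM eM] mY MY.
have iY t : s <= t <= T -> intg P (Y t).
  move=> tI; apply/intgP; split; first exact: gmeas_meas (sF tI) (mY t tI).
  apply: le_lt_trans (iM t tI); rewrite le_eqVlt; apply/orP; left; apply/eqP.
  by apply: integral_ae_congr; apply: filterS (MY t tI) => w ->.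
split => // r t B sr rt tT FB.
have rI : s <= r <= T by rewrite sr (le_trans rt).
have tI : s <= t <= T by rewrite tT (le_trans sr).
have mB := (sF rI).2 _ FB.
apply: EFin_inj; rewrite -!Rint_in//; [|exact: iY|exact: iY].
have [_ /(_ B)] := eM r t sr rt tT.
have nBB : P.-negligible ((B `\` B) `|` (B `\` B)).
  by rewrite setDv setU0; exact: negligible_set0.
rewrite (integral_ae_congr_in (f := EFin \o M t) (g := EFin \o Y t) nBB); last first.
  by apply: filterS (MY t tI) => w /= ->.
rewrite (integral_ae_congr_in (f := EFin \o M r) (g := EFin \o Y r) nBB); last first.
  by apply: filterS (MY r rI) => w /= ->.
by move=> <-//; exists B.
Qed.

Lemma sq_integrable_ae (Y M : W -> R) : sqi P Y -> {ae P, forall w, M w = Y w} ->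
  (\int[P]_w (M w ^+ 2)%:E < +oo)%E.
Proof.
move=> [mY /intgP[_ iY]] MY; apply: le_lt_trans iY; rewrite le_eqVlt; apply/orP; left; apply/eqP.
apply: integral_ae_congr; apply: filterS MY => w ->.
by rewrite ger0_norm// sqr_ge0.
Qed.

Lemma ae_sq_integrable (Y M : W -> R) : measurable_fun setT Y ->
  (\int[P]_w (M w ^+ 2)%:E < +oo)%E -> {ae P, forall w, M w = Y w} -> sqi P Y.
Proof.
move=> mY iM MY; split => //; apply/intgP; split; first exact: measurable_funX.
apply: le_lt_trans iM; rewrite le_eqVlt; apply/orP; left; apply/eqP.
apply: integral_ae_congr; apply: filterS MY => w ->.
by rewrite ger0_norm// sqr_ge0.
Qed.

End completed_martingales.

(** The only case that mixes the two regimes is [r < s <= t]: then [B] is also in [F s], and the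
    integral of [Y t] over [B] is that of [Y s], which is almost surely 0. *)
Lemma rmart_extend d (W : measurableType d) (R : realType) (P : probability W R)
  (F : R -> set (set W)) (s T : R) (Y : R -> W -> R) :
  0 <= s -> s <= T -> (forall t, 0 <= t <= T -> sub_sigma (F t)) ->
  (forall r t, 0 <= r -> r <= t -> t <= T -> F r `<=` F t) ->
  rmart P F s T Y -> {ae P, forall w, Y s w = 0} ->
  rmart P F 0 T (fun t w => if s <= t then Y t w else 0).
Proof.
move=> s0 sT sF monoF [mY iY eY] Y0; split.
- move=> t /andP[t0 tT]; case: (leP s t) => st; last exact: measurable_cst.
  by apply: mY; rewrite st.
- move=> t /andP[t0 tT]; case: (leP s t) => st; last exact: intg_cst.
  by apply: iY; rewrite st.
move=> r t B r0 rt tT FB.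
have [sr|rs] := leP s r; first by rewrite (le_trans sr rt) (eY r t).
under [RHS]eq_Rintegral do rewrite mulr0.
rewrite Rintegral_cst// mul0r.
have [st|ts] := leP s t; last first.
  by under eq_Rintegral do rewrite mulr0; rewrite Rintegral_cst// mul0r.
rewrite (eY s t) ?lexx//; last by apply: monoF (r0) (ltW rs) sT _ FB.
rewrite (@Rint_ae _ _ _ _ _ (fun=> 0)) ?Rintegral_cst ?mul0r//.
by apply: filterS Y0 => w ->; rewrite mulr0.
Qed.

(** * Brackets *)

Section bracket_product.
Context d (W : measurableType d) (R : realType) (P : probability W R).
Context (F : R -> set (set W)) (s T : R).
Hypothesis sT : s <= T.
Hypothesis sF : forall t, s <= t <= T -> sub_sigma (F t).
Hypothesis monoF : forall r t, s <= r -> r <= t -> t <= T -> F r `<=` F t.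
Variable m : {finite_measure set (measurableTypeR R) -> \bar R}.
Hypothesis atomless : forall q : R, m [set q] = 0%E.
Hypothesis msupp : m (~` `]s, T]%classic) = 0%E.
Local Notation Iint := (Iint s T m).
Local Notation rmart := (rmart P F s T).
Local Notation prog := (prog F s T).
Local Notation cl := (clamp s T).

Variables (U S f b v : R -> W -> R) (U0 S0 : R).
Hypotheses (pU : prog U) (pS : prog S) (pf : prog f) (pb : prog b) (pv : prog v).
Hypotheses (f2 : pint2 P s T m f) (b2 : pint2 P s T m b) (iv : pint P s T m v).
Let M t w := U t w - U0 + Iint f t w.
Let N t w := S t w - S0 - Iint b t w.
Hypotheses (mM : rmart M) (mN : rmart N) (sM : sqi P (M T)) (sN : sqi P (N T)).
Hypothesis mK : rmart (fun t w => U t w * S t w -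
  Iint (fun q w => v q w + U q w * b q w - S q w * f q w) t w).

(** With [I_f = Iint f] and [I_b = Iint b], substitute [U = M + U0 - I_f] and [S = N + S0 + I_b] in
    [U S]. The cross terms [M I_b] and [N I_f] are compensated by [rmart_ibp], and [I_f I_b] by
    integration by parts along paths. *)
Lemma rmart_bracket : rmart (fun t w => M t w * N t w - Iint v t w).
Proof.
have pM : prog M by apply: progD; [apply: progB => //; exact: prog_cst|exact: Iint_prog].
have pN : prog N by apply: progB; [apply: progB => //; exact: prog_cst|exact: Iint_prog].
have J1 := rmart_ibp sT sF monoF mM pM sM pb b2.
have J2 := rmart_ibp sT sF monoF mN pN sN pf f2.
have M2 : pint2 P s T m M.
  by apply: (@pint2_bounded _ _ _ P F s T sT sF m M (\int[P]_w (M T w ^+ 2)) pM) => t tI; exact: (rmart_sqi sF mM sM tI).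
have N2 : pint2 P s T m N.
  by apply: (@pint2_bounded _ _ _ P F s T sT sF m N (\int[P]_w (N T w ^+ 2)) pN) => t tI; exact: (rmart_sqi sF mN sN tI).
(* Writing [K] for the martingale of [mK], the process is almost surely
   [K - S0 M - U0 N - J1 - U0 S0 + J2], a combination of martingales. *)
have Z := rmartD sF (rmartB sF (rmartB sF (rmartB sF (rmartB sF mK (rmartZ sF S0 mM)) (rmartZ sF U0 mN))
  J1) (rmart_cst P F s T (U0 * S0))) J2.
apply: (rmart_ae sF Z).
  move=> t tI; apply: (prog_gmeas (b := fun t w => M t w * N t w - Iint v t w)); last exact: tI.
  by apply: progB; [exact: (progM pM pN)|exact: Iint_prog].
move=> t tI.
have pathM := pint_path (pint2M M2 b2); have pathN := pint_path (pint2M N2 f2).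
have pathf := pint_path (pint2_pint f2); have pathb := pint_path (pint2_pint b2).
have pathv := pint_path iv.
have A1 : {ae P, forall w, intg m (fun q => M (cl q) w * b (cl q) w) /\ intg m (fun q => N (cl q) w * f (cl q) w)}.
  by apply: filterS2 pathM pathN => w h1 h2; split.
have A2 : {ae P, forall w, intg m (fun q => f (cl q) w) /\ intg m (fun q => b (cl q) w)}.
  by apply: filterS2 pathf pathb => w h1 h2; split.
apply: filterS3 A1 A2 pathv => w [iMb iNf] [ifw ibw] ivw.
pose fw q := f (cl q) w; pose bw q := b (cl q) w; pose vw q := v (cl q) w.
pose Mb q := M (cl q) w * bw q; pose Nf q := N (cl q) w * fw q.
have iFb : intg m (fun q => cumint m fw q * bw q) by exact: (intg_cumintM atomless).
have iBf : intg m (fun q => cumint m bw q * fw q) by exact: (intg_cumintM atomless).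
have prod := cumintM atomless t ifw ibw.
have i1 : intg m (fun q => Mb q + U0 * bw q) by apply: intgD => //; exact: intgZ.
have i2 : intg m (fun q => Mb q + U0 * bw q - cumint m fw q * bw q) by exact: intgB.
have i3 : intg m (fun q => vw q + (Mb q + U0 * bw q - cumint m fw q * bw q)) by exact: intgD.
have i4 : intg m (fun q => Nf q + S0 * fw q) by apply: intgD => //; exact: intgZ.
have i5 : intg m (fun q => Nf q + S0 * fw q + cumint m bw q * fw q) by exact: intgD.
have KE : Iint (fun q w => v q w + U q w * b q w - S q w * f q w) t w =
    cumint m vw t + (cumint m Mb t + U0 * cumint m bw t - cumint m (fun q => cumint m fw q * bw q) t)
    - (cumint m Nf t + S0 * cumint m fw t + cumint m (fun q => cumint m bw q * fw q) t).
  rewrite -(cumintZ U0 t ibw) -(cumintZ S0 t ifw).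
  rewrite -(cumintD t iMb (intgZ U0 ibw)) -(cumintB t i1 iFb) -(cumintD t ivw i2).
  rewrite -(cumintD t iNf (intgZ S0 ifw)) -(cumintD t i4 iBf) -(cumintB t i3 i5).
  apply: cumint_ae; apply: filterS (ae_clamp msupp) => q qE.
  rewrite /vw /Mb /Nf /bw /fw /M /N /Iint.
  have e1 : cumint m (fun q => f (cl q) w) (cl q) = cumint m (fun q => f (cl q) w) q by rewrite qE.
  have e2 : cumint m (fun q => b (cl q) w) (cl q) = cumint m (fun q => b (cl q) w) q by rewrite qE.
  rewrite -e1 -e2 /cumint; ring.
rewrite KE.
have E1 : Iint (fun q w => M q w * b q w) t w = cumint m Mb t by [].
have E2 : Iint (fun q w => N q w * f q w) t w = cumint m Nf t by [].
have E3 : Iint b t w = cumint m bw t by [].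
have E4 : Iint f t w = cumint m fw t by [].
have E5 : Iint v t w = cumint m vw t by [].
have EM : M t w = U t w - U0 + cumint m fw t by [].
have EN : N t w = S t w - S0 - cumint m bw t by [].
rewrite E1 E2 E3 E4 E5 EM EN.
move: prod; set X1 := cumint m (fun q => _) t; set X2 := cumint m (fun q => _) t => prod.
rewrite -/X1 -/X2.
have -> : X1 = cumint m fw t * cumint m bw t - X2 by rewrite prod; ring.
ring.
Qed.

End bracket_product.

(** * Left-continuous adapted processes are predictable *)

Section predictability.
Context d (W : measurableType d) (R : realType) (G : R -> set (set W)) (T : R).
Hypothesis T0 : 0 < T.

Let D : set (R * W) := `[0, T]%classic `*` [set: W].
Let PS := predictable_sigma_algebra G T.

Let PS_sigma : sigma_algebra D PS. Proof. exact: smallest_sigma_algebra. Qed.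

(** The predictable sigma-algebra lives on [[0, T]] times [W] only. Constraining just the trace on
    that set gives a sigma-algebra on the whole product, for which limits of measurable functions
    are available. *)
Definition trace_predictable : set (set (R * W)) := [set C | PS (C `&` D)].

Lemma trace_predictable_sigma : sigma_algebra setT trace_predictable.
Proof.
have [P0 PD PU] := PS_sigma; split.
- by rewrite /trace_predictable/= set0I.
- move=> A HA; rewrite /trace_predictable /= setTD.
  rewrite (_ : _ `&` D = D `\` (A `&` D)); first exact: PD.
  by apply/seteqP; split => z /=; [move=> [nA Dz]; split => // -[]|move=> [Dz h]; split => // Az; exact: h].
- by move=> A HA; rewrite /trace_predictable /= setI_bigcupl; exact: PU.
Qed.

Let gT := grid 0 T.

Let gTI n k : (k <= 2 ^ n)%N -> 0 <= gT n k <= T. Proof. exact: grid_itv. Qed.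

Let index_ex n t : 0 < t <= T -> exists k, (k < 2 ^ n)%N /\ gT n k < t <= gT n k.+1.
Proof.
move=> /andP[t0 tT].
have : t <= gT n (2 ^ n) by rewrite /gT grid_last.
elim: (2 ^ n)%N => [|k IH].
  by rewrite /gT /grid mul0r mulr0 addr0 leNgt t0.
have [tk _|kt tk1] := leP t (gT n k); last by exists k; rewrite kt tk1.
by have [j [jk jt]] := IH tk; exists j; rewrite ltnS ltnW.
Qed.

(** The grid point strictly to the left of [t]; the default index 0 is not reached for [t] in []0,
    T]], by [index_ex]. *)
Let prev n t := gT n (xget 0%N [set k | (k < 2 ^ n)%N /\ gT n k < t <= gT n k.+1]).

Let prevE n k t : (k < 2 ^ n)%N -> gT n k < t <= gT n k.+1 -> prev n t = gT n k.
Proof.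
move=> kn /andP[kt tk]; rewrite /prev; congr (gT n _).
case: xgetP => [j _ [jn /andP[jt tj]]|/(_ k)]; last by move=> H; exfalso; apply: H; split => //; apply/andP.
apply/eqP; rewrite eqn_leq; apply/andP; split; rewrite leqNgt; apply/negP => lt.
  have : gT n k.+1 <= gT n j by exact: grid_le.
  by move=> /(le_trans tk)/(lt_le_trans jt); rewrite ltxx.
have : gT n j.+1 <= gT n k by exact: grid_le.
by move=> /(le_trans tj)/(lt_le_trans kt); rewrite ltxx.
Qed.

Let prev_lt n t : 0 < t <= T -> t - T / (2 ^ n)%:R <= prev n t < t.
Proof.
move=> tI; have [k [kn kI]] := index_ex n tI; rewrite (prevE kn kI).
have /andP[-> tk] := kI; rewrite andbT lerBlDr; apply: le_trans tk _.
by rewrite /gT /grid !add0r subr0 -natr1 mulrDl mul1r mulrDr.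
Qed.

Let prev_cvg t : 0 < t <= T -> (fun n => prev n t) @ \oo --> t.
Proof.
move=> tI; apply: (@squeeze_cvgr _ _ _ _ (fun n => t - T / (2 ^ n)%:R) (fun=> t)).
- by apply: nearW => n; have /andP[-> /ltW ->] := prev_lt n tI.
- rewrite -[X in _ --> X]subr0; apply: cvgB; first exact: cvg_cst.
  rewrite -(mulr0 T); apply: cvgMr.
  under eq_fun do rewrite natrX -exprVn.
  by apply: cvg_expr; rewrite ger0_norm ?invr_ge0// invf_lt1 ?ltr1n.
- exact: cvg_cst.
Qed.

Variable A : R -> W -> R.
Hypothesis mA : forall t, 0 <= t <= T -> measurable_wrt (G t) (A t).
Hypothesis cA : forall w t, 0 < t <= T -> A r w @[r --> t^'-] --> A t w.

Let step n (z : R * W) : R :=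
  if z.1 == 0 then A 0 z.2 else if 0 < z.1 <= T then A (prev n z.1) z.2 else 0.

Let f (z : R * W) : R := if 0 <= z.1 <= T then A z.1 z.2 else 0.

Local Notation Z := (g_sigma_algebraType trace_predictable).

Let ZE : @measurable _ Z = trace_predictable.
Proof. exact/sigma_algebra_id/trace_predictable_sigma. Qed.

Let DE (z : R * W) : D z = (0 <= z.1 <= T) :> Prop.
Proof. by rewrite /D /= ?in_itv/= propeqE; split => [[]|]. Qed.

Let gen_zero (C : set W) : G 0 C -> trace_predictable ([set 0] `*` C).
Proof.
move=> GC; rewrite /trace_predictable /= (_ : _ `&` D = [set 0] `*` C).
  by apply: sub_sigma_algebra; left; exists C.
apply/seteqP; split => [z []//|[t w] /= [-> Cw]]; split => //.
by rewrite DE /= lexx ltW.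
Qed.

Let gen_rect (r t : R) (C : set W) : 0 <= r -> r < t -> t <= T -> G r C ->
  trace_predictable (`]r, t]%classic `*` C).
Proof.
move=> r0 rt tT GC; rewrite /trace_predictable /= (_ : _ `&` D = `]r, t]%classic `*` C).
  by apply: sub_sigma_algebra; right; exists r, t; split => //; exists C.
apply/seteqP; split => [z []//|[q w] /=]; rewrite ?in_itv/= => -[/andP[rq qt] Cw].
split; first by split => //=; rewrite ?in_itv/= rq.
by rewrite DE /= (le_trans r0 (ltW rq)) (le_trans qt).
Qed.

Let step_meas n : measurable_fun [set: Z] (step n : Z -> R).
Proof.
move=> _ B mB; rewrite setTI ZE.
have [P0 PC PU] := trace_predictable_sigma.
have I0 : 0 <= (0 : R) <= T by rewrite lexx ltW.
(* One piece for time 0, one for each of the [2 ^ n] rectangles, and one, at index [(2 ^ n).+1], for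
   the points outside [D], where the step process is 0. *)
pose C (i : nat) : set (R * W) :=
  if i is k.+1 then
    if (k < 2 ^ n)%N then `]gT n k, gT n k.+1]%classic `*` (A (gT n k) @^-1` B)
    else if (k == 2 ^ n)%N then (if `[< B 0 >] then ~` D else set0) else set0
  else [set 0] `*` (A 0 @^-1` B).
have DD : trace_predictable (~` D) by rewrite /trace_predictable /= setICl; have [] := PS_sigma.
have CP i : trace_predictable (C i).
  case: i => [|k]; first by apply: gen_zero; apply: (mA I0).
  rewrite /C; case: ifP => kn.
    have /andP[g0 _] := gTI (ltnW kn); have /andP[_ gT1] := gTI kn.
    apply: gen_rect => //; first by rewrite grid_lt.
    by apply: mA => //; exact: gTI (ltnW kn).
  by case: ifP => // _; case: ifP => // _.
rewrite (_ : _ @^-1` B = \bigcup_i C i); first exact: PU.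
apply/seteqP; split => -[t w] /=.
  rewrite /step /=; case: eqP => [-> Bz|t0]; first by exists 0%N.
  case: ifPn => [tI Bz|tI B0].
    have [k [kn kI]] := index_ex n tI; exists k.+1 => //=; rewrite kn; split => /=.
      by rewrite ?in_itv.
    by rewrite -(prevE kn kI).
  exists (2 ^ n).+1 => //=; rewrite ltnn eqxx asboolT// => Dz.
  move: tI; have : 0 <= t <= T by move: Dz; rewrite DE.
  by move=> /andP[t1 ->]; rewrite andbT lt_neqAle t1 andbT eq_sym => /negP; apply; apply/eqP.
move=> [[|k] _ /=]; first by move=> [-> Bz]; rewrite /step /= eqxx.
case: ifP => kn.
  move=> -[/andP[kt tk] Bz]; rewrite ?bnd_simp in kt tk.
  have /andP[g0 _] := gTI (ltnW kn); have /andP[_ gT1] := gTI kn.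
  have t0 : 0 < t by exact: le_lt_trans kt.
  rewrite /step /= gt_eqF// t0 (le_trans tk gT1)/=.
  by rewrite (@prevE n k)// kt.
case: ifP => // _; case: asboolP => // B0 nD.
rewrite /step /=; case: eqP => [t0|t0].
  by exfalso; apply: nD; rewrite DE /= t0 lexx ltW.
case: ifPn => // /andP[t1 tT]; exfalso; apply: nD; rewrite DE /= tT andbT ltW//.
Qed.

(** The step processes freeze [A] at the left end of each dyadic interval; they are predictable, and
    left-continuity makes them converge to [A]. *)
Lemma predictable_left_continuous : predictable G T A.
Proof.
move=> B mB.
have : measurable_fun [set: Z] (f : Z -> R).
  apply: (measurable_fun_cvg step_meas) => -[t w] _ /=.
  rewrite /f /=; have [tI|tI] := boolP (0 <= t <= T).
    have [->|t0] := eqVneq t 0; first by apply: cvg_near_cst; apply: nearW => n; rewrite /step /= eqxx.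
    have tI' : 0 < t <= T by rewrite lt_neqAle eq_sym t0.
    have -> : (fun n => step n (t, w)) = fun n => A (prev n t) w.
      by apply/funext => n; rewrite /step /= (negbTE t0) tI'.
    have /cvg_at_leftP := @cA w t tI'; apply; split; last exact: prev_cvg.
    by move=> n; have /andP[] := prev_lt n tI'.
  apply: cvg_near_cst; apply: nearW => n; rewrite /step /=.
  rewrite ifF; last by apply/negbTE; apply: contra tI => /eqP ->; rewrite lexx ltW.
  by rewrite ifF//; apply/negbTE; apply: contra tI => /andP[/ltW -> ->].
move=> /(_ measurableT B mB); rewrite setTI ZE /trace_predictable /=.
rewrite (_ : _ `&` D = [set z | 0 <= z.1 <= T /\ B (A z.1 z.2)])//.
apply/seteqP; split => z /=; rewrite DE /f.
  by move=> [+ zI]; rewrite zI.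
by move=> [zI Bz]; rewrite zI.
Qed.

End predictability.

(** Difference of the two nondecreasing integrals of [|f|] and of [|f| - f]. *)
Lemma cumint_bounded_variation (R : realType) (m : {finite_measure set (measurableTypeR R) -> \bar R})
  (f : R -> R) a b : a < b -> intg m f -> bounded_variation a b (cumint m f).
Proof.
move=> ab fi; have ai := intg_abs fi.
have di : intg m (fun q => `|f q| - f q) by exact: intgB.
rewrite (_ : cumint m f = cumint m (fun q => `|f q|) \+ (\- cumint m (fun q => `|f q| - f q))).
  apply: bounded_variationD => //; [|apply: bounded_variationN];
    apply: nondecreasing_bounded_variation => x y _ _ xy; apply: cumint_nd => // q.
  by rewrite subr_ge0 ler_norm.
by apply/funext => t /=; rewrite (cumintB t ai fi); ring.
Qed.

Section integral_bracket.
Context d (W : measurableType d) (R : realType) (P : probability W R).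
Context (F : R -> set (set W)) (s T : R).
Hypotheses (T0 : 0 < T) (s0 : 0 <= s) (sT : s <= T).
Hypothesis sF : forall t, 0 <= t <= T -> sub_sigma (F t).
Hypothesis monoF : forall r t, 0 <= r -> r <= t -> t <= T -> F r `<=` F t.
Variable m : {finite_measure set (measurableTypeR R) -> \bar R}.
Hypothesis atomless : forall q : R, m [set q] = 0%E.
Hypothesis msupp : m (~` `]s, T]%classic) = 0%E.
Variables (M N M' N' v : R -> W -> R).
Hypotheses (pv : prog F s T v) (iv : pint P s T m v).
Hypothesis mMN : rmart P F s T (fun t w => M' t w * N' t w - Iint s T m v t w).
Hypothesis M'0 : {ae P, forall w, M' s w = 0}.
Hypothesis ME : forall t, 0 <= t <= T -> {ae P, forall w, M t w = if s <= t then M' t w else 0}.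
Hypothesis NE : forall t, 0 <= t <= T -> {ae P, forall w, N t w = if s <= t then N' t w else 0}.

Let good w := intg m (fun q => v (clamp s T q) w).
(** Set to 0 on the paths along which [v] is not integrable, so that every path is continuous, as
    [predictable_left_continuous] asks. Adaptedness survives in the completed filtration, these
    paths being negligible. *)
Let A t w := if `[< good w >] then Iint s T m v t w else 0.

Let sF' t : s <= t <= T -> sub_sigma (F t).
Proof. by move=> /andP[st tT]; apply: sF; rewrite (le_trans s0 st). Qed.

Let goodP : {ae P, forall w, good w}. Proof. exact: pint_path. Qed.

Let AE t : {ae P, forall w, A t w = Iint s T m v t w}.
Proof. by apply: filterS goodP => w gw; rewrite /A asboolT. Qed.

Let Astart t w : t <= s -> A t w = 0.
Proof. by move=> ts; rewrite /A; case: ifP => // _; exact: (cumint_start msupp). Qed.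

Let Acont w : continuous (A ^~ w).
Proof.
rewrite /A; case: asboolP => gw; last exact: cst_continuous.
exact: (cumint_continuous atomless gw).
Qed.

Lemma is_angle_bracket_Iint : exists B,
  is_angle_bracket P (fun t => completion P (F t)) T M N B /\
  indistinguishable P T B (fun t w => Iint s T m v (Num.max t s) w).
Proof.
exists A; split; last first.
  apply: filterS goodP => w gw t tI; rewrite /A asboolT//.
  have [ts|st] := leP t s; last by [].
  by rewrite /Iint -/(cumint m _ t) -/(cumint m _ s) !(cumint_start msupp).
split.
- apply: predictable_left_continuous => //.
  + move=> t tI; have [st|ts] := leP s t.
      have tI' : s <= t <= T by rewrite st; case/andP: tI.
      apply: (@measurable_wrt_completion _ _ _ _ _ _ _ (Iint s T m v t)); last exact: AE.
      by apply/(gmeasP _ (sF' tI')); exact: (Iint_gmeas m pv).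
    apply: (@measurable_wrt_completion _ _ _ _ _ _ _ (fun=> 0 : R)).
      by apply/(gmeasP _ (sF tI)); exact: measurable_cst.
    by apply: aeW => w; rewrite Astart// ltW.
  + by move=> w t _; apply: cvg_at_left_filter; exact: Acont.
- by apply: aeW => w; exact: Astart.
- apply: aeW => w; split => t _; first by apply: cvg_at_right_filter; exact: Acont.
  by exists (A t w); apply: cvg_at_left_filter; exact: Acont.
- apply: filterS goodP => w gw.
  rewrite (_ : A ^~ w = cumint m (fun q => v (clamp s T q) w)); first exact: cumint_bounded_variation.
  by apply/funext => t; rewrite /A asboolT.
have ext := rmart_extend s0 sT sF monoF mMN.
have z0 : {ae P, forall w, M' s w * N' s w - Iint s T m v s w = 0}.
  apply: filterS M'0 => w ->; rewrite mul0r sub0r.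
  by rewrite [Iint _ _ _ _ _ _](cumint_start msupp) ?oppr0.
apply: (rmart_martingale sF (ext z0)) => t tI.
apply: filterS3 (ME tI) (NE tI) (AE t) => w -> -> AtE.
case: ifPn => st; first by rewrite AtE.
by rewrite mul0r Astart ?subr0// ltW// ltNge.
Qed.

End integral_bracket.
(** * The canonical space and the Markov property *)

Section polish_borel.
Context (R : realType) (E : ptopologicalType).
Hypothesis polishE : polish_space R E.

(* [phi k = min 1 (k rho)] with [rho] the distance to the complement of [U],
   capped at 1 (so that [U] may be the whole space). *)
Lemma polish_indic_approx (U : set E) : open U -> exists phi : nat -> E -> R,
  [/\ forall k, continuous (phi k), forall k y, 0 <= phi k y <= 1 &
      forall y, (fun k => phi k y) @ \oo --> (\1_U y : R)].
Proof.
move=> oU; have [_ [d [d0 dC dT _] dN]] := polishE.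
have d_ge0 x y : 0 <= d x y.
  have := dT x y x; rewrite (dC y x) ((d0 x x).2 erefl); lra.
pose S y := [set 1 : R] `|` [set d y z | z in ~` U].
pose rho y := inf (S y).
have S1 y : S y 1 by left.
have Slb y : lbound (S y) 0 by move=> _ [->|[z _ <-]].
have hS y : has_inf (S y) by split; [exists 1|exists 0].
have rho0 y : 0 <= rho y by apply: lb_le_inf; [exists 1|exact: Slb].
have lip y y' : rho y - d y y' <= rho y'.
  apply: lb_le_inf; first by exists 1.
  move=> _ [->|[z nUz <-]]; rewrite lerBlDr.
    apply: le_trans (_ : rho y <= 1) _; last by rewrite lerDl.
    by apply: ge_inf; [exists 0|left].
  apply: le_trans (_ : rho y <= d y z) _; last by rewrite addrC.
  by apply: ge_inf; [exists 0|right; exists z].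
have rho_cont : continuous rho.
  move=> y; apply/cvgrPdist_lt => e e0; apply/dN; exists e => // y' /= yy'.
  rewrite ltr_norml; have l1 := lip y y'; have l2 := lip y' y; rewrite (dC y' y) in l2; apply/andP; split; lra.
have rhoU y : U y -> 0 < rho y.
  move=> Uy; have /dN[e e0 eU] : nbhs y U by exact: open_nbhs_nbhs.
  apply: (@lt_le_trans _ _ (Num.min 1 e)); first by rewrite lt_min ltr01.
  apply: lb_le_inf; first by exists 1.
  move=> _ [->|[z nUz <-]]; first by rewrite ge_min lexx.
  by rewrite ge_min; apply/orP; right; rewrite leNgt; apply/negP => h; apply: nUz; exact: eU.
have rhoN y : ~ U y -> rho y = 0.
  move=> nUy; apply/eqP; rewrite eq_le rho0 andbT.
  by apply: ge_inf; [exists 0|right; exists y => //; exact/d0].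
exists (fun k y => Num.min 1 (k%:R * rho y)); split.
- move=> k y; apply: (@continuous_min _ _ (fun=> 1) (fun y => k%:R * rho y)); first exact: cst_continuous.
  by apply: cvgMr; exact: rho_cont.
- by move=> k y; rewrite le_min ler01 mulr_ge0//= ge_min lexx.
- move=> y; have [Uy|nUy] := pselect (U y); last first.
    by rewrite indicE memNset// rhoN//; apply: cvg_near_cst; apply: nearW => k; rewrite mulr0 min_r.
  rewrite indicE mem_set//; apply: cvg_near_cst.
  have r0 := rhoU y Uy; exists (Num.trunc (rho y)^-1).+1 => // k /= hk.
  rewrite min_l// -ler_pdivrMr// mul1r ltW// (lt_le_trans (truncnS_gt _))// ler_nat//.
Qed.

Lemma continuous_borel_measurable (phi : E -> R) : continuous phi ->
  measurable_fun [set: borel E] (phi : borel E -> R).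
Proof.
move=> cphi; apply: (measurability _ (RGenOInfty.measurableE R)) => //.
move=> _ [_ [a ->] <-]; rewrite setTI; apply: sub_sigma_algebra.
apply: open_comp; last exact: rray_open.
by move=> y _; exact: cphi.
Qed.

(** For [U] open, the indicator of [U] is a limit of continuous functions [phi k], and each [phi k]
    composed with [f] is a limit of measurable real functions. Two passages to the limit thus reduce
    the claim to real-valued functions. *)
Lemma measurable_fun_limit_borel d (Z : measurableType d) (f_ : nat -> Z -> borel E) (f : Z -> borel E) :
  (forall n, measurable_fun setT (f_ n)) ->
  (forall z, (fun n => f_ n z : E) @ \oo --> (f z : E)) ->
  measurable_fun setT f.
Proof.
move=> mf_ ff; apply: (measurability _ (erefl : @measurable _ (borel E) = <<s @open E >>)).
move=> _ [U oU <-]; rewrite setTI.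
have [phi [cphi _ phiU]] := polish_indic_approx oU.
have mphi k : measurable_fun setT (fun z => phi k (f z)).
  apply: (@measurable_fun_cvg _ _ _ _ (fun n z => phi k (f_ n z))).
    by move=> n; exact: measurableT_comp (continuous_borel_measurable (cphi k)) (mf_ n).
  by move=> z _; apply: cvg_comp (ff z) _; exact: cphi.
have mU : measurable_fun setT (fun z => \1_U (f z) : R).
  by apply: (measurable_fun_cvg mphi) => z _; exact: phiU.
have := mU measurableT [set 1] (measurable_set1 1).
rewrite setTI; congr (measurable _); apply/seteqP; split => z /=; rewrite indicE.
  by case: (boolP (f z \in U)) => [/set_mem//|_ /eqP]; rewrite eq_sym oner_eq0.
by move=> Uz; rewrite mem_set.
Qed.

End polish_borel.

Lemma measurable_time_discretized d1 d2 d3 (Z1 : measurableType d1) (Z2 : measurableType d2)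
  (S : measurableType d3) (g : Z1 -> nat) (f : nat -> Z2 -> S) :
  (forall k, measurable (g @^-1` [set k])) -> (forall k, measurable_fun setT (f k)) ->
  measurable_fun [set: Z1 * Z2] (fun z => f (g z.1) z.2).
Proof.
move=> mg mf _ B mB; rewrite setTI.
rewrite (_ : _ @^-1` B = \bigcup_k ((g @^-1` [set k]) `*` (f k @^-1` B))).
  apply: bigcupT_measurable => k; apply: measurableX => //.
  by rewrite -[X in measurable X]setTI; exact: mf.
by apply/seteqP; split => [z /= Bz|z [k _ /= [<-]]//]; exists (g z.1).
Qed.

Section time_discretization.
Context (R : realType) (s t : R).
Hypothesis st : s <= t.

Definition disc_index (n : nat) (q : measurableTypeR R) : nat :=
  if s < t then next_index s t n (clamp s t q) else 0%N.

(** The minimum with [t] matters at the right end: for a time clamped to [t], [next_index] is one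
    past the last grid point. *)
Definition disc_time (n k : nat) : R := Num.max s (Num.min (grid s t n k) t).

Lemma measurable_disc_index n k : measurable (disc_index n @^-1` [set k]).
Proof.
rewrite /disc_index; case: ltP => h; last first.
  have [->|k0] := eqVneq k 0%N.
    by rewrite (_ : _ @^-1` _ = setT)//; apply/seteqP.
  by rewrite (_ : _ @^-1` _ = set0)//; apply/seteqP; split => // q /= /esym/eqP; rewrite (negbTE k0).
pose x (q : measurableTypeR R) : R := (2 ^ n)%:R * ((clamp s t q - s) / (t - s)).
have mx : measurable_fun setT x.
  apply: measurable_funM => //; apply: measurable_funM => //; apply: measurable_funB => //.
  exact: measurable_clamp.
have x0 q : 0 <= x q.
  have /andP[h1 _] := clamp_itv q st.
  by rewrite mulr_ge0// divr_ge0// subr_ge0.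
case: k => [|k].
  by rewrite (_ : _ @^-1` _ = set0)//; apply/seteqP; split => // q.
rewrite (_ : _ @^-1` _ = x @^-1` `[k%:R, k.+1%:R[%classic).
  by rewrite -[X in measurable X]setTI; apply: mx => //; exact: measurable_itv.
apply/seteqP; split => q /=; rewrite in_itv/=.
  by move=> [] E; rewrite -(truncn_eq _ (x0 q)); apply/eqP.
by move=> xk; rewrite /next_index; congr (_.+1); apply/eqP; rewrite (truncn_eq _ (x0 q)).
Qed.

Lemma disc_time_itv n k : s <= disc_time n k <= t.
Proof. exact: clamp_itv. Qed.

Lemma disc_time_ge n q : clamp s t q <= disc_time n (disc_index n q).
Proof.
have /andP[c1 c2] := clamp_itv q st; rewrite /disc_index /disc_time.
case: ltP => h; last by rewrite (le_trans c2)// (le_trans h)// le_max lexx.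
rewrite le_max le_min c2 andbT; apply/orP; right.
have [ct|ct] := ltP (clamp s t q) t.
  have cI : s <= clamp s t q < t by rewrite c1.
  by have /andP[/ltW] := next_gt h n cI.
have -> : clamp s t q = t by apply/eqP; rewrite eq_le c2.
rewrite -{1}(grid_last s t n) grid_le// /next_index divff ?gt_eqF ?subr_gt0// mulr1.
by rewrite natrK ltnW.
Qed.

Lemma disc_time_cvg q : (fun n => disc_time n (disc_index n q)) @ \oo --> clamp s t q.
Proof.
have /andP[c1 c2] := clamp_itv q st.
apply: (@squeeze_cvgr _ _ _ _ (fun=> clamp s t q) (fun n => clamp s t q + (t - s) / (2 ^ n)%:R)).
- apply: nearW => n; rewrite disc_time_ge/=.
  have D0 : 0 <= (t - s) / (2 ^ n)%:R by rewrite divr_ge0// subr_ge0.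
  rewrite /disc_time ge_max; apply/andP; split; first by rewrite (le_trans c1)// lerDl.
  rewrite ge_min; have [ct|ct] := ltP (clamp s t q) t; apply/orP; last first.
    by right; rewrite (le_trans ct)// lerDl.
  left; have h := le_lt_trans c1 ct; rewrite /disc_index h.
  have cI : s <= clamp s t q < t by rewrite c1.
  by have /andP[_] := next_gt h n cI.
- exact: cvg_cst.
- rewrite -[X in _ --> X]addr0; apply: cvgD; first exact: cvg_cst.
  rewrite -(mulr0 (t - s)); apply: cvgMr.
  under eq_fun do rewrite natrX -exprVn.
  by apply: cvg_expr; rewrite ger0_norm ?invr_ge0// invf_lt1 ?ltr1n.
Qed.

End time_discretization.

Section canonical_filtration.
Context (R : realType) (E : ptopologicalType) (T : R).
Hypothesis T0 : 0 < T.
Local Notation Om := (Omega E T).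
Local Notation F := (@filtration R E T).

Lemma sub_sigma_filtration t : t <= T -> sub_sigma (F t).
Proof.
move=> tT; rewrite /filtration; case: ltP => h; last first.
  split => //; rewrite -[measurable]/(<<s @path_cylinders R E T T >>).
  exact: smallest_sigma_algebra.
have sA u := @smallest_sigma_algebra _ [set: Om] (@path_cylinders R E T u).
split; first split.
- by move=> u _; have [] := sA u.
- by move=> A FA u uI; have [_ + _] := sA u; apply; exact: FA.
- by move=> A FA u uI; have [_ _] := sA u; apply => n; exact: FA.
- by move=> A /(_ T); apply; rewrite /= in_itv/= h lexx.
Qed.

Lemma filtration_mono r t : r <= t -> t <= T -> F r `<=` F t.
Proof.
move=> rt tT A; rewrite /filtration; case: (ltP r T) => rT; last first.
  by rewrite ltNge (le_trans rT rt).
move=> FA; case: (ltP t T) => h; last by apply: FA; rewrite /= in_itv/= rT lexx.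
move=> u /=; rewrite in_itv/= => /andP[tu uT]; apply: FA.
by rewrite /= in_itv/= (le_lt_trans rt tu).
Qed.

Lemma filtration_rc t : t < T -> forall A, (forall u, t < u <= T -> F u A) -> F t A.
Proof.
move=> tT A HA; rewrite /filtration tT => u /=; rewrite in_itv/= => /andP[tu uT].
(* A set of [F v], for [v < T], belongs to the sigma-algebra of the paths up to any later time, in
   particular up to [u]; so a [v] strictly between [t] and [u] is used. *)
pose v := (t + u) / 2; have tv : t < v by rewrite /v; lra.
have vu : v < u by rewrite /v; lra.
have := HA v; rewrite tv (ltW (lt_le_trans vu uT)) => /(_ isT).
by rewrite /filtration (lt_le_trans vu uT); apply; rewrite /= in_itv/= vu.
Qed.

Lemma cylinder_filtration r t (B : set (borel E)) : 0 <= r <= t -> t <= T -> measurable B ->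
  F t ((X r : Om -> borel E) @^-1` B).
Proof.
move=> rI tT mB; rewrite /filtration; case: ltP => h.
  move=> u /=; rewrite in_itv/= => /andP[tu uT]; apply: sub_sigma_algebra.
  by exists r; [case/andP: rI => -> rt; rewrite (le_trans rt)// ltW|exists B].
apply: sub_sigma_algebra; exists r; first by case/andP: rI => -> rt; rewrite (le_trans rt).
by exists B.
Qed.

Lemma measurable_X r : 0 <= r <= T -> measurable_fun setT (X r : Om -> borel E).
Proof.
move=> rI _ B mB; rewrite setTI.
have TT : T <= T by [].
by have := cylinder_filtration rI TT mB; rewrite /filtration ltxx.
Qed.

Lemma X_right_cvg (w : Om) (r : R) (u : nat -> R) : 0 <= r <= T ->
  (forall n, r <= u n <= T) -> u @ \oo --> r -> (fun n => X (u n) w : E) @ \oo --> (X r w : E).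
Proof.
move=> /andP[r0 rT] uI ur; have := set_valP w => -[[rc _] _ _].
move: rT; rewrite le_eqVlt => /orP[/eqP rT|rT].
  apply: cvg_near_cst; apply: nearW => n; have := uI n.
  by rewrite rT -eq_le => /eqP <-.
have := rc r; rewrite r0 rT => /(_ isT) cr.
move=> B nB; have /= := cr B nB; rewrite /at_right /= => -[e /= e0 He].
have /cvgrPdist_lt/(_ _ e0) := ur; apply: filterS => n /= un.
have /andP[run _] := uI n; move: run; rewrite le_eqVlt => /orP[/eqP <-|run].
  exact: nbhs_singleton.
by apply: He.
Qed.

Hypothesis polishE : polish_space R E.

(** By right-continuity of paths, [X] is the limit of its values at the discretized times. These
    approach from the right without ever exceeding [t], so only [F t] is involved. *)
Lemma prog_X s t : 0 <= s -> s <= t -> t <= T ->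
  measurable_fun [set: measurableTypeR R * g_sigma_algebraType (F t)]
    (fun z => X (clamp s t z.1) z.2 : borel E).
Proof.
move=> s0 st tT; have sF := sub_sigma_filtration tT.
apply: (measurable_fun_limit_borel polishE
  (f_ := fun n (z : measurableTypeR R * g_sigma_algebraType (F t)) =>
    X (disc_time s t n (disc_index s t n z.1)) (z.2 : Om) : borel E)).
  move=> n; apply: (measurable_time_discretized (g := disc_index s t n)
    (f := fun k (w : g_sigma_algebraType (F t)) => X (disc_time s t n k) (w : Om) : borel E)).
    by move=> k; exact: measurable_disc_index.
  move=> k _ B mB; rewrite setTI sub_sigmaE//; apply: cylinder_filtration => //.
  by have /andP[h1 ->] := disc_time_itv st n k; rewrite (le_trans s0).
move=> [q w] /=; apply: X_right_cvg.
- by have /andP[h1 h2] := clamp_itv q st; rewrite (le_trans s0 h1) (le_trans h2).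
- move=> n; rewrite disc_time_ge//=.
  by have /andP[_ h] := disc_time_itv st n (disc_index s t n q); rewrite (le_trans h).
- exact: disc_time_cvg.
Qed.

Lemma measurable_time_dom : measurable (@time_dom R E T).
Proof.
rewrite (_ : time_dom T = `[0, T]%classic `*` setT).
  by apply: measurableX => //; exact: measurable_itv.
apply/seteqP; split => z; rewrite /time_dom/=; first by move=> zI; rewrite ?in_itv/=.
by rewrite ?in_itv/= => -[].
Qed.

Lemma prog_borel_fun s (phi : measurableTypeR R * borel E -> R) : 0 <= s -> s <= T ->
  borel_fun T phi -> prog F s T (fun q w => phi (q, X q w)).
Proof.
move=> s0 sT mphi t /andP[st tT].
apply: (@measurable_comp _ _ _ _ _ _ (time_dom T) phi _
  (fun z : measurableTypeR R * g_sigma_algebraType (F t) => (clamp s t z.1, X (clamp s t z.1) z.2 : borel E))).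
- exact: measurable_time_dom.
- move=> _ [z _ <-]; rewrite /time_dom/=.
  by have /andP[h1 h2] := clamp_itv z.1 st; rewrite (le_trans s0 h1) (le_trans h2).
- exact: mphi.
apply: measurable_fun_pair; last exact: prog_X.
exact: measurableT_comp (measurable_clamp s t) measurable_fst.
Qed.

End canonical_filtration.

Section kernel_family.
Context d1 d2 (X1 : measurableType d1) (Y : measurableType d2) (R : realType).
Variable l : X1 -> {measure set Y -> \bar R}.
Hypothesis l1 : forall x, (l x setT <= 1)%E.
Hypothesis ml : forall A, measurable A -> measurable_fun setT (fun x => l x A).

Let kfam (_ : forall A, measurable A -> measurable_fun setT (fun x => l x A))
  (x : X1) : {measure set Y -> \bar R} := l x.

HB.instance Definition _ := isKernel.Build _ _ _ _ R (kfam ml) ml.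

Let kfam_uub : measure_fam_uub (kfam ml).
Proof.
by exists 2 => x; rewrite /kfam (le_lt_trans (l1 x))// lte_fin ltr1n.
Qed.

HB.instance Definition _ := Kernel_isFinite.Build _ _ _ _ R (kfam ml) kfam_uub.

(** Serves for [P t r y] as a family indexed by the pair of the time [r] and the state [y]: once it
    is packaged as a finite kernel, integrals with a parameter are measurable. *)
Lemma measurable_integral_family (k : X1 * Y -> \bar R) :
  (forall z, 0 <= k z)%E -> measurable_fun setT k ->
  measurable_fun setT (fun x => \int[l x]_y k (x, y))%E.
Proof. exact: measurable_fun_integral_finite_kernel k (kfam ml). Qed.

End kernel_family.

Section ge0_induction.
Import HBNNSimple.
Context d (Y : measurableType d) (R : realType).
Local Open Scope ereal_scope.

Lemma ge0_measurable_ind (H : (Y -> \bar R) -> Prop) :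
  (forall A, measurable A -> H (fun y => (\1_A y)%:E)) ->
  (forall (k : R) f, (0 <= k)%R -> measurable_fun setT f -> (forall y, 0 <= f y) -> H f -> H (fun y => k%:E * f y)) ->
  (forall f g, measurable_fun setT f -> measurable_fun setT g -> (forall y, 0 <= f y) ->
     (forall y, 0 <= g y) -> H f -> H g -> H (fun y => f y + g y)) ->
  (forall (f_ : nat -> Y -> \bar R) f, (forall n, measurable_fun setT (f_ n)) ->
     (forall n y, 0 <= f_ n y) -> (forall y, nondecreasing_seq (f_ ^~ y)) ->
     (forall y, f_ ^~ y @ \oo --> f y) -> (forall n, H (f_ n)) -> H f) ->
  forall f, measurable_fun setT f -> (forall y, 0 <= f y) -> H f.
Proof.
move=> H1 HZ HD Hlim f mf f0.
pose f_ := nnsfun_approx measurableT mf.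
apply: (Hlim (fun n y => (f_ n y)%:E)) => /=.
- by move=> n; apply/measurable_EFinP.
- by move=> n y; rewrite lee_fin.
- by move=> y m n mn; rewrite lee_fin; exact/lefP/nd_nnsfun_approx.
- by move=> y; exact: cvg_nnsfun_approx.
move=> n.
have H0 : H (fun=> 0).
  have -> : (fun=> 0) = (fun y : Y => (\1_set0 y : R)%:E) by apply/funext => y; rewrite indic0.
  exact: H1.
have -> : (fun y => (f_ n y)%:E) = (fun y => \sum_(r <- fset_set (range (f_ n))) ((r * \1_(f_ n @^-1` [set r]) y)%:E : \bar R)).
  by apply/funext => y; rewrite [X in X%:E]fimfunE fsbig_finite//= sumEFin.
(* Replacing [r] by [Num.max 0 r] keeps all coefficients nonnegative for an arbitrary list; on the
   range of the nonnegative [f_ n] nothing changes. *)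
have key (s : seq R) : H (fun y => \sum_(r <- s) (Num.max 0 r * \1_(f_ n @^-1` [set r]) y)%:E) /\
   measurable_fun setT (fun y => \sum_(r <- s) (Num.max 0 r * \1_(f_ n @^-1` [set r]) y)%:E).
  elim: s => [|r s [IH IHm]].
    by under eq_fun do rewrite big_nil; split.
  have mi : measurable_fun setT (fun y => (\1_(f_ n @^-1` [set r]) y : R)%:E).
    by apply/measurable_EFinP; exact: measurable_indic.
  have i0 y : 0 <= (\1_(f_ n @^-1` [set r]) y : R)%:E by rewrite lee_fin.
  under eq_fun do rewrite big_cons EFinM.
  have m0 : (0 <= Num.max 0 r)%R by rewrite le_max lexx.
  split; last by apply: emeasurable_funD IHm; exact: measurable_funeM.
  apply: HD => //.
  - exact: measurable_funeM.
  - by move=> y; rewrite mule_ge0// lee_fin.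
  - by move=> y; apply: sume_ge0 => r' _; rewrite lee_fin mulr_ge0// le_max lexx.
  - by apply: HZ => //; exact: H1.
have [+ _] := key (fset_set (range (f_ n))); congr H; apply/funext => y.
rewrite !big_seq; apply: eq_bigr => r; rewrite in_fset_set// inE => -[z _ <-].
by rewrite max_r.
Qed.

End ge0_induction.

Lemma integral_bounded_cvg d (Y : measurableType d) (R : realType) (mu : {measure set Y -> \bar R})
  (f_ : nat -> Y -> R) (f : Y -> R) : (mu setT < +oo)%E ->
  (forall n, measurable_fun setT (f_ n)) -> (forall n y, 0 <= f_ n y <= 1) ->
  (forall y, f_ ^~ y @ \oo --> f y) ->
  ((\int[mu]_y (f_ n y)%:E)%E @[n --> \oo] --> (\int[mu]_y (f y)%:E)%E).
Proof.
move=> muT mf_ f01 f_f.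
have mf : measurable_fun setT f by apply: (measurable_fun_cvg mf_) => y _; exact: f_f.
have [] := @dominated_convergence _ _ _ mu setT measurableT (fun n y => (f_ n y)%:E)
   (fun y => (f y)%:E) (cst 1%E) => //.
- by move=> n; apply/measurable_EFinP.
- by apply/measurable_EFinP.
- by apply: aeW => y _; apply: cvg_EFin_seq; exact: f_f.
- apply/integrableP; split; first exact: measurable_cst.
  by under eq_integral do rewrite /= normr1; rewrite integral_cst// mul1e.
- by apply: aeW => y n _; rewrite lee_fin /= ger0_norm; have /andP[] := f01 n y.
Qed.

Section markov_property.
Context (R : realType) (E : ptopologicalType) (T : R).
Hypotheses (polishE : polish_space R E) (T0 : 0 < T).
Local Notation Om := (Omega E T).
Local Notation F := (@filtration R E T).
Context (P : R -> R -> R.-pker (borel E) ~> (borel E)).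
Context (PP : R -> borel E -> probability Om R).
Hypothesis markovPP : canonical_markov_class P PP.

Lemma markov_marginal s t x (phi : borel E -> \bar R) :
  0 <= s <= T -> 0 <= t <= T -> measurable_fun setT phi -> (forall y, 0 <= phi y)%E ->
  (\int[P s t x]_y phi y = \int[PP s x]_w phi (X t w))%E.
Proof.
move=> sI tI mphi phi0.
have mX := @measurable_X R E T t tI.
etransitivity; last first.
  have := ge0_integral_pushforward mX (PP s x) measurableT mphi.
  by rewrite preimage_setT; apply => y _; exact: phi0.
apply: eq_measure_integral => A mA _.
by rewrite -[LHS](markovPP.1 s x t A).
Qed.

(* Measurability in time is only assumed in the first time variable of [P];
   in the second one it comes from the right-continuity of paths. *)
Lemma measurable_transition t (A : set (borel E)) : 0 <= t <= T -> measurable A ->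
  measurable_fun setT (fun z : measurableTypeR R * borel E => P t (clamp t T z.1) z.2 A).
Proof.
move=> tI mA; have /andP[t0 tT] := tI.
have cI q : 0 <= clamp t T q <= T.
  by have /andP[h1 h2] := clamp_itv q tT; rewrite (le_trans t0 h1) h2.
(* Open sets are stable under intersection and generate the Borel sets. For them the indicator is
   approximated by continuous functions, which can use the continuity of paths. *)
apply: (@dynkin_induction _ (borel E) (@open E) (fun A : set (borel E) =>
  measurable_fun setT (fun z : measurableTypeR R * borel E => P t (clamp t T z.1) z.2 A))) => //.
- exact: openI.
- rewrite (_ : (fun _ => _) = cst 1%E)//; apply/funext => z /=.
  exact: prob_kernel.
- move=> U oU; have [phi [cphi phi01 phiU]] := polish_indic_approx polishE oU.
  have mphi k := continuous_borel_measurable (cphi k).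
  have dI n q : 0 <= disc_time t T n (disc_index t T n q) <= T.
    by have /andP[h1 ->] := disc_time_itv tT n (disc_index t T n q); rewrite (le_trans t0 h1).
  have mU : measurable (U : set (borel E)) by exact: sub_sigma_algebra.
  have mk k : measurable_fun setT (fun z : measurableTypeR R * borel E =>
      (\int[P t (clamp t T z.1) z.2]_y (phi k y)%:E)%E).
    (* For a continuous [phi k], the integral is the mean of [phi k (X r)] under [PP t y],
       right-continuous in [r]: it is the limit of its values at discretized times, for which each
       [P t r] is a kernel. *)
    apply: (@emeasurable_fun_cvg _ _ _ _ (fun n (z : measurableTypeR R * borel E) =>
      (\int[P t (disc_time t T n (disc_index t T n z.1)) z.2]_y (phi k y)%:E)%E)).
      move=> n; apply: (measurable_time_discretized (g := disc_index t T n)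
        (f := fun j (y : borel E) => (\int[P t (disc_time t T n j) y]_y' (phi k y')%:E)%E)).
        by move=> j; exact: measurable_disc_index.
      move=> j; apply: measurable_fun_integral_kernel.
      + by move=> B mB; exact: measurable_kernel.
      + by move=> y; rewrite lee_fin; have /andP[] := phi01 k y.
      + by apply/measurable_EFinP; exact: mphi.
    move=> [q y] _ /=.
    have e r : 0 <= r <= T -> (\int[P t r y]_y' (phi k y')%:E = \int[PP t y]_w (phi k (X r w))%:E)%E.
      move=> rI; apply: (@markov_marginal t r y (fun y => (phi k y)%:E)) => //.
        by apply/measurable_EFinP; exact: mphi.
      by move=> y'; rewrite lee_fin; have /andP[] := phi01 k y'.
    rewrite e//; under eq_fun do rewrite e//.
    apply: (@integral_bounded_cvg _ _ _ (PP t y) (fun n w => phi k (X (disc_time t T n (disc_index t T n q)) w))).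
    + by rewrite -[(_ : measure _ _) _]/(PP t y setT) probability_setT ltry.
    + by move=> n; exact: measurableT_comp (mphi k) (measurable_X (dI n q)).
    + by move=> n w; exact: phi01.
    + move=> w.
      have Xc : (fun n => X (disc_time t T n (disc_index t T n q)) w : E) @ \oo --> (X (clamp t T q) w : E).
        apply: X_right_cvg => //; last exact: disc_time_cvg.
        by move=> n; rewrite disc_time_ge//=; have /andP[_ ->] := dI n q.
      exact: (cvg_comp _ _ Xc (cphi k _)).
  apply: (emeasurable_fun_cvg _ _ mk) => -[q y] _ /=.
  have -> : P t (clamp t T q) y U = (\int[P t (clamp t T q) y]_y' (\1_U y' : R)%:E)%E.
    by rewrite integral_indic// setIT.
  by apply: integral_bounded_cvg => //; rewrite prob_kernel ltry.
- move=> S mS mfS.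
  rewrite (_ : (fun _ => _) = fun z : measurableTypeR R * borel E => (1 - P t (clamp t T z.1) z.2 S)%E).
    by apply: emeasurable_funB.
  apply/funext => z /=; have p1 := @prob_kernel _ _ _ _ _ (P t (clamp t T z.1)) z.2.
  rewrite -setTD measureD ?setTI//; last by rewrite [X in (X < _)%E]p1 ltry.
  by rewrite [X in (X - _)%E]p1.
- move=> G mG tG mfG.
  rewrite (_ : (fun _ => _) = fun z : measurableTypeR R * borel E => (\sum_(0 <= i <oo) P t (clamp t T z.1) z.2 (G i))%E).
    by apply: ge0_emeasurable_sum.
  by apply/funext => z; apply: measure_semi_bigcup => //; exact: bigcupT_measurable.
Qed.

(** The Markov property, known for indicators, passes to nonnegative Borel functions through
    [ge0_measurable_ind]. *)
Lemma markov_transition s x t r (phi : borel E -> \bar R) (B : set Om) :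
  0 <= s -> s <= t -> t <= r -> r <= T -> filtration t B ->
  measurable_fun setT phi -> (forall y, 0 <= phi y)%E ->
  (\int[PP s x]_(w in B) phi (X r w) = \int[PP s x]_(w in B) \int[P t r (X t w)]_y phi y)%E.
Proof.
move=> s0 st tr rT FB mphi phi0.
have tI : 0 <= t <= T by rewrite (le_trans s0 st) (le_trans tr rT).
have rI : 0 <= r <= T by rewrite rT andbT; have /andP[t0 _] := tI; exact: le_trans tr.
have mB : measurable B.
  by have [_] := @sub_sigma_filtration R E T t (le_trans tr rT); apply.
have mXr := @measurable_X R E T r rI.
have mXt := @measurable_X R E T t tI.
have mK f : measurable_fun setT f -> (forall y, 0 <= f y)%E ->
    measurable_fun setT (fun w : Om => \int[P t r (X t w)]_y f y)%E.
  move=> mf f0; have mi : measurable_fun setT (fun y : borel E => \int[P t r y]_y' f y')%E.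
    by apply: measurable_fun_integral_kernel => // A mA; exact: measurable_kernel.
  exact: measurableT_comp mi mXt.
have mX f : measurable_fun setT f -> measurable_fun setT (fun w : Om => f (X r w) : \bar R).
  by move=> mf; exact: measurableT_comp mf mXr.
have K0 f : (forall y, 0 <= f y)%E -> forall w : Om, (0 <= \int[P t r (X t w)]_y f y)%E.
  by move=> f0 w; apply: integral_ge0.
pose H (phi : borel E -> \bar R) :=
  (\int[PP s x]_(w in B) phi (X r w) = \int[PP s x]_(w in B) \int[P t r (X t w)]_y phi y)%E.
apply: (ge0_measurable_ind (H := H)) mphi phi0; rewrite /H.
- move=> A mA; have [_ <-//] := markovPP.2 s x t r A s0 st tr rT mA.
  by apply: eq_integral => w _; rewrite integral_indic// setIT.
- move=> k f k0 mf f0 Hf.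
  have z1 := @ge0_integralZl_EFin _ _ _ (PP s x) B mB (fun w => f (X r w))
    (fun w _ => f0 _) (measurable_funTS (mX f mf)) k k0.
  have z2 := @ge0_integralZl_EFin _ _ _ (PP s x) B mB (fun w => \int[P t r (X t w)]_y f y)%E
    (fun w _ => K0 f f0 w) (measurable_funTS (mK f mf f0)) k k0.
  rewrite z1 Hf -z2.
  apply: eq_integral => w _; exact/esym/(@ge0_integralZl_EFin _ _ _ (P t r (X t w)) setT measurableT f (fun y _ => f0 y) mf k k0).
- move=> f g mf mg f0 g0 Hf Hg.
  have z1 := @ge0_integralD _ _ _ (PP s x) B mB (fun w => f (X r w)) (fun w => g (X r w))
    (fun w _ => f0 _) (measurable_funTS (mX f mf)) (fun w _ => g0 _) (measurable_funTS (mX g mg)).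
  have z2 := @ge0_integralD _ _ _ (PP s x) B mB (fun w => \int[P t r (X t w)]_y f y)%E
    (fun w => \int[P t r (X t w)]_y g y)%E
    (fun w _ => K0 f f0 w) (measurable_funTS (mK f mf f0))
    (fun w _ => K0 g g0 w) (measurable_funTS (mK g mg g0)).
  rewrite z1 Hf Hg -z2.
  apply: eq_integral => w _; apply/esym.
  exact: (@ge0_integralD _ _ _ (P t r (X t w)) setT measurableT f g (fun y _ => f0 y) mf (fun y _ => g0 y) mg).
- move=> f_ f mf_ f_0 ndf f_f Hn.
  have cvg1 := @cvg_monotone_convergence _ _ _ (PP s x) B mB (fun n w => f_ n (X r w)).
  have cvg2 := @cvg_monotone_convergence _ _ _ (PP s x) B mB (fun n w => \int[P t r (X t w)]_y f_ n y)%E.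
  have e1 : (\int[PP s x]_(w in B) f (X r w) = \int[PP s x]_(w in B) (limn (fun n => f_ n (X r w))))%E.
    by apply: eq_integral => w _; apply/esym/cvg_lim => //; exact: f_f.
  have e2 : (\int[PP s x]_(w in B) \int[P t r (X t w)]_y f y =
     \int[PP s x]_(w in B) limn (fun n => \int[P t r (X t w)]_y f_ n y))%E.
    apply: eq_integral => w _; apply/esym/cvg_lim => //.
    have := @cvg_monotone_convergence _ _ _ (P t r (X t w)) setT measurableT f_ (fun n => mf_ n) (fun n y _ => f_0 n y) (fun y _ => ndf y).
    by congr (_ --> _); apply: eq_integral => y _; apply/cvg_lim => //; exact: f_f.
  have c1 := cvg1 (fun n => measurable_funTS (mX _ (mf_ n))) (fun n w _ => f_0 n _) (fun w _ => ndf _).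
  have c2 : (fun n => \int[PP s x]_(w in B) \int[P t r (X t w)]_y f_ n y)%E @ \oo -->
      (\int[PP s x]_(w in B) limn (fun n => \int[P t r (X t w)]_y f_ n y))%E.
    apply: cvg2.
    + by move=> n; exact: measurable_funTS (mK _ (mf_ n) (f_0 n)).
    + by move=> n w _; exact: integral_ge0.
    + by move=> w _ m n mn; apply: ge0_le_integral => // y _; exact: ndf.
  have eqs : (fun n => \int[PP s x]_(w in B) f_ n (X r w))%E =
    (fun n => \int[PP s x]_(w in B) \int[P t r (X t w)]_y f_ n y)%E by exact/funext.
  by rewrite e1 e2; rewrite eqs in c1; exact: cvg_unique c1 c2.
Qed.

End markov_property.

Lemma fubini_tonelli_in d1 d2 (W : measurableType d1) (Z : measurableType d2) (R : realType)
  (P : probability W R) (m : {finite_measure set Z -> \bar R}) (B : set W) (f : Z * W -> \bar R) :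
  measurable B -> measurable_fun setT f -> (forall z, 0 <= f z)%E ->
  (\int[P]_(w in B) \int[m]_r f (r, w) = \int[m]_r \int[P]_(w in B) f (r, w))%E.
Proof.
move=> mB mf f0.
have mi : measurable_fun setT (fun z : Z * W => (\1_B z.2 : R)%:E).
  apply/measurable_EFinP; apply: measurableT_comp measurable_snd.
  exact: measurable_indic.
have i0 w : (0 <= (\1_B w : R)%:E)%E by rewrite lee_fin.
have mr (w : W) : measurable_fun setT (fun r => f (r, w)) by apply: measurableT_comp mf _; exact: measurable_pair2.
have E (g : W -> \bar R) : (forall w, 0 <= g w)%E -> (\int[P]_(w in B) g w = \int[P]_w ((\1_B w : R)%:E * g w))%E.
  move=> g0; rewrite integral_mkcond; apply: eq_integral => w _; rewrite patchE indicE.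
  by case: (w \in B); rewrite ?mul1e ?mul0e.
rewrite E; last by move=> w; exact: integral_ge0.
rewrite (eq_integral (fun w => \int[m]_r ((\1_B w : R)%:E * f (r, w)))%E); last first.
  by move=> w _; rewrite ge0_integralZl.
rewrite -(fubini_tonelli (fun z : Z * W => (\1_B z.2 : R)%:E * f z)%E).
- by apply: eq_integral => r _; rewrite E.
- exact: emeasurable_funM.
- by move=> z; rewrite mule_ge0.
Qed.

Section markov_time_integral.
Context (R : realType) (E : ptopologicalType) (T : R).
Hypotheses (polishE : polish_space R E) (T0 : 0 < T).
Local Notation Om := (Omega E T).
Local Notation F := (@filtration R E T).
Context (P : R -> R -> R.-pker (borel E) ~> (borel E)).
Context (PP : R -> borel E -> probability Om R).
Hypothesis markovPP : canonical_markov_class P PP.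
Context (m : {finite_measure set (measurableTypeR R) -> \bar R}).

Section nonneg.
Variable G : measurableTypeR R * borel E -> R.
Hypotheses (mG : borel_fun T G) (G0 : forall z, 0 <= G z).

(** Extends [G] from [[t, T]] to all times by clamping and then kills it outside the interval, so
    that the Tonelli theorems apply on full products. *)
Let cut t (z : measurableTypeR R * borel E) : \bar R :=
  (\1_`[t, T] z.1 * G (clamp t T z.1, z.2))%:E.

Let cut0 t z : (0 <= cut t z)%E.
Proof. by rewrite lee_fin mulr_ge0. Qed.

Let mcut t : 0 <= t -> t <= T -> measurable_fun setT (cut t).
Proof.
move=> t0 tT; apply/measurable_EFinP; apply: measurable_funM.
  apply: measurableT_comp measurable_fst; apply: measurable_indic; exact: measurable_itv.
apply: (@measurable_comp _ _ _ _ _ _ (time_dom T) G _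
  (fun z : measurableTypeR R * borel E => (clamp t T z.1, z.2))) => //.
- exact: measurable_time_dom.
- move=> _ [z _ <-]; rewrite /time_dom/=.
  by have /andP[h1 ->] := clamp_itv z.1 tT; rewrite (le_trans t0 h1).
apply: measurable_fun_pair; last exact: measurable_snd.
exact: measurableT_comp (measurable_clamp t T) measurable_fst.
Qed.

Let cutP t y : (\int[m]_(r in `[t, T]) \int[P t r y]_y' (G (r, y'))%:E =
  \int[m]_r \int[P t (clamp t T r) y]_y' cut t (r, y'))%E.
Proof.
rewrite integral_mkcond; apply: eq_integral => r _; rewrite patchE /cut /=.
case: ifPn => [/set_mem/= rI|/negP rI]; last first.
  by apply/esym/integral0_eq => y' _; rewrite indicE memNset ?mul0r// => h; apply: rI; exact: mem_set.
have -> : clamp t T r = r by apply: clamp_id; move: rI; rewrite ?in_itv.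
by apply: eq_integral => y' _; rewrite indicE mem_set ?mul1r.
Qed.

Let cutX t (w : Om) : (\int[m]_(r in `[t, T]) (G (r, X r w))%:E =
  \int[m]_r cut t (r, X (clamp t T r) w))%E.
Proof.
rewrite integral_mkcond; apply: eq_integral => r _; rewrite patchE /cut /=.
case: ifPn => [/set_mem/= rI|/negP rI]; last first.
  by rewrite indicE memNset ?mul0r// => h; apply: rI; exact: mem_set.
have -> : clamp t T r = r by apply: clamp_id; move: rI; rewrite ?in_itv.
by rewrite indicE mem_set ?mul1r.
Qed.

Let mcutX t : 0 <= t -> t <= T ->
  measurable_fun setT (fun z : measurableTypeR R * Om => cut t (z.1, X (clamp t T z.1) z.2)).
Proof.
move=> t0 tT; apply/measurable_EFinP; rewrite /cut /=.
apply: measurable_funM.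
  apply: measurableT_comp measurable_fst; apply: measurable_indic; exact: measurable_itv.
have sF u : t <= u <= T -> sub_sigma (F u).
  by move=> /andP[_ uT]; exact: sub_sigma_filtration.
have pG := prog_borel_fun polishE t0 tT mG.
exact: (prog_joint tT sF pG).
Qed.

Lemma measurable_path_integral t : 0 <= t -> t <= T -> measurable_fun setT
  (fun w : Om => \int[m]_(r in `[t, T]) (G (r, X r w))%:E)%E.
Proof.
move=> t0 tT; under eq_fun do rewrite cutX.
apply: (measurable_fun_fubini_tonelli_G (m1 := m) (fun z : measurableTypeR R * Om =>
  cut t (z.1, X (clamp t T z.1) z.2))); first exact: mcutX.
by move=> z; exact: cut0.
Qed.

Lemma measurable_path (w : Om) t : 0 <= t -> t <= T -> measurable_fun `[t, T]
  (fun r : measurableTypeR R => (G (r, X r w))%:E).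
Proof.
move=> t0 tT; apply: (eq_measurable_fun (fun r : measurableTypeR R => cut t (r, X (clamp t T r) w))).
  move=> r /set_mem/= rI; rewrite /cut/= (@clamp_id _ t T r); last by move: rI; rewrite ?in_itv.
  by rewrite indicE mem_set ?mul1r.
apply: measurable_funTS; exact: measurableT_comp (mcutX t0 tT) (measurable_pair2 w).
Qed.

Let mcutP t : 0 <= t -> t <= T -> measurable_fun setT
  (fun z : measurableTypeR R * borel E => \int[P t (clamp t T z.1) z.2]_y' cut t (z.1, y'))%E.
Proof.
move=> t0 tT.
apply: (@measurable_integral_family _ _ (measurableTypeR R * borel E)%type (borel E) R
  (fun z => P t (clamp t T z.1) z.2) _ _
  (fun z : measurableTypeR R * borel E * borel E => cut t (z.1.1, z.2))).
- by move=> z; rewrite prob_kernel.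
- by move=> A mA; apply: (measurable_transition polishE markovPP) mA; rewrite t0.
- by move=> z; exact: cut0.
- apply: measurableT_comp (mcut t0 tT) _; apply: measurable_fun_pair; last exact: measurable_snd.
  exact: measurableT_comp measurable_fst measurable_fst.
Qed.

Lemma measurable_transition_integral t : 0 <= t -> t <= T -> measurable_fun setT
  (fun y : borel E => \int[m]_(r in `[t, T]) \int[P t r y]_y' (G (r, y'))%:E)%E.
Proof.
move=> t0 tT; under eq_fun do rewrite cutP.
apply: (measurable_fun_fubini_tonelli_G (m1 := m) (fun z : measurableTypeR R * borel E =>
  \int[P t (clamp t T z.1) z.2]_y' cut t (z.1, y'))%E); first exact: mcutP.
by move=> z; apply: integral_ge0.
Qed.

Lemma measurable_transition_time t y : 0 <= t -> t <= T -> measurable_fun `[t, T]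
  (fun r : measurableTypeR R => \int[P t r y]_y' (G (r, y'))%:E)%E.
Proof.
move=> t0 tT; apply: (eq_measurable_fun (fun r : measurableTypeR R =>
  \int[P t (clamp t T r) y]_y' cut t (r, y'))%E).
  move=> r /set_mem/= rI; rewrite (@clamp_id _ t T r); last by move: rI; rewrite ?in_itv.
  apply: eq_integral => y' _; rewrite /cut/= (@clamp_id _ t T r); last by move: rI; rewrite ?in_itv.
  by rewrite indicE mem_set ?mul1r.
apply: measurable_funTS; exact: measurableT_comp (mcutP t0 tT) (measurable_pair2 y).
Qed.

Lemma markov_start_integral t y : 0 <= t -> t <= T ->
  (\int[m]_(r in `[t, T]) \int[P t r y]_y' (G (r, y'))%:E =
   \int[PP t y]_w \int[m]_(r in `[t, T]) (G (r, X r w))%:E)%E.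
Proof.
move=> t0 tT; rewrite cutP; under [RHS]eq_integral do rewrite cutX.
rewrite (fubini_tonelli_in (PP t y) m measurableT (mcutX t0 tT)) => [|z]; last exact: cut0.
have cI r : 0 <= clamp t T r <= T.
  by have /andP[h1 ->] := clamp_itv r tT; rewrite (le_trans t0 h1).
apply: eq_integral => r _.
apply: (@markov_marginal R E T P PP markovPP t _ y (fun y' => cut t (r, y'))) => //.
- by rewrite t0.
- exact: measurableT_comp (mcut t0 tT) (measurable_pair1 _).
Qed.

(** Tonelli brings the time integral outside, where the Markov property is applied at each time [r]
    separately. *)
Lemma markov_transition_integral s x t (B : set Om) : 0 <= s -> s <= t -> t <= T -> F t B ->
  (\int[PP s x]_(w in B) \int[m]_(r in `[t, T]) \int[P t r (X t w)]_y (G (r, y))%:E =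
   \int[PP s x]_(w in B) \int[m]_(r in `[t, T]) (G (r, X r w))%:E)%E.
Proof.
move=> s0 st tT FB; have t0 := le_trans s0 st.
have mB : measurable B by have [_] := @sub_sigma_filtration R E T t tT; apply.
have tI : 0 <= t <= T by rewrite t0.
have mXt := @measurable_X R E T t tI.
under eq_integral do rewrite cutP; under [RHS]eq_integral do rewrite cutX.
rewrite (fubini_tonelli_in (PP s x) m mB (mcutX t0 tT)) => [|z]; last exact: cut0.
have mK : measurable_fun setT (fun z : measurableTypeR R * Om =>
  \int[P t (clamp t T z.1) (X t z.2)]_y' cut t (z.1, y'))%E.
  apply: (measurableT_comp (mcutP t0 tT) (g := fun z : measurableTypeR R * Om => (z.1, X t z.2 : borel E))).
  apply: measurable_fun_pair; first exact: measurable_fst.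
  exact: measurableT_comp mXt measurable_snd.
rewrite (fubini_tonelli_in (PP s x) m mB mK) => [|z]; last exact: integral_ge0.
apply: eq_integral => r _; have /andP[h1 h2] := clamp_itv r tT.
have mc : measurable_fun setT (fun y' : borel E => cut t (r, y')).
  exact: measurableT_comp (mcut t0 tT) (measurable_pair1 _).
have e := @markov_transition R E T P PP markovPP s x t (clamp t T r) (fun y' => cut t (r, y')) B
  s0 st h1 h2 FB mc (fun y' => cut0 t (r, y')).
exact: (esym e).
Qed.

End nonneg.

End markov_time_integral.

Section conditional_fine.
Context d (W : measurableType d) (R : realType) (P : probability W R).

Lemma fine_cond_exp (f : W -> \bar R) (g : W -> R) (B : set W) :
  measurable_fun setT f -> (forall w, 0 <= f w < +oo)%E -> intg P g -> measurable B ->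
  (\int[P]_w f w = \int[P]_w (g w)%:E)%E ->
  (\int[P]_(w in B) f w = \int[P]_(w in B) (g w)%:E)%E ->
  intg P (fun w => fine (f w)) /\ \int[P]_w (\1_B w * fine (f w)) = \int[P]_w (\1_B w * g w).
Proof.
move=> mf f0 ig mB eT eB.
have ff w : f w = (fine (f w))%:E by rewrite fineK// ge0_fin_numE; have /andP[] := f0 w.
split.
  apply/intgP; split; first exact: measurableT_comp.
  rewrite (eq_integral f); last first.
    move=> w _; have /andP[f0w _] := f0 w; by rewrite [RHS]ff ger0_norm ?fine_ge0.
  rewrite eT; have /integrable_fin_num : P.-integrable setT (EFin \o g) by exact: ig.
  by rewrite fin_numElt => /(_ measurableT)/andP[].
rewrite /Rintegral; congr fine.
have E (k : W -> R) : (\int[P]_w (\1_B w * k w)%:E = \int[P]_(w in B) (k w)%:E)%E.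
  rewrite [RHS]integral_mkcond; apply: eq_integral => w _; rewrite patchE indicE.
  by case: (w \in B); rewrite ?mul1r ?mul0r.
by rewrite !E -eB; apply: eq_integral => w _; rewrite -ff.
Qed.

End conditional_fine.

(** * Martingales from a terminal value and a running cost *)

Section ip_representation.
Context (R : realType) (E : ptopologicalType) (T : R).
Hypotheses (polishE : polish_space R E) (T0 : 0 < T).
Local Notation Om := (Omega E T).
Local Notation F := (@filtration R E T).
Context (P : R -> R -> R.-pker (borel E) ~> (borel E)).
Context (PP : R -> borel E -> probability Om R).
Hypothesis markovPP : canonical_markov_class P PP.
Context (m : {finite_measure set (measurableTypeR R) -> \bar R}).
Hypothesis atomless : forall q : R, m [set q] = 0%E.

Variables (s : R) (x : borel E).
Hypotheses (s0 : 0 <= s) (sT : s <= T).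

Section terminal.
Variable h : borel E -> R.
Hypotheses (mh : measurable_fun setT h) (h0 : forall y, 0 <= h y).
Hypothesis hi : forall t y, s <= t <= T -> (\int[PP t y]_w (h (X T w))%:E < +oo)%E.

Let TI : 0 <= T <= T. Proof. by apply/andP; split => //; exact: ltW. Qed.

Let mhX : measurable_fun setT (fun w : Om => h (X T w)).
Proof. have mX := @measurable_X R E T T TI; exact: measurableT_comp mh mX. Qed.

Let mhE : measurable_fun setT (fun y => (h y)%:E). Proof. exact/measurable_EFinP. Qed.

Let hE0 y : (0 <= (h y)%:E)%E. Proof. by rewrite lee_fin. Qed.

(** Finiteness at every point [y], not only in mean, keeps [fine] faithful when [y] is replaced by
    the random state [X t]. *)
Lemma transition_finite t y : s <= t <= T -> (0 <= \int[P t T y]_y' (h y')%:E < +oo)%E.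
Proof.
move=> /andP[st tT]; rewrite integral_ge0//=.
rewrite (@markov_marginal R E T P PP markovPP t T y (fun y => (h y)%:E))//.
  by apply: hi; rewrite st.
by rewrite tT (le_trans s0 st).
Qed.

Lemma terminal_intg : intg (PP s x) (fun w => h (X T w)).
Proof.
apply/intgP; split; first exact: mhX.
rewrite (eq_integral (fun w => (h (X T w))%:E)); last by move=> w _; rewrite ger0_norm.
by apply: hi; rewrite lexx.
Qed.

Lemma terminal_cond t B : s <= t <= T -> F t B ->
  intg (PP s x) (fun w => fine (\int[P t T (X t w)]_y (h y)%:E)%E) /\
  \int[PP s x]_w (\1_B w * fine (\int[P t T (X t w)]_y (h y)%:E)%E) =
  \int[PP s x]_w (\1_B w * h (X T w)).
Proof.
move=> tI FB; have /andP[st tT] := tI; have tI0 : 0 <= t <= T by rewrite (le_trans s0 st).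
have [sa FF] := @sub_sigma_filtration R E T t tT.
have mXt := @measurable_X R E T t tI0.
have e C : F t C -> (\int[PP s x]_(w in C) \int[P t T (X t w)]_y (h y)%:E =
    \int[PP s x]_(w in C) (h (X T w))%:E)%E.
  move=> FC; exact/esym/(@markov_transition R E T P PP markovPP s x t T (fun y => (h y)%:E) C s0 st tT (lexx _) FC).
have mk : measurable_fun setT (fun y : borel E => \int[P t T y]_y' (h y')%:E)%E.
  by apply: measurable_fun_integral_kernel => // A mA; exact: measurable_kernel.
apply: (fine_cond_exp (f := fun w => (\int[P t T (X t w)]_y (h y)%:E)%E)
  (g := fun w => h (X T w))).
- exact: measurableT_comp mk mXt.
- by move=> w; exact: transition_finite.
- exact: terminal_intg.
- exact: FF.
- by apply: e; have [F0 FC _] := sa; rewrite -(setD0 setT); exact: FC.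
- exact: e.
Qed.

End terminal.

Hypothesis msupp : m (~` `]s, T]%classic) = 0%E.

Lemma msupp_integral (f g : R -> \bar R) : (forall r, s <= r <= T -> f r = g r) ->
  (\int[m]_r f r = \int[m]_(r in `[s, T]) g r)%E.
Proof.
move=> fg; rewrite [RHS]integral_mkcond; apply: integral_ae_congr.
exists (~` `]s, T]%classic); split => //.
  by apply: measurableC; exact: measurable_itv.
move=> r /=; rewrite patchE => nfg rI; apply: nfg.
have rI' : s <= r <= T by move: rI; rewrite /= ?in_itv/= => /andP[/ltW -> ->].
by rewrite mem_set ?fg//= ?in_itv.
Qed.

Let sF t : s <= t <= T -> sub_sigma (F t).
Proof. by move=> /andP[_ tT]; exact: sub_sigma_filtration. Qed.

Section running.
Variable G : measurableTypeR R * borel E -> R.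
Hypotheses (mG : borel_fun T G) (G0 : forall z, 0 <= G z).
Hypothesis Gi : forall t y, s <= t <= T ->
  (\int[PP t y]_w \int[m]_(r in `[t, T]) (G (r, X r w))%:E < +oo)%E.

Let b (q : R) (w : Om) : R := G (q, X q w).

Let pb : prog F s T b. Proof. exact: prog_borel_fun. Qed.

Let Z t w := \int[m]_r (\1_`[t, T] r * b (clamp s T r) w).

Lemma running_pint : pint (PP s x) s T m b.
Proof.
apply: intg_prodP2; first exact: (prog_joint sT sF pb).
apply: le_lt_trans (Gi x (_ : s <= s <= T)); last by rewrite lexx.
rewrite le_eqVlt; apply/orP; left; apply/eqP; apply: eq_integral => w _ /=.
by apply: msupp_integral => r rI; rewrite ger0_norm ?clamp_id// /b; exact: G0.
Qed.

Let Zintg t : s <= t <= T -> intg (m \x PP s x)%E (fun z => \1_`[t, T] z.1 * b (clamp s T z.1) z.2).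
Proof.
move=> tI; apply: (@intg_le _ _ _ (m \x PP s x)%E _ (fun z : measurableTypeR R * Om => b (clamp s T z.1) z.2)).
- apply: measurable_funM; last exact: (intg_meas running_pint).
  apply: measurableT_comp measurable_fst; apply: measurable_indic; exact: measurable_itv.
- move=> z; rewrite normrM ler_piMl// ger0_norm// indicE; by case: (_ \in _).
- exact: running_pint.
Qed.

Lemma running_finite t y : s <= t <= T ->
  (0 <= \int[m]_(r in `[t, T]) \int[P t r y]_y' (G (r, y'))%:E < +oo)%E.
Proof.
move=> /andP[st tT]; apply/andP; split.
  by apply: integral_ge0 => r _; apply: integral_ge0 => y' _; rewrite lee_fin.
rewrite (markov_start_integral polishE markovPP m mG G0 y (le_trans s0 st) tT).
by apply: Gi; rewrite st.
Qed.

Lemma running_cond t B : s <= t <= T -> F t B ->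
  [/\ intg (PP s x) (fun w => fine (\int[m]_(r in `[t, T]) \int[P t r (X t w)]_y (G (r, y))%:E)%E),
   intg (PP s x) (Z t) &
  \int[PP s x]_w (\1_B w * fine (\int[m]_(r in `[t, T]) \int[P t r (X t w)]_y (G (r, y))%:E)%E) =
  \int[PP s x]_w (\1_B w * Z t w)].
Proof.
move=> tI FB; have /andP[st tT] := tI; have t0 := le_trans s0 st.
have tI0 : 0 <= t <= T by rewrite t0.
have [sa FF] := @sub_sigma_filtration R E T t tT.
have mXt := @measurable_X R E T t tI0.
have iZ : intg (PP s x) (Z t) by exact: (intg_Rint2 (Zintg tI)).
have e C : F t C -> (\int[PP s x]_(w in C) \int[m]_(r in `[t, T]) \int[P t r (X t w)]_y (G (r, y))%:E =
    \int[PP s x]_(w in C) (Z t w)%:E)%E.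
  move=> FC.
  rewrite (markov_transition_integral polishE markovPP m mG G0 x s0 st tT FC).
  apply: integral_ae_congr_in; first by rewrite !setDv setU0; exact: negligible_set0.
  apply: filterS (intg_sect2 (Zintg tI)) => w /= iw; rewrite (Rint_EFin iw).
  rewrite [LHS]integral_mkcond; apply: eq_integral => r _; rewrite patchE indicE.
  case: ifPn => [/set_mem/= rI|_]; last by rewrite mul0r.
  rewrite mul1r /b clamp_id//; move: rI; rewrite ?in_itv/= => /andP[h1 ->].
  by rewrite (le_trans st h1).
have mk := measurable_transition_integral polishE markovPP m mG G0 t0 tT.
have FT : F t setT by have [F0 FC _] := sa; rewrite -(setD0 setT); exact: FC.
have [] := @fine_cond_exp _ Om R (PP s x)
  (fun w => (\int[m]_(r in `[t, T]) \int[P t r (X t w)]_y (G (r, y))%:E)%E) (Z t) B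
  (measurableT_comp mk mXt) (fun w => running_finite _ tI) iZ (FF _ FB) (e _ FT) (e _ FB).
by split.
Qed.

End running.

End ip_representation.

(** Bookkeeping for [ip_rmart]: [a1], [a2] stand for the conditional expectations of the positive
    and negative parts [h1], [h2] of the terminal value, [c1], [c2] for those of the remaining costs
    [z1], [z2], and [i1], [i2] for the accumulated costs at [t] and at [T]. *)
Lemma cond_exp_combine d (W : measurableType d) (R : realType) (P : probability W R) (B : set W)
  (a1 a2 c1 c2 h1 h2 z1 z2 i1 i2 q h : W -> R) : measurable B ->
  intg P a1 -> intg P a2 -> intg P c1 -> intg P c2 -> intg P h1 -> intg P h2 ->
  intg P z1 -> intg P z2 -> intg P i1 -> intg P i2 ->
  let J f := \int[P]_w (\1_B w * f w) in
  J a1 = J h1 -> J a2 = J h2 -> J c1 = J z1 -> J c2 = J z2 ->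
  {ae P, forall w, z1 w - z2 w = i2 w - i1 w} ->
  (forall w, q w = (a1 w - a2 w) + (c1 w - c2 w)) -> (forall w, h w = h1 w - h2 w) ->
  intg P q /\ J (fun w => q w + i1 w) = J (fun w => h w + i2 w).
Proof.
move=> mB ia1 ia2 ic1 ic2 ih1 ih2 iz1 iz2 ii1 ii2 J ea1 ea2 ec1 ec2 zE qE hE.
have {qE} -> : q = (fun w => (a1 w - a2 w) + (c1 w - c2 w)) by exact/funext.
have {hE} -> : h = (fun w => h1 w - h2 w) by exact/funext.
have JD f g : intg P f -> intg P g -> J (fun w => f w + g w) = J f + J g.
  move=> fi gi; rewrite /J -RintD; [|exact: intg_indic|exact: intg_indic].
  by congr Rintegral; apply/funext => w; rewrite mulrDr.
have JB f g : intg P f -> intg P g -> J (fun w => f w - g w) = J f - J g.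
  move=> fi gi; rewrite /J -RintB; [|exact: intg_indic|exact: intg_indic].
  by congr Rintegral; apply/funext => w; rewrite mulrBr.
have i12 := intgB ia1 ia2; have i34 := intgB ic1 ic2; have iz := intgB iz1 iz2.
split; first exact: intgD.
rewrite (JD _ _ (intgD i12 i34) ii1) (JD _ _ i12 i34) (JB _ _ ia1 ia2) (JB _ _ ic1 ic2).
rewrite (JD _ _ (intgB ih1 ih2) ii2) (JB _ _ ih1 ih2) ea1 ea2 ec1 ec2 -(JB _ _ iz1 iz2).
have -> : J (fun w => z1 w - z2 w) = J (fun w => i2 w - i1 w).
  by apply: Rint_ae; apply: filterS zE => w ->.
by rewrite (JB _ _ ii2 ii1) -addrA subrK.
Qed.

Section ip_martingale.
Context (R : realType) (E : ptopologicalType) (T : R).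
Hypotheses (polishE : polish_space R E) (T0 : 0 < T).
Local Notation Om := (Omega E T).
Local Notation F := (@filtration R E T).
Context (P : R -> R -> R.-pker (borel E) ~> (borel E)).
Hypothesis kernelP : transition_kernel T P.
Context (PP : R -> borel E -> probability Om R).
Hypothesis markovPP : canonical_markov_class P PP.
Context (m : {finite_measure set (measurableTypeR R) -> \bar R}).
Hypothesis atomless : forall q : R, m [set q] = 0%E.
Variables (s : R) (x : borel E).
Hypotheses (s0 : 0 <= s) (sT : s <= T).
Hypothesis msupp : m (~` `]s, T]%classic) = 0%E.

Variables (q phi : measurableTypeR R * borel E -> R) (h : borel E -> R).
Hypotheses (mq : borel_fun T q) (mphi : borel_fun T phi) (mh : measurable_fun setT h).
Hypothesis hi : forall t y, s <= t <= T -> (\int[PP t y]_w `|h (X T w)|%:E < +oo)%E.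
Hypothesis phii : forall t y, s <= t <= T ->
  (\int[PP t y]_w \int[m]_(r in `[t, T]) `|phi (r, X r w)|%:E < +oo)%E.
Hypothesis rep : forall t y, s <= t <= T ->
  (q (t, y))%:E = (transition_op P t T h y +
    \int[m]_(r in `[t, T]) transition_op P t r (fun y' => phi (r, y')) y)%E.

Let b (r : R) (w : Om) : R := phi (r, X r w).

Let pos (u : R) := Num.max u 0.

Let pos0 u : 0 <= pos u. Proof. by rewrite /pos le_max lexx orbT. Qed.

Let pos_le u : pos u <= `|u| /\ pos (- u) <= `|u|.
Proof. by rewrite /pos !ge_max !normr_ge0 !andbT ler_norm -normrN ler_norm. Qed.

Let posB u : u = pos u - pos (- u).
Proof.
rewrite /pos; case: (lerP 0 u) => u0.
  by rewrite (@max_r _ _ (- u)) ?oppr_le0// subr0.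
by rewrite (@max_l _ _ (- u)) ?oppr_ge0 ?ltW// sub0r opprK.
Qed.

Let hp y := pos (h y).
Let hn y := pos (- h y).
Let Gp z := pos (phi z).
Let Gn z := pos (- phi z).

Let mhp : measurable_fun setT hp. Proof. exact: measurable_maxr. Qed.
Let mhn : measurable_fun setT hn.
Proof. by apply: measurable_maxr => //; exact: measurableT_comp. Qed.
Let mGp : borel_fun T Gp. Proof. exact: measurable_maxr. Qed.
Let mGn : borel_fun T Gn.
Proof. by apply: measurable_maxr => //; exact: measurableT_comp. Qed.

Let hle (k : borel E -> R) : (forall y, 0 <= k y <= `|h y|) -> measurable_fun setT k -> forall t y, s <= t <= T ->
  (\int[PP t y]_w (k (X T w))%:E < +oo)%E.
Proof.
move=> k0 mk t y tI; apply: le_lt_trans (hi y tI); apply: ge0_le_integral => //.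
- by move=> w _; rewrite lee_fin; have /andP[] := k0 (X T w).
- apply/measurable_EFinP; apply: measurableT_comp mk _; apply: measurable_X.
  by rewrite lexx (ltW T0).
- apply/measurable_EFinP; apply: measurableT_comp => //; apply: measurableT_comp mh _; apply: measurable_X.
  by rewrite lexx (ltW T0).
- by move=> w _; rewrite lee_fin; have /andP[] := k0 (X T w).
Qed.

Let hpi : forall t y, s <= t <= T -> (\int[PP t y]_w (hp (X T w))%:E < +oo)%E.
Proof. by apply: hle mhp => y; rewrite pos0 (pos_le _).1. Qed.

Let hni : forall t y, s <= t <= T -> (\int[PP t y]_w (hn (X T w))%:E < +oo)%E.
Proof. by apply: hle mhn => y; rewrite pos0 (pos_le _).2. Qed.

Let Gle (k : measurableTypeR R * borel E -> R) : (forall z, 0 <= k z <= `|phi z|) -> borel_fun T k -> forall t y, s <= t <= T ->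
  (\int[PP t y]_w \int[m]_(r in `[t, T]) (k (r, X r w))%:E < +oo)%E.
Proof.
move=> k0 mk t y tI; apply: le_lt_trans (phii y tI).
have /andP[st tT] := tI; have t0 := le_trans s0 st.
have k0' z : 0 <= k z by have /andP[] := k0 z.
have ma : borel_fun T (fun z => `|phi z|) by exact: measurableT_comp.
have mm (g : measurableTypeR R * borel E -> R) : borel_fun T g -> (forall z, 0 <= g z) ->
    measurable_fun setT (fun w : Om => \int[m]_(r in `[t, T]) (g (r, X r w))%:E)%E.
  by move=> mg g0; exact: (measurable_path_integral polishE).
apply: ge0_le_integral => //.
- by move=> w _; apply: integral_ge0 => r _; rewrite lee_fin.
- exact: mm.
- exact: (mm _ ma (fun z => normr_ge0 _)).
- move=> w _; apply: ge0_le_integral => //.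
  + by move=> r _; rewrite lee_fin.
  + exact: (measurable_path polishE mk w t0 tT).
  + exact: (measurable_path polishE ma w t0 tT).
  + by move=> r _; rewrite lee_fin; have /andP[] := k0 (r, X r w).
Qed.

Let Gpi t y : s <= t <= T -> (\int[PP t y]_w \int[m]_(r in `[t, T]) (Gp (r, X r w))%:E < +oo)%E.
Proof. by move=> tI; apply: (Gle _ mGp) => // z; rewrite pos0 (pos_le _).1. Qed.

Let Gni t y : s <= t <= T -> (\int[PP t y]_w \int[m]_(r in `[t, T]) (Gn (r, X r w))%:E < +oo)%E.
Proof. by move=> tI; apply: (Gle _ mGn) => // z; rewrite pos0 (pos_le _).2. Qed.

Let Gai t y : s <= t <= T -> (\int[PP t y]_w \int[m]_(r in `[t, T]) (`|phi (r, X r w)|)%:E < +oo)%E.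
Proof. exact: phii. Qed.

Let transition_opE r t (k : borel E -> R) y : (transition_op P r t k y =
  \int[P r t y]_y' (pos (k y'))%:E - \int[P r t y]_y' (pos (- k y'))%:E)%E.
Proof.
rewrite /transition_op integralE; congr (_ - _)%E; apply: eq_integral => y' _.
  by rewrite funeposE EFin_max.
by rewrite funenegE -EFinN EFin_max.
Qed.

Let A k (t : R) (y : borel E) : R := fine (\int[P t T y]_y' (k y')%:E)%E.
Let C k (t : R) (y : borel E) : R := fine (\int[m]_(r in `[t, T]) \int[P t r y]_y' (k (r, y'))%:E)%E.

(** The Markov lemmas above concern nonnegative functions; the representation is split accordingly
    into four integrals, all finite, so that the subtractions are harmless in the extended reals. *)
Let q_split t y : s <= t <= T -> q (t, y) = (A hp t y - A hn t y) + (C Gp t y - C Gn t y).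
Proof.
move=> tI; have /andP[st tT] := tI; have t0 := le_trans s0 st.
have fin (e : \bar R) : (0 <= e < +oo)%E -> e \is a fin_num.
  by move=> /andP[e0 eo]; rewrite ge0_fin_numE.
have fin4 (a1 a2 a3 a4 : \bar R) : a1 \is a fin_num -> a2 \is a fin_num -> a3 \is a fin_num -> a4 \is a fin_num ->
    (a1 - a2 + (a3 - a4) = ((fine a1 - fine a2) + (fine a3 - fine a4))%R%:E)%E.
  by case: a1 => // ?; case: a2 => // ?; case: a3 => // ?; case: a4.
have f1 := fin _ (transition_finite T0 markovPP s0 mhp (fun y => pos0 _) hpi y tI).
have f2 := fin _ (transition_finite T0 markovPP s0 mhn (fun y => pos0 _) hni y tI).
have c1 := running_finite polishE markovPP s0 mGp (fun y => pos0 _) Gpi y tI.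
have c2 := running_finite polishE markovPP s0 mGn (fun y => pos0 _) Gni y tI.
have f3 := fin _ c1; have f4 := fin _ c2.
suff e : (\int[m]_(r in `[t, T]) transition_op P t r (fun y' => phi (r, y')) y =
  \int[m]_(r in `[t, T]) \int[P t r y]_y' (Gp (r, y'))%:E -
  \int[m]_(r in `[t, T]) \int[P t r y]_y' (Gn (r, y'))%:E)%E.
  apply: EFin_inj; rewrite (rep y tI) e transition_opE.
  have e4 := fin4 _ _ _ _ f1 f2 f3 f4; exact: e4.
rewrite -integralB//.
- by apply: eq_integral => r _; rewrite transition_opE.
- apply/integrableP; split; first exact: (measurable_transition_time polishE markovPP mGp (fun z => pos0 _) y t0 tT).
  rewrite (eq_integral (fun r : measurableTypeR R => \int[P t r y]_y' (Gp (r, y'))%:E)%E).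
    by have /andP[] := c1.
  by move=> r _; rewrite gee0_abs//; apply: integral_ge0 => y' _; rewrite lee_fin pos0.
- apply/integrableP; split; first exact: (measurable_transition_time polishE markovPP mGn (fun z => pos0 _) y t0 tT).
  rewrite (eq_integral (fun r : measurableTypeR R => \int[P t r y]_y' (Gn (r, y'))%:E)%E).
    by have /andP[] := c2.
  by move=> r _; rewrite gee0_abs//; apply: integral_ge0 => y' _; rewrite lee_fin pos0.
Qed.

Let sF t : s <= t <= T -> sub_sigma (F t).
Proof. by move=> /andP[_ tT]; exact: sub_sigma_filtration. Qed.

Let pb : prog F s T b. Proof. exact: prog_borel_fun. Qed.

Lemma path_pint : pint (PP s x) s T m b.
Proof.
have ma : borel_fun T (fun z => `|phi z|) by exact: measurableT_comp.
have := running_pint polishE x s0 sT msupp ma (fun z => normr_ge0 _) Gai.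
apply: intg_le; first exact: (prog_joint sT sF pb).
by move=> z; rewrite normr_id.
Qed.

Let Zdiff t : s <= t <= T -> {ae PP s x, forall w,
  \int[m]_r (\1_`[t, T] r * Gp (clamp s T r, X (clamp s T r) w)) -
  \int[m]_r (\1_`[t, T] r * Gn (clamp s T r, X (clamp s T r) w)) =
  Iint s T m b T w - Iint s T m b t w}.
Proof.
move=> /andP[st tT].
apply: filterS (intg_sect2 path_pint) => w /= iw.
have ind (D : set R) (k : measurableTypeR R -> R) : measurable D -> intg m k -> intg m (fun r => \1_D r * k r).
  by move=> mD ik; exact: intg_indic.
have ip : intg m (fun r : measurableTypeR R => Gp (clamp s T r, X (clamp s T r) w)).
  apply: (fun a c => intg_le a c iw); last by move=> r; rewrite ger0_norm ?pos0//; exact: (pos_le _).1.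
  by apply: measurable_maxr => //; exact: intg_meas iw.
have ig : intg m (fun r : measurableTypeR R => Gn (clamp s T r, X (clamp s T r) w)).
  apply: (fun a c => intg_le a c iw); last by move=> r; rewrite ger0_norm ?pos0//; exact: (pos_le _).2.
  by apply: measurable_maxr => //; apply: measurableT_comp => //; exact: intg_meas iw.
rewrite /Iint -!RintB; do ?[by apply: ind => //; exact: measurable_itv].
apply: Rint_ae; apply: filterS (ae_neq atomless t) => r rt.
rewrite -!mulrBr -(posB (phi _)) -mulrBl -/(b _ _); congr (_ * _).
rewrite !indicE !mem_setE ?in_itv/=.
have [tr|tr] := leP t r => /=.
  have -> : (r <= t) = false by apply/negbTE; rewrite -ltNge lt_neqAle eq_sym tr andbT; exact/eqP.
  by rewrite subr0.
by rewrite (ltW tr) (le_trans (ltW tr) tT) subrr.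
Qed.

(** The process at time [t] is the conditional expectation of the terminal variable
    [h (X T) + Iint b T], which does not depend on [t]; comparing two times amounts to comparing
    each with [T]. *)
Lemma ip_rmart : rmart (PP s x) F s T (fun t w => q (t, X t w) + Iint s T m b t w).
Proof.
have iI t : s <= t <= T -> intg (PP s x) (Iint s T m b t).
  by move=> tI; exact: (Iint_intg t path_pint).
have mB t B : s <= t <= T -> F t B -> measurable B by move=> /sF[_ FF] /FF.
have key t B : s <= t <= T -> F t B -> intg (PP s x) (fun w => q (t, X t w)) /\
    \int[PP s x]_w (\1_B w * (q (t, X t w) + Iint s T m b t w)) =
    \int[PP s x]_w (\1_B w * (h (X T w) + Iint s T m b T w)).
  move=> tI FB.
  have [ia1 ea1] := terminal_cond T0 markovPP x s0 sT mhp (fun y => pos0 _) hpi tI FB.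
  have [ia2 ea2] := terminal_cond T0 markovPP x s0 sT mhn (fun y => pos0 _) hni tI FB.
  have [ic1 iz1 ec1] := running_cond polishE markovPP x s0 sT msupp mGp (fun z => pos0 _) Gpi tI FB.
  have [ic2 iz2 ec2] := running_cond polishE markovPP x s0 sT msupp mGn (fun z => pos0 _) Gni tI FB.
  have it1 := terminal_intg T0 x sT mhp (fun y => pos0 _) hpi.
  have it2 := terminal_intg T0 x sT mhn (fun y => pos0 _) hni.
  have iIt := iI _ tI; have TI : s <= T <= T by rewrite sT lexx.
  have iIT := iI _ TI.
  have qE (w : Om) : q (t, X t w) = (A hp t (X t w) - A hn t (X t w)) +
      (C Gp t (X t w) - C Gn t (X t w)) by exact: q_split tI.
  have hE (w : Om) : h (X T w) = hp (X T w) - hn (X T w) by exact: posB.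
  exact: (cond_exp_combine (mB _ _ tI FB) ia1 ia2 ic1 ic2 it1 it2 iz1 iz2 iIt iIT
    ea1 ea2 ec1 ec2 (Zdiff tI) qE hE).
split.
- move=> t tI; have /andP[st tT] := tI; have t0 := le_trans s0 st.
  have gX : measurable_fun setT (fun w : g_sigma_algebraType (F t) => X t (w : Om) : borel E).
    move=> _ B mB'; rewrite setTI sub_sigmaE; last exact: sF.
    by apply: cylinder_filtration => //; rewrite t0 lexx.
  have gq : measurable_fun setT (fun w : g_sigma_algebraType (F t) => q (t, X t (w : Om))).
    apply: (@measurable_comp _ _ _ _ _ _ (time_dom T) q _
      (fun w : g_sigma_algebraType (F t) => (t, X t (w : Om) : borel E))) => //.
    + exact: measurable_time_dom.
    + by move=> _ [w _ <-]; rewrite /time_dom/= t0.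
    + exact: measurable_fun_pair.
  have gI := Iint_gmeas m pb tI.
  by rewrite /gmeas; apply: measurable_funD gq gI.
- move=> t tI; have FT : F t setT by have [[F0 FC _] _] := sF tI; rewrite -(setD0 setT); exact: FC.
  by apply: intgD (iI t tI); exact: (key t setT tI FT).1.
- move=> r t B sr rt tT FB.
  have tI : s <= t <= T by rewrite tT (le_trans sr rt).
  have rI : s <= r <= T by rewrite sr (le_trans rt tT).
  have FtB : F t B by exact: filtration_mono FB.
  have [_ e1] := key t B tI FtB; have [_ e2] := key r B rI FB.
  exact: (etrans e1 (esym e2)).
Qed.

Lemma ip_terminal y : q (T, y) = h y.
Proof.
have TI : s <= T <= T by rewrite sT lexx.
have T0' : 0 <= T by exact: ltW.
apply: EFin_inj; rewrite (rep y TI).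
have -> : (\int[m]_(r in `[T, T]) transition_op P T r (fun y' => phi (r, y')) y = 0)%E.
  rewrite -[RHS](integral_set0 m (fun=> 0%E)) [LHS]integral_mkcond [RHS]integral_mkcond.
  apply: integral_ae_congr; apply: filterS (ae_neq atomless T) => r rT.
  rewrite !patchE memNset ?memNset//= in_itv/= => /andP[h1 h2].
  by apply: rT; apply/eqP; rewrite eq_le h1 h2.
rewrite adde0 /transition_op.
rewrite (eq_measure_integral (dirac y)); last first.
  by move=> D mD _; apply: kernelP.1 => //; rewrite T0' lexx.
by rewrite integral_dirac// ?diracT ?mul1e//; exact/measurable_EFinP.
Qed.

End ip_martingale.

Section stieltjes_restriction.
Context (R : realType) (V : cumulative R R).
Hypothesis V_continuous : continuous V.

Lemma dStieltjes_ocitv (a b : R) : a <= b -> dStieltjes V `]a, b]%classic = (V b - V a)%:E.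
Proof.
move=> ab; rewrite -(wlength_itv_bnd V false false ab).
exact: (measurable_mu_extE (wlength V) (is_ocitv a b)).
Qed.

Lemma dStieltjes_atomless (q : R) : dStieltjes V [set q] = 0%E.
Proof.
apply/eqP; rewrite eq_le measure_ge0 andbT.
apply/lee_addgt0Pr => e e0; rewrite add0e.
have cV : V x @[x --> q] --> V q by exact: V_continuous.
have /cvgrPdist_lt/(_ _ e0)[k /= k0 Vk] := cV.
have qk : q - k / 2 <= q by rewrite lerBlDr lerDl divr_ge0// ltW.
apply: (@le_trans _ _ (dStieltjes V `]q - k / 2, q]%classic)).
  apply: le_measure; rewrite ?inE//.
  by move=> _ ->; rewrite /= in_itv/= lexx andbT ltrBlDr ltrDl divr_gt0.
rewrite dStieltjes_ocitv// lee_fin (le_trans (ler_norm _))// ltW// Vk//=.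
by rewrite opprB addrC subrK gtr0_norm ?divr_gt0// ltr_pdivrMr// ltr_pMr// ltr1n.
Qed.

(** The restriction of [dV] to []s, T]] is a finite measure, as the process lemmas require, and the
    missing point [s] is no atom. *)
Lemma dStieltjes_restriction (s T : R) : s <= T ->
  exists m : {finite_measure set (measurableTypeR R) -> \bar R},
  [/\ forall q : R, m [set q] = 0%E, m (~` `]s, T]%classic) = 0%E &
      forall t u (g : R -> \bar R), s <= t -> u <= T ->
        (\int[dStieltjes V]_(r in `[t, u]) g r = \int[m]_(r in `[t, u]) g r)%E].
Proof.
move=> sT.
have mD : measurable (`]s, T]%classic : set (measurableTypeR R)) by exact: measurable_itv.
have fD : (dStieltjes V `]s, T]%classic < +oo)%E by rewrite dStieltjes_ocitv// ltry.
exists (mfrestr mD fD : {finite_measure set (measurableTypeR R) -> \bar R}).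
split.
- move=> q; apply/eqP; rewrite eq_le measure_ge0 andbT -(dStieltjes_atomless q).
  rewrite -[leLHS]/(dStieltjes V ([set q] `&` `]s, T]%classic)).
  apply: le_measure; rewrite ?inE; [|exact: measurable_set1|exact: subIsetl].
  by apply: measurableI => //; exact: measurable_set1.
- by rewrite -[LHS]/(dStieltjes V (~` `]s, T]%classic `&` `]s, T]%classic)) setICl measure0.
move=> t u g st uT; apply: eq_measure_integral => A mA Atu.
rewrite -[RHS]/(dStieltjes V (A `&` `]s, T]%classic)).
have mAI : measurable (A `&` `]s, T]%classic) by exact: measurableI.
have ms1 : measurable [set s] by exact: measurable_set1.
apply/eqP; rewrite eq_le; apply/andP; split; last first.
  by apply: le_measure; rewrite ?inE; [exact: mAI|exact: mA|exact: subIsetl].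
apply: (@le_trans _ _ (dStieltjes V ((A `&` `]s, T]%classic) `|` [set s]))).
  apply: le_measure; rewrite ?inE; [exact: mA|exact: measurableU|].
  move=> r Ar; have := Atu _ Ar; rewrite /= in_itv/= => /andP[tr ru].
  have := le_trans st tr; rewrite le_eqVlt => /orP[/eqP <-|sr]; first by right.
  by left; split => //=; rewrite in_itv/= sr (le_trans ru).
apply: (le_trans (measureU2 _ mAI ms1)).
by rewrite [X in (_ + X)%E](dStieltjes_atomless s) adde0.
Qed.

End stieltjes_restriction.

Section canonical_integrals.
Context (R : realType) (E : ptopologicalType) (T : R).
Hypotheses (polishE : polish_space R E) (T0 : 0 < T).
Local Notation Om := (Omega E T).
Local Notation F := (@filtration R E T).
Context (V : cumulative R R) (PP : R -> borel E -> probability Om R).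
Context (mu : R -> {finite_measure set (measurableTypeR R) -> \bar R}).
Hypothesis muP : forall s, s <= T ->
  [/\ forall q : R, mu s [set q] = 0%E, mu s (~` `]s, T]%classic) = 0%E &
      forall t u (g : R -> \bar R), s <= t -> u <= T ->
        (\int[dStieltjes V]_(r in `[t, u]) g r = \int[mu s]_(r in `[t, u]) g r)%E].
Implicit Types phi chi : measurableTypeR R * borel E -> R.

Local Notation along phi := (fun (q : R) (w : Om) => phi (q, X q w)).

Let sF s t : s <= t <= T -> sub_sigma (F t).
Proof. by move=> /andP[_ tT]; exact: sub_sigma_filtration. Qed.

Lemma path_integralE s (k : R -> \bar R) : s <= T ->
  (\int[dStieltjes V]_(r in `[s, T]) k r = \int[mu s]_r k (clamp s T r))%E.
Proof.
move=> sT; have [at0 ms dVm] := muP sT; rewrite dVm//; apply/esym.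
by apply: (msupp_integral ms) => r rI; rewrite clamp_id.
Qed.

Lemma dV_integral_Iint s t chi (w : Om) : s <= t <= T ->
  dV_integral V s t chi w = Iint s T (mu s) (along chi) t w.
Proof.
move=> /andP[st tT]; have sT := le_trans st tT; have [at0 ms dVm] := muP sT.
rewrite /dV_integral /Iint /Rintegral dVm//; congr fine.
rewrite [LHS]integral_mkcond; apply: integral_ae_congr.
apply: filterS (ae_supp ms) => r /= rI.
have {}rI : s < r <= T by move: rI; rewrite ?in_itv.
have /andP[sr rT] := rI.
rewrite patchE (@clamp_id _ s T r) ?(ltW sr)// indicE !mem_setE !in_itv/= (ltW sr)/=.
by case: (r <= t); rewrite ?mul1r ?mul0r.
Qed.

Lemma L2X_pint2 s x phi : 0 <= s <= T -> L2X V PP phi ->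
  pint2 (PP s x) s T (mu s) (along phi).
Proof.
move=> sI [mphi ip]; have /andP[s0 sT] := sI.
have pb := prog_joint sT (@sF s) (prog_borel_fun polishE s0 sT mphi).
split; first exact: pb.
apply: intg_prodP2; first exact: measurable_funX.
apply: le_lt_trans (ip s x sI); rewrite le_eqVlt; apply/orP; left; apply/eqP.
apply: eq_integral => w _; rewrite path_integralE//; apply: eq_integral => r _.
by rewrite normrX.
Qed.

Lemma pint_L1 s x phi : 0 <= s <= T -> pint (PP s x) s T (mu s) (along phi) ->
  (\int[PP s x]_w \int[dStieltjes V]_(r in `[s, T]) `|phi (r, X r w)|%:E < +oo)%E.
Proof.
move=> /andP[s0 sT] ip.
have mE := (measurable_EFinP _ _).2 (intg_meas ip).
have := (integrable21ltyP (mu s) (PP s x) mE).1 ip.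
apply: le_lt_trans; rewrite le_eqVlt; apply/orP; left; apply/eqP.
by apply: eq_integral => w _; rewrite path_integralE.
Qed.

Lemma pint_L0X phi : borel_fun T phi ->
  (forall s x, 0 <= s <= T -> pint (PP s x) s T (mu s) (along phi)) -> L0X V PP phi.
Proof.
move=> mphi ip; split => // s x sI; have /andP[s0 sT] := sI.
apply: filterS (pint_path (ip s x sI)) => w /intgP[_].
by rewrite path_integralE.
Qed.

Lemma L0X_path s x phi : 0 <= s <= T -> L0X V PP phi ->
  {ae PP s x, forall w, intg (mu s) (fun q => phi (clamp s T q, X (clamp s T q) w))}.
Proof.
move=> sI [mphi ip]; have /andP[s0 sT] := sI.
apply: filterS (ip s x sI) => w; rewrite path_integralE// => iw; apply/intgP; split => //.
have pb := prog_joint sT (@sF s) (prog_borel_fun polishE s0 sT mphi).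
exact: measurableT_comp pb (measurable_pair2 w).
Qed.

End canonical_integrals.

Lemma Iint_pint2 d (W : measurableType d) (R : realType) (P : probability W R)
  (F : R -> set (set W)) (s T : R) (m : {finite_measure set (measurableTypeR R) -> \bar R})
  (b : R -> W -> R) : s <= T -> (forall t, s <= t <= T -> sub_sigma (F t)) ->
  prog F s T b -> pint2 P s T m b -> pint2 P s T m (Iint s T m b).
Proof.
move=> sT sF pb b2.
pose a q w := `|b q w|; have a2 : pint2 P s T m a by exact: sqi_abs b2.
apply: (@pint2_bounded _ _ _ P F s T sT sF m _ (\int[P]_w (Iint s T m a T w ^+ 2)) (Iint_prog m pb)).
move=> t /andP[st tT]; have sI := Iint_sqi t b2; split; first exact: sI.
have sa := Iint_sqi T a2.
(* The domination by [Iint a T] holds on integrable paths only; taking the minimum makes it hold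
   everywhere. *)
rewrite (@Rint_ae _ _ _ P (fun w => Iint s T m b t w ^+ 2)
  (fun w => Num.min (Iint s T m b t w ^+ 2) (Iint s T m a T w ^+ 2))); last first.
  apply: filterS (pint_path (pint2_pint b2)) => w iw; apply/esym/min_l.
  rewrite -real_normK ?num_real// ler_sqr ?nnegrE//; last first.
    by apply: Rint_ge0 => q; rewrite mulr_ge0// /a normr_ge0.
  apply: le_trans (cumint_norm t iw) _; apply: cumint_nd => //.
  exact: intg_abs.
apply: Rint_le; [|exact: sa.2|by move=> w; rewrite ge_min lexx orbT].
apply: (@intg_le _ _ _ P _ (fun w => Iint s T m b t w ^+ 2)); last exact: sI.2.
  apply: measurable_minr; apply: measurable_funX; [exact: sI.1|exact: sa.1].
move=> w; rewrite !ger0_norm ?sqr_ge0 ?le_min ?sqr_ge0//.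
by rewrite ge_min lexx.
Qed.

(** * Measurability and integrability of the driver *)

Section growth.
Context (R : realType) (E : ptopologicalType) (T : R) (n : nat).
Variables (f : measurableTypeR R * borel E * R * n.-tuple R -> R).

Hypothesis T0 : 0 <= T.

(** [f], [u] and [v] are measurable on times in [[0, T]] only; composing with [rho] gives functions
    that are measurable everywhere. *)
Let rho (z : measurableTypeR R * borel E) : measurableTypeR R * borel E := (clamp 0 T z.1, z.2).

Let rho_dom z : time_dom T (rho z).
Proof. exact: clamp_itv. Qed.

Let mrho : measurable_fun setT rho.
Proof.
apply: measurable_fun_pair; last exact: measurable_snd.
exact: measurableT_comp (measurable_clamp 0 T) measurable_fst.
Qed.

Let measurable_rho (phi : measurableTypeR R * borel E -> R) : borel_fun T phi ->
  measurable_fun setT (fun z => phi (rho z)).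
Proof.
move=> mphi; apply: (@measurable_comp _ _ _ _ _ _ (time_dom T) phi _ rho) => //.
- exact: measurable_time_dom.
- by move=> _ [z _ <-]; exact: rho_dom.
Qed.

Lemma measurable_driver (u : measurableTypeR R * borel E -> R)
  (v : 'I_n -> measurableTypeR R * borel E -> R) :
  measurable_fun [set q | 0 <= q.1.1.1 <= T] f ->
  borel_fun T u -> (forall i, borel_fun T (v i)) -> borel_fun T (driver f u v).
Proof.
move=> mf mu mv; apply: (eq_measurable_fun (fun z => driver f u v (rho z))).
  move=> z /set_mem zI; rewrite (_ : rho z = z)// /rho clamp_id//; exact: esym (surjective_pairing z).
apply: measurable_funTS.
apply: (@measurable_comp _ _ _ _ _ _ [set q : measurableTypeR R * borel E * R * n.-tuple R | 0 <= q.1.1.1 <= T] f _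
  (fun z => (rho z, u (rho z), [tuple v i (rho z) | i < n]))) => //.
- rewrite (_ : mkset _ = (fun q : measurableTypeR R * borel E * R * n.-tuple R => q.1.1) @^-1` (time_dom T))//.
  have m11 := measurableT_comp (@measurable_fst _ _ (measurableTypeR R * borel E)%type R)
    (@measurable_fst _ _ (measurableTypeR R * borel E * R)%type (n.-tuple R)).
  by have := m11 measurableT _ (@measurable_time_dom R E T); rewrite setTI.
- by move=> _ [z zI <-]; exact: rho_dom.
- apply: measurable_fun_pair.
    by apply: measurable_fun_pair; [exact: mrho|exact: measurable_rho].
  apply/measurable_fun_tnthP => i.
  rewrite (_ : _ \o _ = fun z => v i (rho z)); first exact: measurable_rho.
  by apply/funext => z /=; rewrite tnth_mktuple.
Qed.

Lemma euclidean_norm_le (z : n.-tuple R) : euclidean_norm z <= \sum_(i < n) `|tnth z i|.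
Proof.
have s0 : 0 <= \sum_(i < n) `|tnth z i| by exact: sumr_ge0.
rewrite /euclidean_norm -[leRHS](ger0_norm s0) -sqrtr_sqr ler_wsqrtr//.
(* Nonnegativity is carried through the induction for the sake of the cross term of the square. *)
suff : \sum_(i < n) tnth z i ^+ 2 <= (\sum_(i < n) `|tnth z i|) ^+ 2 /\ 0 <= \sum_(i < n) `|tnth z i| by case.
elim/big_rec2 : _ => [|i a b _ [ab b0]]; first by rewrite expr0n.
split; last by rewrite addr_ge0.
rewrite sqrrD real_normK ?num_real//.
have := mulr_ge0 (normr_ge0 (tnth z i)) b0; nra.
Qed.

End growth.

Lemma sqi_sum d (W : measurableType d) (R : realType) (mu : {measure set W -> \bar R}) (n : nat)
  (k : 'I_n -> W -> R) : (forall i, sqi mu (k i)) -> sqi mu (fun w => \sum_(i < n) k i w).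
Proof.
move=> sk; rewrite (_ : (fun w => _) = \sum_(i < n) k i); last by apply/funext => w; rewrite fct_sumE.
elim/big_ind : _ => //; last by move=> f g; exact: sqiD.
have m0 : measurable_fun setT (0 : W -> R) by exact: measurable_cst.
split => //; apply/intgP; split; first exact: measurable_funX.
by rewrite integral0_eq ?ltry// => w _; rewrite expr0n normr0.
Qed.

Section growth_integrability.
Context (R : realType) (E : ptopologicalType) (T : R).
Hypotheses (polishE : polish_space R E) (T0 : 0 < T).
Local Notation Om := (Omega E T).
Local Notation F := (@filtration R E T).
Context (V : cumulative R R) (PP : R -> borel E -> probability Om R).
Context (mu : R -> {finite_measure set (measurableTypeR R) -> \bar R}).
Hypothesis muP : forall s, s <= T ->
  [/\ forall q : R, mu s [set q] = 0%E, mu s (~` `]s, T]%classic) = 0%E &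
      forall t u (g : R -> \bar R), s <= t -> u <= T ->
        (\int[dStieltjes V]_(r in `[t, u]) g r = \int[mu s]_(r in `[t, u]) g r)%E].
Variables (zeta eta : borel E -> R).
Hypotheses (mzeta : measurable_fun setT zeta) (meta : measurable_fun setT eta).
Hypothesis (zeta_ge0 : forall x, 0 <= zeta x) (eta_ge0 : forall x, 0 <= eta x).
Hypothesis mom : Hmom V PP zeta eta.
Variables (n : nat) (f : measurableTypeR R * borel E * R * n.-tuple R -> R) (g : borel E -> R).
Hypothesis growth : Hgrowth T zeta eta f g.
Local Notation along phi := (fun (q : R) (w : Om) => phi (q, X q w)).

Lemma terminal_sqi s x : 0 <= s <= T -> sqi (PP s x) (fun w => g (X T w)).
Proof.
move=> sI; have [_ mg [C C0 gC] _] := growth; have [mz _] := mom x sI.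
have TI : 0 <= T <= T by rewrite lexx ltW.
have mX := @measurable_X R E T T TI.
have mzX : measurable_fun setT (fun w : Om => zeta (X T w)) by exact: measurableT_comp mzeta mX.
have sz : sqi (PP s x) (fun w => zeta (X T w)).
  by apply: (ae_sq_integrable (M := fun w => zeta (X T w)) mzX mz); exact: aeW.
have sb := sqiZ C (sqiD (sqi_cst (PP s x) 1) sz).
apply: (sqi_le _ _ sb); first exact: measurableT_comp mg mX.
move=> w; rewrite [leRHS]ger0_norm; first exact: gC.
by apply: mulr_ge0; [exact: ltW|exact: addr_ge0].
Qed.

Lemma eta_L2X : L2X V PP (fun z => eta z.2).
Proof.
have me : borel_fun T (fun z : measurableTypeR R * borel E => eta z.2).
  by apply: measurable_funTS; exact: measurableT_comp meta measurable_snd.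
split => // s x sI; have /andP[s0 sT] := sI; have [_ ie] := mom x sI.
have T0' : 0 <= T by exact: ltW.
have [_ _ dV0] := muP T0'.
have me2 : borel_fun T (fun z : measurableTypeR R * borel E => eta z.2 ^+ 2).
  exact: measurable_funX.
apply: le_lt_trans ie; apply: ge0_le_integral => //.
- by move=> w _; apply: integral_ge0 => r _; rewrite lee_fin sqr_ge0.
- under eq_fun do rewrite dV0//.
  under eq_fun do under eq_integral do rewrite real_normK ?num_real//.
  exact: (measurable_path_integral polishE (mu 0) me2 (fun z => sqr_ge0 _) s0 sT).
- under eq_fun do rewrite dV0//.
  exact: (measurable_path_integral polishE (mu 0) me2 (fun z => sqr_ge0 _) (lexx 0) T0').
- move=> w _; under eq_integral do rewrite real_normK ?num_real//.
  apply: ge0_subset_integral => //.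
  + exact: (measurable_path polishE me2 w (lexx 0) T0').
  + by move=> r _; rewrite lee_fin sqr_ge0.
  + by move=> r; rewrite /= !in_itv/= => /andP[sr ->]; rewrite (le_trans s0 sr).
Qed.

(** The growth condition dominates the driver by a multiple of [1 + eta + |u| + sum |v_i|], and each
    of these terms is square integrable. *)
Lemma driver_pint2 (u : measurableTypeR R * borel E -> R)
  (v : 'I_n -> measurableTypeR R * borel E -> R) s x : 0 <= s <= T ->
  L2X V PP u -> (forall i, L2X V PP (v i)) ->
  pint2 (PP s x) s T (mu s) (along (driver f u v)).
Proof.
move=> sI u2 v2; have /andP[s0 sT] := sI.
have [mf _ _ [C C0 fC]] := growth.
have md := measurable_driver (ltW T0) mf u2.1 (fun i => (v2 i).1).
have sF t : s <= t <= T -> sub_sigma (F t) by move=> /andP[_ tT]; exact: sub_sigma_filtration.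
have se := L2X_pint2 polishE muP x sI eta_L2X.
have su := sqi_abs (L2X_pint2 polishE muP x sI u2).
have sv := sqi_sum (fun i => sqi_abs (L2X_pint2 polishE muP x sI (v2 i))).
have s1 : sqi (mu s \x PP s x)%E (fun=> 1).
  have p1 : prog F s T (fun _ _ => 1) by exact: prog_cst.
  by apply: (pint2_bounded sT sF (mu s) p1 (k := \int[PP s x]_w 1 ^+ 2)) => t tI; split => //; exact: sqi_cst.
have sb := sqiZ C (sqiD (sqiD (sqiD s1 se) su) sv).
apply: (sqi_le _ _ sb); first exact: (prog_joint sT sF (prog_borel_fun polishE s0 sT md)).
move=> z /=; rewrite [leRHS]ger0_norm; last first.
  by apply: mulr_ge0; [exact: ltW|apply: addr_ge0; [apply: addr_ge0; [apply: addr_ge0|]|exact: sumr_ge0]].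
rewrite /driver; set q := clamp s T z.1.
have qI : 0 <= q <= T by have /andP[h1 ->] := clamp_itv z.1 sT; rewrite (le_trans s0 h1).
apply: le_trans (fC q (X q z.2) _ _ qI) _; rewrite ler_pM2l// lerD2l.
apply: le_trans (euclidean_norm_le _) _.
by apply: ler_sum => i _; rewrite tnth_mktuple.
Qed.

End growth_integrability.

(** The exceptional null set in the hypothesis depends on [t]. Countably many discretized times
    share one, continuity of the indefinite integral reaches the other times, and [cumint_eq0]
    recovers the density. *)
Lemma Iint_ae_eq0 d (W : measurableType d) (R : realType) (P : probability W R) (s T : R)
  (m : {finite_measure set (measurableTypeR R) -> \bar R}) (c : R -> W -> R) :
  s <= T -> (forall q : R, m [set q] = 0%E) -> m (~` `]s, T]%classic) = 0%E ->
  {ae P, forall w, intg m (fun q => c (clamp s T q) w)} ->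
  (forall t, s <= t <= T -> {ae P, forall w, Iint s T m c t w = 0}) ->
  {ae P, forall w, {ae m, forall q : measurableTypeR R, c (clamp s T q) w = 0}}.
Proof.
move=> sT atomless msupp ic c0.
have D0 : {ae P, forall w, forall n k, Iint s T m c (disc_time s T n k) w = 0}.
  apply: (ae_foralln (P := fun n w => forall k, _)) => n.
  apply: (ae_foralln (P := fun k w => Iint s T m c (disc_time s T n k) w = 0)) => k.
  by apply: c0; exact: disc_time_itv.
apply: filterS2 ic D0 => w iw D0w; apply: (cumint_eq0 msupp iw) => t.
have cc := cumint_continuous atomless iw.
have clE : cumint m (fun q => c (clamp s T q) w) (clamp s T t) = 0.
  have dc := @disc_time_cvg R s T sT t.
  have lim1 := cvg_comp _ _ dc (cc (clamp s T t)).
  have lim2 : (cumint m (fun q => c (clamp s T q) w) \o (fun n => disc_time s T n (disc_index s T n t))) @ \oo --> (0 : R).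
    by apply: cvg_near_cst; apply: nearW => n /=; exact: D0w.
  exact: (cvg_unique _ lim1 lim2).
have [ts|st] := leP t s; first exact: (cumint_start msupp).
have [tT|Tt] := leP t T; first by rewrite -clE clamp_id// (ltW st).
rewrite (cumint_end msupp _ (ltW Tt)) -clE -(cumint_end msupp _ (_ : T <= clamp s T t))//.
by rewrite /clamp le_max le_min lexx (ltW Tt) orbT.
Qed.

Lemma martingaleS d (W : measurableType d) (R : realType) (P : probability W R)
  (F : R -> set (set W)) (a s T : R) (M : R -> W -> R) : a <= s ->
  martingale P F a T M -> martingale P F s T M.
Proof.
move=> as_ [mM iM eM]; split.
- by move=> t /andP[st tT]; apply: mM; rewrite (le_trans as_ st).
- by move=> t /andP[st tT]; apply: iM; rewrite (le_trans as_ st).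
- by move=> r t sr; apply: eM; exact: le_trans sr.
Qed.

Section cadlag_extension.
Context d (W : measurableType d) (R : realType) (P : probability W R) (F : R -> set (set W)) (s T : R).
Hypotheses (T0 : 0 < T) (s0 : 0 <= s) (sT : s <= T).
Hypothesis sF : forall t, 0 <= t <= T -> sub_sigma (F t).
Hypothesis monoF : forall r t, 0 <= r -> r <= t -> t <= T -> F r `<=` F t.
Hypothesis rcF : forall t, 0 <= t < T ->
  forall A, (forall u, t < u <= T -> F u A) -> F t A.

(** The process is extended by 0 before it is regularized: [H20] concerns all of [[0, T]], which
    unlike [[s, T]] is never reduced to a point, as [cadlag_modification] requires. *)
Lemma cadlag_H20 (Y : R -> W -> R) : rmart P F s T Y -> sqi P (Y T) ->
  {ae P, forall w, Y s w = 0} ->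
  exists M, [/\ forall t, 0 <= t <= T -> {ae P, forall w, M t w = if s <= t then Y t w else 0},
    cadlag_process P 0 T M & H20 P (fun t => completion P (F t)) T M].
Proof.
move=> mY sY Y0; have mZ := rmart_extend s0 sT sF monoF mY Y0.
set Z := (fun t w => _) in mZ.
have sZ : sqi P (Z T) by rewrite /Z sT.
have [M [ME cM]] := cadlag_modification T0 sF monoF rcF mZ sZ.
exists M; split => //; split; first split.
- exact: (rmart_martingale sF mZ ME).
- by move=> t tI; apply: sq_integrable_ae (ME t tI); exact: (rmart_sqi sF mZ sZ tI).1.
- have ZI : 0 <= (0 : R) <= T by rewrite lexx ltW.
  apply: filterS2 (ME 0 ZI) Y0 => w -> Y0w; rewrite /Z; case: leP => // h.
  have sE : s = 0 by apply/eqP; rewrite eq_le h s0.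
  by move: Y0w; rewrite sE.
Qed.

End cadlag_extension.

Lemma polish_measurable_set1 (R : realType) (E : ptopologicalType) (x : E) :
  polish_space R E -> measurable ([set x] : set (borel E)).
Proof.
move=> [_ [d [d0 dC dT _] dN]]; rewrite -[X in measurable X]setCK; apply: measurableC.
apply: sub_sigma_algebra; rewrite openE => y /= yx; apply/dN.
have d_ge0 : 0 <= d y x by have := dT y x y; rewrite (dC x y) ((d0 y y).2 erefl); lra.
exists (d y x).
  by rewrite lt_neqAle d_ge0 andbT eq_sym; apply/eqP => /d0.
by move=> z /= + zx; rewrite zx ltxx.
Qed.

(** * Decoupled mild solutions *)

Section mild_solution.
Context (R : realType) (E : ptopologicalType).
Hypothesis polishE : polish_space R E.
Variable T : R.
Hypothesis T0 : 0 < T.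
Variables (V : cumulative R R) (P : R -> R -> R.-pker (borel E) ~> (borel E)).
Hypothesis kernelP : transition_kernel T P.
Variable PP : R -> borel E -> probability (Omega E T) R.
Hypothesis markovPP : canonical_markov_class P PP.
Variables (Da : set (measurableTypeR R * borel E -> R))
  (a : (measurableTypeR R * borel E -> R) -> (measurableTypeR R * borel E -> R)).
Hypotheses (linear_a : linear_operator T Da a) (mart_pb : solves_martingale_problem V PP Da a).
Variables (n : nat) (psi : 'I_n -> measurableTypeR R * borel E -> R).
Hypotheses (psi_Da : forall i, Da (psi i)) (psi_L2 : forall i, L2X V PP (a (psi i))).
Variables zeta eta : borel E -> R.
Hypotheses (zeta_borel : measurable_fun setT zeta) (eta_borel : measurable_fun setT eta).
Hypotheses (zeta_ge0 : forall x, 0 <= zeta x) (eta_ge0 : forall x, 0 <= eta x).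
Hypothesis mom : Hmom V PP zeta eta.
Variables (f : measurableTypeR R * borel E * R * n.-tuple R -> R) (g : borel E -> R).
Hypothesis growth : Hgrowth T zeta eta f g.
Variable mu : R -> {finite_measure set (measurableTypeR R) -> \bar R}.
Hypothesis muP : forall s, s <= T ->
  [/\ forall q : R, mu s [set q] = 0%E, mu s (~` `]s, T]%classic) = 0%E &
      forall t u (g : R -> \bar R), s <= t -> u <= T ->
        (\int[dStieltjes V]_(r in `[t, u]) g r = \int[mu s]_(r in `[t, u]) g r)%E].
Variables (u : measurableTypeR R * borel E -> R) (v : 'I_n -> measurableTypeR R * borel E -> R).
Hypothesis sol : solves_IP V PP P a psi f g u v.

Local Notation Om := (Omega E T).
Local Notation F := (@filtration R E T).
Local Notation dr := (driver f u v).
Local Notation along phi := (fun (q : R) (w : Om) => phi (q, X q w)).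

Let u2 : L2X V PP u. Proof. by have [H _ _] := sol; exact: H. Qed.
Let v2 i : L2X V PP (v i). Proof. by have [_ H _] := sol; exact: H. Qed.
Let mdr : borel_fun T dr.
Proof.
have [mf _ _ _] := growth.
exact: (measurable_driver (ltW T0) mf u2.1 (fun i => (v2 i).1)).
Qed.
Let mg : measurable_fun setT g. Proof. by case: growth. Qed.
Let mpsi i : borel_fun T (psi i).
Proof. by have [_ H _ _] := linear_a; have [] := H _ (psi_Da i). Qed.
Let mapsi i : borel_fun T (a (psi i)). Proof. by case: (psi_L2 i). Qed.

Let dr_pint2 s x : 0 <= s <= T -> pint2 (PP s x) s T (mu s) (along dr).
Proof. by move=> sI; exact: (driver_pint2 polishE T0 muP eta_borel eta_ge0 mom growth). Qed.

Section at_start.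
Variables (s : R) (x : borel E).
Hypothesis sI : 0 <= s <= T.

Let s0 : 0 <= s. Proof. by case/andP: sI. Qed.
Let sT : s <= T. Proof. by case/andP: sI. Qed.
Let m := mu s.
Let atomless (q : R) : m [set q] = 0%E. Proof. by case: (muP sT). Qed.
Let msupp : m (~` `]s, T]%classic) = 0%E. Proof. by case: (muP sT). Qed.
Let dVm t r (k : R -> \bar R) : s <= t -> r <= T ->
  (\int[dStieltjes V]_(q in `[t, r]) k q = \int[m]_(q in `[t, r]) k q)%E.
Proof. by case: (muP sT) => _ _ + st rT; apply. Qed.

Let sF t : s <= t <= T -> sub_sigma (F t).
Proof. by move=> /andP[_ tT]; exact: sub_sigma_filtration. Qed.
Let monoF r t : s <= r -> r <= t -> t <= T -> F r `<=` F t.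
Proof. by move=> _; exact: filtration_mono. Qed.

Let pprog phi : borel_fun T phi -> prog F s T (along phi).
Proof. exact: prog_borel_fun. Qed.

Let running_L1 phi : (forall t y, 0 <= t <= T -> pint (PP t y) t T (mu t) (along phi)) ->
  forall t y, s <= t <= T -> (\int[PP t y]_w \int[m]_(r in `[t, T]) `|phi (r, X r w)|%:E < +oo)%E.
Proof.
move=> ip t y /andP[st tT]; have tI : 0 <= t <= T by rewrite (le_trans s0 st).
have := pint_L1 muP tI (ip t y tI).
by under eq_integral do rewrite dVm//.
Qed.

Let TI : s <= T <= T. Proof. by rewrite sT lexx. Qed.

Let g_intg t y : s <= t <= T -> (\int[PP t y]_w `|g (X T w)|%:E < +oo)%E.
Proof.
move=> /andP[st tT]; have tI : 0 <= t <= T by rewrite (le_trans s0 st).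
by have /sqi_intg/intgP[] := terminal_sqi T0 zeta_borel zeta_ge0 mom growth y tI.
Qed.

Let u_rep t y : s <= t <= T -> (u (t, y))%:E = (transition_op P t T g y +
    \int[m]_(r in `[t, T]) transition_op P t r (fun y' => dr (r, y')) y)%E.
Proof.
move=> /andP[st tT]; have tI : 0 <= t <= T by rewrite (le_trans s0 st).
by have [_ _ /(_ t y tI)[-> _]] := sol; rewrite dVm.
Qed.

Let M t (w : Om) := u (t, X t w) - u (s, x) + Iint s T m (along dr) t w.

Lemma solution_rmart : rmart (PP s x) F s T M.
Proof.
have Y := ip_rmart polishE T0 markovPP atomless x s0 sT msupp u2.1 mdr mg g_intg
  (running_L1 (fun t y tI => pint2_pint (dr_pint2 y tI))) u_rep.
have <- : (fun t (w : Om) => u (t, X t w) + Iint s T m (along dr) t w - u (s, x)) = M.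
  by apply: funext => t; apply: funext => w; rewrite /M addrAC.
exact: (rmartB sF Y (rmart_cst (PP s x) F s T (u (s, x)))).
Qed.

Lemma solution_terminal y : u (T, y) = g y.
Proof. exact: (ip_terminal T0 kernelP atomless sT mg u_rep y). Qed.

Lemma solution_sqi : sqi (PP s x) (M T).
Proof.
rewrite /M; under eq_fun do rewrite solution_terminal.
apply: sqiD; last exact: Iint_sqi (dr_pint2 x sI).
by apply: sqiB; [exact: (terminal_sqi T0 zeta_borel zeta_ge0 mom growth)|exact: sqi_cst].
Qed.

(* The set of paths equal to [x] on [0, s] need not be known to be measurable:
   the law of [X s] is read off the transition kernel instead. *)
Let X_start : {ae PP s x, forall w, X s w = x}.
Proof.
have mx := polish_measurable_set1 x polishE.
have mX := @measurable_X R E T s sI.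
exists (X s @^-1` (~` [set x])); split.
- by rewrite -[X in measurable X]setTI; apply: mX => //; exact: measurableC.
- have e := markovPP.1 s x s (~` [set x]) sI sI (measurableC mx).
  rewrite [LHS]e kernelP.1 ?lexx//; last exact: measurableC.
  by rewrite diracE memNset//= => h; exact: h.
- by move=> w /= h; exact: h.
Qed.

Let Iint_start (b : R -> Om -> R) w : Iint s T m b s w = 0.
Proof. exact: (cumint_start msupp). Qed.

Lemma solution_start : {ae PP s x, forall w, M s w = 0}.
Proof. by apply: filterS X_start => w Xw; rewrite /M Xw subrr add0r Iint_start. Qed.

Section component.
Variable i : 'I_n.
Let b := a (psi i).

Let N t (w : Om) := psi i (t, X t w) - psi i (s, x) - Iint s T m (along b) t w.

Let b_pint2 : pint2 (PP s x) s T m (along b).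
Proof. exact: (L2X_pint2 polishE muP x sI (psi_L2 i)). Qed.

(** The martingale problem speaks of the completed filtration; since [psi i] is Borel, the process
    itself is progressive for the raw one, and [martingale_rmart] applies. *)
Lemma psi_rmart : rmart (PP s x) F s T N /\ sqi (PP s x) (N T).
Proof.
have [_ /(_ _ (psi_Da i)) [_ /(_ s x sI) [_ [mN iN]]]] := mart_pb.
have NE t : s <= t <= T -> {ae PP s x, forall w, psi i (t, X t w) - dV_integral V s t b w =
    psi i (t, X t w) - Iint s T m (along b) t w}.
  by move=> tI; apply: aeW => w; rewrite (dV_integral_Iint muP).
have pS := pprog (mpsi i); have pI := Iint_prog m (pprog (mapsi i)).
have gY t : s <= t <= T -> gmeas (F t) (fun w => psi i (t, X t w) - Iint s T m (along b) t w).
  by move=> tI; exact: (prog_gmeas (progB pS pI) tI).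
have rY := martingale_rmart sF mN gY NE.
have sY := ae_sq_integrable (gmeas_meas (sF TI) (gY T TI)) (iN T TI) (NE T TI).
have NEq : (fun t w => psi i (t, X t w) - Iint s T m (along b) t w - psi i (s, x)) = N.
  by apply: funext => t; apply: funext => w; rewrite /N addrAC.
split; first by rewrite -NEq; exact: rmartB (rmart_cst _ _ _ _ _).
by rewrite -NEq; apply: sqiB => //; exact: sqi_cst.
Qed.

Lemma psi_start : {ae PP s x, forall w, N s w = 0}.
Proof. by apply: filterS X_start => w Xw; rewrite /N Xw subrr Iint_start subr0. Qed.

(** [psi i] along the path is the sum of the martingale [N], a constant and the integral of
    [a (psi i)], each of them square integrable in time and path. *)
Lemma psi_pint2 : pint2 (PP s x) s T m (along (psi i)).
Proof.
have [mN sN] := psi_rmart.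
have pS := pprog (mpsi i); have pb := pprog (mapsi i).
have pc : prog F s T (fun _ (_ : Om) => psi i (s, x)) by exact: prog_cst.
have pN : prog F s T N by apply: progB; [exact: progB|exact: Iint_prog].
have N2 : pint2 (PP s x) s T m N.
  by apply: (pint2_bounded sT sF m pN (k := \int[PP s x]_w (N T w ^+ 2))) => t tI; exact: (rmart_sqi sF mN sN tI).
have c2 : pint2 (PP s x) s T m (fun _ _ => psi i (s, x)).
  apply: (pint2_bounded sT sF m pc (k := \int[PP s x]_w (psi i (s, x) ^+ 2))) => t tI.
  by split => //; exact: sqi_cst.
have I2 := Iint_pint2 sT sF pb b_pint2.
have := sqiD (sqiD N2 c2) I2; congr sqi; apply/funext => z /=.
by rewrite /N addrAC subrK subrK.
Qed.

Lemma psi_sqi : sqi (PP s x) (fun w => psi i (T, X T w)).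
Proof.
have [_ sN] := psi_rmart.
have := sqiD (sqiD sN (sqi_cst (PP s x) (psi i (s, x)))) (Iint_sqi T b_pint2).
by congr sqi; apply/funext => w; rewrite /N addrAC subrK subrK.
Qed.

(* Needed at every starting point, while [psi_pint2] concerns [(s, x)]. *)
Hypothesis psi2 : forall t y, 0 <= t <= T -> pint2 (PP t y) t T (mu t) (along (psi i)).
Hypothesis psiT : forall t y, 0 <= t <= T -> sqi (PP t y) (fun w => psi i (T, X T w)).

Let h y := g y * psi i (T, y).
Let phi z := v i z + u z * b z - psi i z * dr z.

Let mphi : borel_fun T phi.
Proof.
have m1 := measurable_funM u2.1 (mapsi i); have m2 := measurable_funM (mpsi i) mdr.
exact: measurable_funB (measurable_funD (v2 i).1 m1) m2.
Qed.

Let mh : measurable_fun setT h.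
Proof.
apply: measurable_funM => //.
apply: (@measurable_comp _ _ _ _ _ _ (time_dom T) (psi i) _ (fun y : borel E => (T, y))).
- exact: measurable_time_dom.
- by move=> _ [y _ <-]; rewrite /time_dom/= lexx ltW.
- exact: mpsi.
- exact: measurable_pair1.
Qed.

Let pint_phi t y : 0 <= t <= T -> pint (PP t y) t T (mu t) (along phi).
Proof.
move=> tI; have vi := pint2_pint (L2X_pint2 polishE muP y tI (v2 i)).
have ub := pint2M (L2X_pint2 polishE muP y tI u2) (L2X_pint2 polishE muP y tI (psi_L2 i)).
have pd := pint2M (psi2 y tI) (dr_pint2 y tI).
exact: intgB (intgD vi ub) pd.
Qed.

Let h_intg t y : 0 <= t <= T -> (\int[PP t y]_w `|h (X T w)|%:E < +oo)%E.
Proof.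
move=> tI; have := sqiM (terminal_sqi T0 zeta_borel zeta_ge0 mom growth y tI) (psiT y tI).
by move/intgP => [].
Qed.

Let h_intgP t y : 0 <= t <= T -> intg (P t T y) h.
Proof.
move=> tI; apply/intgP; split; first exact: mh.
have T0' : 0 <= T <= T by rewrite lexx ltW.
have mah : measurable_fun setT (fun y => `|h y|%:E) by apply/measurable_EFinP; exact: measurableT_comp.
rewrite (@markov_marginal R E T P PP markovPP t T y (fun y => `|h y|%:E) tI T0' mah)//.
exact: h_intg.
Qed.

(** The second equation of the system has a minus sign before the time integral; it is negated to
    take the form expected by [ip_rmart], and [product_rmart] changes the sign back. *)
Let neg_rep t y : s <= t <= T -> (- (u (t, y) * psi i (t, y)))%:E =
  (transition_op P t T (fun y => (- h y)%R) y +
   \int[m]_(r in `[t, T]) transition_op P t r (fun y' => phi (r, y')) y)%E.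
Proof.
move=> /andP[st tT]; have tI : 0 <= t <= T by rewrite (le_trans s0 st).
have [_ _ /(_ t y tI)[_ /(_ i)]] := sol; rewrite dVm//.
rewrite -/(phi _); set I := (\int[m]_(r in _) _)%E => e.
have ih := h_intgP y tI.
have e1 : transition_op P t T h y = (\int[P t T y]_y' h y')%:E by rewrite (Rint_EFin ih).
have e2 : transition_op P t T (fun y => (- h y)%R) y = (- \int[P t T y]_y' h y')%:E.
  by rewrite -(RintN ih) (Rint_EFin (intgN ih)).
(* An infinite [I] would contradict the equation, whose left side and first term are real
   numbers. *)
move: e; rewrite -/(h) [transition_op P t T _ y]e1 e2; case: I => [r| |]//.
by rewrite -EFinB -EFinD => -[->]; rewrite opprB addrC.
Qed.

Lemma product_rmart : rmart (PP s x) F s T (fun t w => u (t, X t w) * psi i (t, X t w) -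
  Iint s T m (fun q w => v i (q, X q w) + u (q, X q w) * b (q, X q w) -
    psi i (q, X q w) * dr (q, X q w)) t w).
Proof.
have mq : borel_fun T (fun z => - (u z * psi i z)).
  by apply: measurableT_comp => //; exact: measurable_funM u2.1 (mpsi i).
have mnh : measurable_fun setT (fun y => - h y) by exact: measurableT_comp.
have nh_intg t y : s <= t <= T -> (\int[PP t y]_w `|- h (X T w)|%:E < +oo)%E.
  move=> /andP[st tT]; have tI : 0 <= t <= T by rewrite (le_trans s0 st).
  by under eq_integral do rewrite normrN; exact: h_intg.
have Y := ip_rmart polishE T0 markovPP atomless x s0 sT msupp mq mphi mnh nh_intg
  (running_L1 pint_phi) neg_rep.
have := rmartZ sF (-1) Y; congr rmart; apply: funext => t; apply: funext => w.
by rewrite mulN1r opprD opprK.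
Qed.

Lemma bracket_rmart : rmart (PP s x) F s T
  (fun t w => M t w * N t w - Iint s T m (along (v i)) t w).
Proof.
have [mN sN] := psi_rmart.
have vi := pint2_pint (L2X_pint2 polishE muP x sI (v2 i)).
exact: (rmart_bracket sT sF monoF atomless msupp (pprog u2.1) (pprog (mpsi i)) (pprog mdr)
  (pprog (mapsi i)) (pprog (v2 i).1) (dr_pint2 x sI) b_pint2 vi solution_rmart mN
  solution_sqi sN product_rmart).
Qed.

End component.
End at_start.

Let pcst s c : prog F s T (fun _ (_ : Om) => c). Proof. exact: prog_cst. Qed.

Let subrB_cancel (A B C : R) : A - B - (A - C) = C - B.
Proof. by rewrite opprB addrC addrA subrK. Qed.

Let sF0 t : 0 <= t <= T -> sub_sigma (F t).
Proof. by move=> /andP[_ tT]; exact: sub_sigma_filtration. Qed.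
Let monoF0 r t : 0 <= r -> r <= t -> t <= T -> F r `<=` F t.
Proof. by move=> _; exact: filtration_mono. Qed.
Let rcF0 t : 0 <= t < T -> forall A : set Om, (forall u, t < u <= T -> F u A) -> F t A.
Proof. by move=> /andP[_ tT]; exact: filtration_rc. Qed.
Let sFs s t : 0 <= s -> s <= t <= T -> sub_sigma (F t).
Proof. by move=> _ /andP[_ tT]; exact: sub_sigma_filtration. Qed.
Let monoFs s r t : 0 <= s -> s <= r -> r <= t -> t <= T -> F r `<=` F t.
Proof. by move=> _ _; exact: filtration_mono. Qed.

Let psi2 i t y : 0 <= t <= T -> pint2 (PP t y) t T (mu t) (along (psi i)).
Proof. by move=> tI; exact: psi_pint2. Qed.
Let psiT i t y : 0 <= t <= T -> sqi (PP t y) (fun w => psi i (T, X T w)).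
Proof. by move=> tI; exact: psi_sqi. Qed.

Let mndr : borel_fun T (fun z => - dr z).
Proof. exact: measurableT_comp. Qed.

Let dr_path s x : 0 <= s <= T -> {ae PP s x, forall w : Om,
  intg (mu s) (fun q => dr (clamp s T q, X (clamp s T q) w))}.
Proof. by move=> sI; exact: pint_path (pint2_pint (dr_pint2 x sI)). Qed.

Let Iint_dr s x : 0 <= s <= T -> {ae PP s x, forall w : Om, forall t,
  Iint s T (mu s) (along (fun z => - dr z)) t w = - Iint s T (mu s) (along dr) t w}.
Proof.
move=> sI; apply: filterS (dr_path x sI) => w iw t.
rewrite -mulN1r -[RHS](cumintZ (-1) t iw); apply: cumint_ae; apply: aeW => q.
by rewrite mulN1r.
Qed.

Let ndr_L0X : L0X V PP (fun z => - dr z).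
Proof.
apply: (pint_L0X muP mndr) => s x sI.
exact: intgN (pint2_pint (dr_pint2 x sI)).
Qed.

Let v_L0X i : L0X V PP (v i).
Proof.
apply: (pint_L0X muP (v2 i).1) => s x sI.
exact: pint2_pint (L2X_pint2 polishE muP x sI (v2 i)).
Qed.

Let apsi_L0X i : L0X V PP (a (psi i)).
Proof. by have [_ /(_ _ (psi_Da i)) []] := mart_pb. Qed.

Lemma solution_part s x : 0 <= s <= T -> exists M,
  martingale_part_of V PP u (fun z => - dr z) s x M /\
  forall t, 0 <= t <= T -> {ae PP s x, forall w, M t w =
    if s <= t then u (t, X t w) - u (s, x) + Iint s T (mu s) (along dr) t w else 0}.
Proof.
move=> sI; have /andP[s0 sT] := sI.
have [M [ME cM hM]] := cadlag_H20 T0 s0 sT sF0 monoF0 rcF0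
  (solution_rmart x sI) (solution_sqi x sI) (solution_start x sI).
exists M; split=> //; split => // t tI; have /andP[_ tT] := tI.
apply: filterS2 (ME t tI) (Iint_dr x sI) => w -> Iw; case: ifP => // st.
by rewrite (dV_integral_Iint muP) ?st// Iw opprK.
Qed.

Lemma psi_part i s x : 0 <= s <= T -> exists N,
  martingale_part_of V PP (psi i) (a (psi i)) s x N /\
  forall t, 0 <= t <= T -> {ae PP s x, forall w, N t w =
    if s <= t then psi i (t, X t w) - psi i (s, x) - Iint s T (mu s) (along (a (psi i))) t w else 0}.
Proof.
move=> sI; have /andP[s0 sT] := sI; have [rN sN] := psi_rmart x sI i.
have [N [NE cN hN]] := cadlag_H20 T0 s0 sT sF0 monoF0 rcF0 rN sN (psi_start x sI i).
exists N; split=> //; split => // t tI; have /andP[_ tT] := tI.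
apply: filterS (NE t tI) => w ->; case: ifP => // st.
by rewrite (dV_integral_Iint muP) ?st.
Qed.

Lemma frak_a_solution : frak_a V PP u (fun z => - dr z).
Proof.
split; [exact: u2.1|exact: ndr_L0X|move=> s x sI].
by have [M [hM _]] := solution_part x sI; exists M.
Qed.

Lemma frak_a_psi i : frak_a V PP (psi i) (a (psi i)).
Proof.
split; [exact: mpsi|exact: apsi_L0X|move=> s x sI].
by have [N [hN _]] := psi_part i x sI; exists N.
Qed.

Lemma frakG_solution i : frakG V PP (psi i) u (v i).
Proof.
split; first exact: v_L0X.
move=> s x sI; have /andP[s0 sT] := sI; have [at0 ms _] := muP sT.
have [M [hM ME]] := solution_part x sI; have [N [hN NE]] := psi_part i x sI.
have pv := prog_borel_fun polishE s0 sT (v2 i).1.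
have iv := pint2_pint (L2X_pint2 polishE muP x sI (v2 i)).
have mMN := bracket_rmart x sI (psi2 i) (psiT i).
have [B [hB BE]] := is_angle_bracket_Iint T0 s0 sT sF0 monoF0 at0 ms pv iv mMN
  (solution_start x sI) ME NE.
exists M, N, B; split => //.
- by exists (fun z => - dr z) => //; exact: frak_a_solution.
- by exists (a (psi i)) => //; exact: frak_a_psi.
apply: filterS BE => w Bw t tI; rewrite Bw// (dV_integral_Iint muP)//.
by have /andP[_ tT] := tI; rewrite le_max lexx orbT ge_max tT.
Qed.

(** The shared core of both uniqueness statements below: a difference of two integrals that is a
    martingale is a martingale of finite variation, to which [rmart_Iint_eq0] applies. *)
Let Iint_sub_eq0 s x (k chi : measurableTypeR R * borel E -> R) : 0 <= s <= T ->
  borel_fun T k -> borel_fun T chi ->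
  {ae PP s x, forall w : Om, intg (mu s) (fun q => k (clamp s T q, X (clamp s T q) w))} ->
  {ae PP s x, forall w : Om, intg (mu s) (fun q => chi (clamp s T q, X (clamp s T q) w))} ->
  rmart (PP s x) F s T (fun t w => Iint s T (mu s) (along chi) t w - Iint s T (mu s) (along k) t w) ->
  {ae PP s x, forall w : Om, intg (mu s) (fun q => chi (clamp s T q, X (clamp s T q) w) - k (clamp s T q, X (clamp s T q) w))} /\
  forall t, s <= t <= T -> {ae PP s x, forall w,
    Iint s T (mu s) (fun q w => chi (q, X q w) - k (q, X q w)) t w = 0 /\
    Iint s T (mu s) (along chi) t w = Iint s T (mu s) (along k) t w}.
Proof.
move=> sI mk mchi ik ichi rD; have /andP[s0 sT] := sI; have [at0 ms _] := muP sT.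
have pk := prog_borel_fun polishE s0 sT mk; have pchi := prog_borel_fun polishE s0 sT mchi.
have pc := progB pchi pk.
have ic : {ae PP s x, forall w : Om, intg (mu s) (fun q => chi (clamp s T q, X (clamp s T q) w) - k (clamp s T q, X (clamp s T q) w))}.
  by apply: filterS2 ik ichi => w h1 h2; exact: intgB.
have cE t : {ae PP s x, forall w, Iint s T (mu s) (along chi) t w - Iint s T (mu s) (along k) t w =
    Iint s T (mu s) (fun q w => chi (q, X q w) - k (q, X q w)) t w}.
  by apply: filterS2 ik ichi => w h1 h2; rewrite [RHS](cumintB t h2 h1).
have rc := rmart_ae (fun t => @sFs s t s0) rD (fun t tI => Iint_gmeas (mu s) pc tI) (fun t _ => cE t).
have z := rmart_Iint_eq0 sT (fun t => @sFs s t s0) (fun r t => @monoFs s r t s0) at0 ms pc rc ic.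
split => // t tI; apply: filterS2 (z t tI) (cE t) => w zw e; split => //.
by apply/eqP; rewrite -subr_eq0 e zw.
Qed.

(** The definition of [frakG] lets the martingale parts come from any version [chi] of the extended
    generator. Two drifts of the same process differ by a martingale of finite variation, so the
    version does not matter. *)
Lemma martingale_part_unique s x (phi k chi : measurableTypeR R * borel E -> R) (M : R -> Om -> R) :
  0 <= s <= T -> borel_fun T phi -> L0X V PP k -> L0X V PP chi ->
  rmart (PP s x) F s T (fun t w => phi (t, X t w) - phi (s, x) - Iint s T (mu s) (along k) t w) ->
  martingale_part_of V PP phi chi s x M ->
  forall t, s <= t <= T -> {ae PP s x, forall w, M t w =
    phi (t, X t w) - phi (s, x) - Iint s T (mu s) (along k) t w}.
Proof.
move=> sI mphi kL chiL rk [ME _ [[mM _] _]]; have /andP[s0 sT] := sI.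
have ME' t : s <= t <= T -> {ae PP s x, forall w, M t w =
    phi (t, X t w) - phi (s, x) - Iint s T (mu s) (along chi) t w}.
  move=> /andP[st tT]; have tI : 0 <= t <= T by rewrite (le_trans s0 st).
  by apply: filterS (ME t tI) => w ->; rewrite st (dV_integral_Iint muP)// st.
have pphi := prog_borel_fun polishE s0 sT mphi.
have pchi := prog_borel_fun polishE s0 sT chiL.1.
have pY := progB (progB pphi (@pcst s (phi (s, x)))) (Iint_prog (mu s) pchi).
have rchi := martingale_rmart (fun t => @sFs s t s0) (martingaleS s0 mM) (fun t tI => prog_gmeas pY tI) ME'.
have rD := rmartB (fun t => @sFs s t s0) rk rchi.
have rD' : rmart (PP s x) F s T (fun t w => Iint s T (mu s) (along chi) t w - Iint s T (mu s) (along k) t w).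
  move: rD; congr rmart; apply: funext => t; apply: funext => w.
  exact: subrB_cancel.
have [_ eqI] := Iint_sub_eq0 sI kL.1 chiL.1 (L0X_path polishE muP x sI kL) (L0X_path polishE muP x sI chiL) rD'.
by move=> t tI; apply: filterS2 (ME' t tI) (eqI t tI) => w -> [_ ->].
Qed.

Lemma frakG_unique i w0 : frakG V PP (psi i) u w0 -> eq_zero_potential V PP (v i) w0.
Proof.
move=> [wL0 Hw].
have md : borel_fun T (fun z => v i z - w0 z) := measurable_funB (v2 i).1 wL0.1.
exists [set z | time_dom T z /\ v i z <> w0 z]; last first.
  by move=> z zI nA; apply: contrapT => h; apply: nA.
split; [|by move=> z []|move=> s x sI].
  rewrite (_ : [set _ | _] = time_dom T `&` (fun z => v i z - w0 z) @^-1` (~` [set 0])).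
    by apply: md; [exact: measurable_time_dom|apply: measurableC; exact: measurable_set1].
  apply/seteqP; split => z /= [zI h]; split => //; last by move=> e; apply: h; rewrite e subrr.
  by move=> /subr0_eq.
have /andP[s0 sT] := sI; have [at0 ms _] := muP sT.
have [M [N [A [[chi [_ chiL _] hM] [chi' [_ chi'L _] hN] [_ _ _ _ mA] AE]]]] := Hw s x sI.
(* The solution's martingale rewritten with drift [- dr], in the form used by
   [martingale_part_unique]. *)
have rU : rmart (PP s x) F s T (fun t w => u (t, X t w) - u (s, x) -
    Iint s T (mu s) (along (fun z => - dr z)) t w).
  have pu := prog_borel_fun polishE s0 sT u2.1; have pd := prog_borel_fun polishE s0 sT mndr.
  have pY := progB (progB pu (@pcst s (u (s, x)))) (Iint_prog (mu s) pd).
  apply: (rmart_ae (fun t => @sFs s t s0) (solution_rmart x sI) (fun t tI => prog_gmeas pY tI)) => t tI.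
  by apply: filterS (Iint_dr x sI) => w ->; rewrite opprK.
have MU := martingale_part_unique sI u2.1 ndr_L0X chiL rU hM.
have [rN _] := psi_rmart x sI i.
have NU := martingale_part_unique sI (mpsi i) (apsi_L0X i) chi'L rN hN.
have mMN := bracket_rmart x sI (psi2 i) (psiT i).
have pw := prog_borel_fun polishE s0 sT wL0.1; have pv := prog_borel_fun polishE s0 sT (v2 i).1.
have pU := prog_borel_fun polishE s0 sT u2.1; have pS := prog_borel_fun polishE s0 sT (mpsi i).
have pd := prog_borel_fun polishE s0 sT mdr; have pb := prog_borel_fun polishE s0 sT (mapsi i).
have pM := progD (progB pU (@pcst s (u (s, x)))) (Iint_prog (mu s) pd).
have pN := progB (progB pS (@pcst s (psi i (s, x)))) (Iint_prog (mu s) pb).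
have pY := progB (progM pM pN) (Iint_prog (mu s) pw).
have EA t : s <= t <= T -> {ae PP s x, forall w, M t w * N t w - A t w =
    (u (t, X t w) - u (s, x) + Iint s T (mu s) (along dr) t w) *
    (psi i (t, X t w) - psi i (s, x) - Iint s T (mu s) (along (a (psi i))) t w) -
    Iint s T (mu s) (along w0) t w}.
  move=> tI; have /andP[st tT] := tI; have tI0 : 0 <= t <= T by rewrite (le_trans s0 st).
  have H1 : {ae PP s x, forall w, M t w = u (t, X t w) - u (s, x) + Iint s T (mu s) (along dr) t w}.
    by apply: filterS2 (MU t tI) (Iint_dr x sI) => w -> ->; rewrite opprK.
  apply: filterS3 H1 (NU t tI) AE => w -> -> /(_ t tI0) ->.
  by rewrite max_l// (dV_integral_Iint muP).
have rMA := martingale_rmart (fun t => @sFs s t s0) (martingaleS s0 mA) (fun t tI => prog_gmeas pY tI) EA.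
(* Both martingales contain the same product, so their difference reduces to the difference of the
   integrals of [w0] and [v i]. *)
have rD := rmartB (fun t => @sFs s t s0) mMN rMA.
have rD' : rmart (PP s x) F s T (fun t w => Iint s T (mu s) (along w0) t w - Iint s T (mu s) (along (v i)) t w).
  move: rD; congr rmart; apply: funext => t; apply: funext => w.
  exact: subrB_cancel.
have [ic eqI] := Iint_sub_eq0 sI (v2 i).1 wL0.1 (L0X_path polishE muP x sI (v_L0X i)) (L0X_path polishE muP x sI wL0) rD'.
have eq0 t : s <= t <= T -> {ae PP s x, forall w, Iint s T (mu s) (fun q w => w0 (q, X q w) - v i (q, X q w)) t w = 0}.
  by move=> tI; apply: filterS (eqI t tI) => w [].
have z := Iint_ae_eq0 sT at0 ms ic eq0.
have e0 d' (Z : measurableType d') (nu : {measure set Z -> \bar R}) (k : Z -> \bar R) :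
    {ae nu, forall y, k y = 0%E} -> (\int[nu]_y k y = 0)%E.
  move=> k0; rewrite -(integral0 nu setT); exact: integral_ae_congr.
apply: (e0); apply: filterS z => w zw.
rewrite (path_integralE muP)//; apply: e0.
apply: filterS zw => q /= /subr0_eq e; rewrite indicE memNset//= => -[_].
by rewrite e.
Qed.

End mild_solution.

Theorem proposition5p16 (R : realType) (E : ptopologicalType)
  (polishE : polish_space R E)
  (T : R) (T_gt0 : 0 < T)
  (V : cumulative R R) (V_continuous : continuous V) (V0 : V 0 = 0)
  (P : R -> R -> R.-pker (borel E) ~> (borel E))
  (kernelP : transition_kernel T P) (timeP : measurable_in_time T P)
  (PP : R -> borel E -> probability (Omega E T) R)
  (markovPP : canonical_markov_class P PP)
  (Da : set (measurableTypeR R * borel E -> R))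
  (a : (measurableTypeR R * borel E -> R) ->
       (measurableTypeR R * borel E -> R))
  (linear_a : linear_operator T Da a)
  (mart_pb : solves_martingale_problem V PP Da a)
  (n : nat) (psi : 'I_n -> measurableTypeR R * borel E -> R)
  (psi_Da : forall i, Da (psi i))
  (psi_ac : forall i, bracket_abs_continuous V PP (psi i))
  (psi_L2 : forall i, L2X V PP (a (psi i)))
  (psi_bounded : forall i, exists2 h, frakG V PP (psi i) (psi i) h &
     exists C : R, forall z, time_dom T z -> `|h z| <= C)
  (zeta eta : borel E -> R)
  (zeta_borel : measurable_fun setT zeta) (eta_borel : measurable_fun setT eta)
  (zeta_ge0 : forall x, 0 <= zeta x) (eta_ge0 : forall x, 0 <= eta x)
  (mom : Hmom V PP zeta eta)
  (f : measurableTypeR R * borel E * R * n.-tuple R -> R) (g : borel E -> R)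
  (growth : Hgrowth T zeta eta f g) :
  (forall u, decoupled_mild_solution V PP P a psi f g u ->
     martingale_solution V PP psi f g u) /\
  (forall u v, solves_IP V PP P a psi f g u v ->
     forall i w, frakG V PP (psi i) u w -> eq_zero_potential V PP (v i) w).
Proof.
(* The bound [s <= T] sits inside the existential, so that the axiom of choice gives one family [mu]
   defined for all real [s]; for [s > T] any finite measure will do. *)
have restr s : exists m : {finite_measure set (measurableTypeR R) -> \bar R}, s <= T ->
  [/\ forall q : R, m [set q] = 0%E, m (~` `]s, T]%classic) = 0%E &
      forall t u (g : R -> \bar R), s <= t -> u <= T ->
        (\int[dStieltjes V]_(r in `[t, u]) g r = \int[m]_(r in `[t, u]) g r)%E].
  have [sT|Ts] := leP s T.
    by have [m mP] := dStieltjes_restriction V_continuous sT; exists m.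
  by have [m _] := dStieltjes_restriction V_continuous (lexx T); exists m.
have [mu muP] := boolp.choice restr.
split=> [u [v sol]|u v sol i w].
- have fa := frak_a_solution polishE T_gt0 kernelP markovPP zeta_borel
    eta_borel zeta_ge0 eta_ge0 mom growth muP sol.
  split.
  + by case: fa.
  + by eexists; exact: fa.
  + exists v; last exact: fa.
    by move=> i; exact: (frakG_solution polishE T_gt0 kernelP markovPP linear_a mart_pb psi_Da psi_L2
      zeta_borel eta_borel zeta_ge0 eta_ge0 mom growth muP sol).
  + have TI : 0 <= T <= T by rewrite lexx ltW.
    exact: (solution_terminal T_gt0 kernelP growth muP sol TI).
- exact: (frakG_unique polishE T_gt0 kernelP markovPP linear_a mart_pb psi_Da psi_L2
      zeta_borel eta_borel zeta_ge0 eta_ge0 mom growth muP sol).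
Qed.
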